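(* Let $X\neq\{0\}$ be a complex Banach space with open unit ball $\mathbb{B}$ and let $\frac12\le\lambda\le 1$. Let $g:\mathbb{B}\to\mathbb{C}$ be holomorphic with $g(0)=1$, define $F(x)=g(x)x$ for $x\in\mathbb{B}$, and suppose that $F\in\widehat{\mathcal{F}}_{\lambda}(\mathbb{B})$. Then for every $x_0\in X$ with $\|x_0\|=1$ (and every $T_{x_0}\in T(x_0)$), $$|J_{2,3}(F)|\le\frac{(1+2\lambda)(7+2\lambda)^{3/2}}{36\sqrt{3(9-4\lambda^2)}},\qquad\text{where } J_{2,3}(F)=A_2A_3-A_4 .$$ The inequality is sharp: for every $\lambda\in[\frac12,1]$ there exist such an $F$, $x_0$ and $T_{x_0}$ for which equality holds.
   Context: $X$ is a complex Banach space with norm $\|\cdot\|$ and $\mathbb{B}=\{x\in X:\|x\|<1\}$. For $x\in X\setminus\{0\}$, $T(x)$ is the set of bounded linear functionals $T_x:X\to\mathbb{C}$ with $T_x(x)=\|x\|$ and $\|T_x\|=1$. $D^nF(x)$ denotes the $n$th Fréchet derivative of $F$ at $x$ (a bounded symmetric $n$-linear map $X^n\to X$). A holomorphic map $F:\mathbb{B}\to X$ is normalized if $F(0)=0$ and $DF(0)=I$; it is locally biholomorphic if $DF(x)$ is invertible with bounded inverse for every $x\in\mathbb{B}$. For $\frac12\le\lambda\le1$, $\widehat{\mathcal{F}}_{\lambda}(\mathbb{B})$ is the class of normalized locally biholomorphic maps $F:\mathbb{B}\to X$ such that $$\operatorname{Re}\left\{T_x\left(\frac{(DF(x))^{-1}\bigl(D^2F(x)(x,x)+DF(x)x\bigr)}{\|x\|}\right)\right\}\ge\frac12-\lambda$$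 for every $x\in\mathbb{B}\setminus\{0\}$ and every $T_x\in T(x)$. For $\|x_0\|=1$ and $T_{x_0}\in T(x_0)$, put $A_n=\frac{1}{n!}T_{x_0}\bigl(D^nF(0)(x_0,\ldots,x_0)\bigr)$ for $n=2,3,4$. *)

(* Defs.v *)
From HB Require Import structures.
From mathcomp Require Import all_boot all_order all_algebra.
From mathcomp Require Import complex.
From mathcomp Require Import boolp classical_sets functions reals.
From mathcomp Require Import topology normedtype derive exp.

Set Implicit Arguments.
Unset Strict Implicit.
Unset Printing Implicit Defensive.

Import Order.TTheory GRing.Theory Num.Theory.
Import numFieldNormedType.Exports.

Local Open Scope classical_set_scope.
Local Open Scope complex_scope.
Local Open Scope ring_scope.

Section BoundedOperators.
Variables (R : realType) (V W : normedModType R[i]).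

Definition bounded_op_pred : {pred V -> W} :=
  fun f => `[< linear f /\ continuous f >].

Lemma bounded_op_predP (f : V -> W) :
  reflect (linear f /\ continuous f) (f \in bounded_op_pred).
Proof. exact: asboolP. Qed.

Lemma bounded_op_submod_closed : submod_closed bounded_op_pred.
Proof.
split=> [|a f g /bounded_op_predP[lf cf] /bounded_op_predP[lg cg]].
  apply/bounded_op_predP; split=> [b u v|x].
    by rewrite scaler0 addr0.
  exact: cvg_cst.
apply/bounded_op_predP; split=> [b u v|x].
  rewrite !fctE lf lg !scalerDr !scalerA (mulrC a b) -!addrA; congr (_ + _).
  by rewrite addrCA.
by apply: cvgD; [apply: cvgZr; exact: cf | exact: cg].
Qed.

HB.instance Definition _ := GRing.isSubmodClosed.Build R[i] (V -> W)
  bounded_op_pred bounded_op_submod_closed.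

(* Bounded (= continuous) linear operators. *)
Record bounded_op := BoundedOp {
  bounded_op_fun :> V -> W ;
  _ : bounded_op_fun \in bounded_op_pred
}.

HB.instance Definition _ := [isSub for bounded_op_fun].
HB.instance Definition _ := [Choice of bounded_op by <:].
HB.instance Definition _ := [SubChoice_isSubLmodule of bounded_op by <:].

Lemma bounded_op_linear (A : bounded_op) : linear A.
Proof. by have [] := elimT (bounded_op_predP A) (valP A). Qed.

Lemma bounded_op_continuous (A : bounded_op) : continuous A.
Proof. by have [] := elimT (bounded_op_predP A) (valP A). Qed.

HB.instance Definition _ (A : bounded_op) :=
  GRing.isLinear.Build R[i] V W *:%R A (@bounded_op_linear A).

(* Norms over R[i] are R[i]-valued: the supremum is taken in R, then embedded. *)
Definition unit_values (A : bounded_op) : set R :=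
  [set complex.Re `|A x| | x in [set x : V | `|x| <= 1]].

Definition opnorm (A : bounded_op) : R[i] := (sup (unit_values A))%:C.

Lemma norm_ReE (U : normedModType R[i]) (u : U) : (complex.Re `|u|)%:C = `|u|.
Proof. by apply: RRe_real; exact: normr_real. Qed.

Lemma has_sup_unit_values (A : bounded_op) : has_sup (unit_values A).
Proof.
split; first by exists (complex.Re `|A 0|), 0; rewrite //= normr0.
have /linear_bounded_continuous/linear_boundedP := @bounded_op_continuous A.
move=> /pinfty_ex_gt0[M M0 AM]; exists (complex.Re M) => _ [x /= x1 <-].
have : `|A x| <= M.
  by rewrite (le_trans (AM x))// -[leRHS]mulr1 ler_pM2l.
by rewrite lecE => /andP[].
Qed.

Lemma opnorm_ge0 (A : bounded_op) : 0 <= opnorm A.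
Proof.
rewrite ler0c -[leLHS](_ : complex.Re `|A 0| = 0).
  by apply: (sup_upper_bound (has_sup_unit_values A)); exists 0; rewrite //= normr0.
by rewrite linear0 normr0.
Qed.

Lemma ler_opnorm (A : bounded_op) (x : V) : `|A x| <= opnorm A * `|x|.
Proof.
have [->|x0] := eqVneq x 0; first by rewrite linear0 !normr0 mulr0.
have nx0 : 0 < `|x| by rewrite normr_gt0.
rewrite -ler_pdivrMr// mulrC -[X in X * _]ger0_norm ?invr_ge0//.
rewrite -normrZ -linearZ -[leLHS]norm_ReE lecR.
apply: (sup_upper_bound (has_sup_unit_values A)).
exists (`|x|^-1 *: x) => //=.
by rewrite normrZ ger0_norm ?invr_ge0// mulVf ?gt_eqF.
Qed.

Lemma opnorm_le (A : bounded_op) (M : R[i]) : 0 <= M ->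
  (forall x, `|A x| <= M * `|x|) -> opnorm A <= M.
Proof.
move=> M0 AM; rewrite -(RRe_real (ger0_real M0)) lecR.
apply: ge_sup; first by case: (has_sup_unit_values A).
move=> _ [x /= x1 <-]; rewrite -lecR norm_ReE (RRe_real (ger0_real M0)).
by rewrite (le_trans (AM x))// -[leRHS]mulr1 ler_wpM2l.
Qed.

Lemma ler_opnormD (A B : bounded_op) : opnorm (A + B) <= opnorm A + opnorm B.
Proof.
apply: opnorm_le => [|x]; first by rewrite addr_ge0 ?opnorm_ge0.
by rewrite mulrDl (le_trans (ler_normD _ _))// lerD ?ler_opnorm.
Qed.

Lemma opnormZ (c : R[i]) (A : bounded_op) : opnorm (c *: A) = `|c| * opnorm A.
Proof.
have le_opnormZ (d : R[i]) (B : bounded_op) : opnorm (d *: B) <= `|d| * opnorm B.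
  apply: opnorm_le => [|x]; first by rewrite mulr_ge0 ?opnorm_ge0.
  by rewrite -mulrA [leLHS]normrZ ler_wpM2l ?ler_opnorm.
apply/eqP; rewrite eq_le le_opnormZ/=.
have [->|c0] := eqVneq c 0; first by rewrite normr0 mul0r opnorm_ge0.
rewrite -ler_pdivlMl ?normr_gt0// -normfV.
by rewrite -[in leLHS](scale1r A) -(mulVf c0) -scalerA le_opnormZ.
Qed.

Lemma opnorm0_eq0 (A : bounded_op) : opnorm A = 0 -> A = 0.
Proof.
move=> A0; apply: val_inj; apply/funext => x /=.
by apply/eqP; rewrite -normr_le0; have := ler_opnorm A x; rewrite A0 mul0r.
Qed.

HB.instance Definition _ := @Lmodule_isNormed.Build R[i] bounded_op
  opnorm ler_opnormD opnormZ opnorm0_eq0.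

End BoundedOperators.

Section FrechetDerivatives.
Variables (R : realType) (V : normedModType R[i]).

(* The Fréchet derivative as a point of the normed space of bounded operators;
   if F is not differentiable at x, the value is irrelevant. *)
Definition frechet (W : normedModType R[i]) (F : V -> W) (x : V) :
    bounded_op V W :=
  insubd (0 : bounded_op V W) ('d F x : V -> W).

Lemma frechetE (W : normedModType R[i]) (F : V -> W) (x : V) :
  differentiable F x -> frechet F x = 'd F x :> (V -> W).
Proof.
move=> dF; rewrite /frechet insubdK//; apply/bounded_op_predP; split.
  exact: linearP.
exact: diff_continuous.
Qed.

(* Bounded n-linear maps V^n -> W in curried form, L(V, L(V, ... L(V, W))),
   which is isometric to the space of bounded n-linear maps. *)
Fixpoint bounded_mlin (n : nat) (W : normedModType R[i]) : normedModType R[i] :=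
  if n is m.+1 then (bounded_op V (bounded_mlin m W) : normedModType R[i])
  else W.

Fixpoint frechetn (n : nat) (W : normedModType R[i]) (F : V -> W) :
    V -> bounded_mlin n W :=
  if n is m.+1 return V -> bounded_mlin n W
  then frechet (frechetn m F) else F.

(* A(x, ..., x) *)
Fixpoint mlin_diag (n : nat) (W : normedModType R[i]) :
    bounded_mlin n W -> V -> W :=
  if n is m.+1 return bounded_mlin n W -> V -> W
  then fun (A : bounded_op V (bounded_mlin m W)) x => mlin_diag (A x) x
  else fun w _ => w.

End FrechetDerivatives.

Section UnitBall.
Variables (R : realType) (X : completeNormedModType R[i]).

Definition unit_ball : set X := [set x | `|x| < 1].

Definition holomorphic (W : normedModType R[i]) (F : X -> W) :=
  forall x, unit_ball x -> differentiable F x.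

Definition op_inverses (A : bounded_op X X) : set (bounded_op X X) :=
  [set B | cancel A B /\ cancel B A].

(* (DF(x))^-1, meaningful only if A has a bounded inverse (which is unique). *)
Definition op_inv (A : bounded_op X X) : bounded_op X X := get (op_inverses A).

Lemma op_inv_unique (A B : bounded_op X X) : op_inverses A B -> op_inv A = B.
Proof.
move=> AB; have [_ ACK] : op_inverses A (op_inv A) by apply: getPex; exists B.
by apply: val_inj; apply/funext => x /=; rewrite -[in RHS](ACK x) AB.1.
Qed.

Definition normalized (F : X -> X) :=
  F 0 = 0 /\ forall h, frechet F 0 h = h.

Definition locally_biholomorphic (F : X -> X) :=
  forall x, unit_ball x -> op_inverses (frechet F x) !=set0.

(* The set T(x) of norm-one support functionals at x. *)
Definition support_functionals (x : X) : set (bounded_op X R[i]^o) :=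
  [set T : bounded_op X R[i]^o | T x = `|x| /\ `|T| = 1].

Definition F_class (lambda : R) : set (X -> X) :=
  [set F | [/\ holomorphic F, normalized F, locally_biholomorphic F &
    forall x (T : bounded_op X R[i]^o),
      unit_ball x -> x != 0 -> support_functionals x T ->
      1 / 2 - lambda <=
      complex.Re (T (`|x|^-1 *: op_inv (frechet F x)
                       (mlin_diag (frechetn 2 F x) x + frechet F x x)))]].

Definition A_coef (F : X -> X) (x0 : X) (T : bounded_op X R[i]^o) (n : nat) :
    R[i] :=
  n`!%:R^-1 * T (mlin_diag (frechetn n F 0) x0).

Definition J23 (F : X -> X) (x0 : X) (T : bounded_op X R[i]^o) : R[i] :=
  A_coef F x0 T 2 * A_coef F x0 T 3 - A_coef F x0 T 4.

End UnitBall.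

(* Main.v *)
(* On the slice [z |-> F (z x0)] the map becomes [f z *: x0] with [f] holomorphic in
   the unit disc, [f' 0 = 1] and [1/2 - lambda <= Re (1 + z f''/f')]. Writing
   [m = 1 + 2 lambda], this says that [z phi], [phi = f'' / (z f'' + m f')], is bounded
   by 1, and [J23] is [- m / 12] times [b2 + mu b0 b1 + nu b0^3], where [b_k] are the
   Taylor coefficients of [phi], [mu = 2 + m / 2] and [nu = (1 + m) (2 - m) / 2].
   Averaging [phi u^2 / z^2] over circles, for quadratic polynomials [u], gives Schur's
   inequality [|c3 + D c1^* t^2| <= D (1 - |t|^2)] for the coefficients [c_(k+1) = b_k]
   of [z phi], where [D = 1 - |c1|^2] and [c2 = D t]; what remains is a maximization in
   [|c1|] and [|t|]. Equality holds for [phi = (c - z) / (1 - c z)] with a suitable real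
   [c], that is for [f' = (1 - 2 c z + z^2)^(- m / 2)]; the extremal map is
   [F x = h (T x) *: x], where [z h = f].

   Differentiability of [F] on the ball is all that is assumed, so the existence of the
   higher derivatives has to be derived: Goursat's argument on rectangles in the
   coordinate [log z] gives the mean value property on circles, hence first- and
   second-order Cauchy estimates for scalar functions; by Hahn-Banach these hold with
   the same constants for vector-valued ones, which makes the difference quotients of
   the derivative a Cauchy family in operator norm. *)

(* For [p = z f''/f'] the class condition is the half plane [Re p >= - m / 2], that is
   [|p| <= |p + m|], and [z phi = p / (p + m)]. The formula for [phi] has no division by [z]: its
   denominator is [m] at the origin.

   The maximization ends in the cubic [(1 + mu) x - (1 + mu + nu) x^3] of [x = |c1|], reached at
   [|t| = 1]. Its critical point [s], with [3 (1 + mu + nu) s^2 = 1 + mu], produces the radicals of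
   the bound and is the parameter [c] of the extremal map: there [z phi] is a Blaschke product of
   degree two with [c1 = c] and [t = -1], so both sides of Schur's inequality vanish.

   The obstacle on the sharpness side is local biholomorphy. For [F x = h (T x) *: x] the derivative
   at [x] acts as [h (T x)] on the kernel of [T] and as [f' (T x)] on [x]. Besides [f'], the
   function [h] must therefore have no zero, so [f] must vanish only at 0, which [f' <> 0] alone
   does not give. This is what the logarithms and the strip coordinate are for. *)
Require Import Defs.
From HB Require Import structures.
From mathcomp Require Import all_boot all_order all_algebra.
From mathcomp Require Import complex.
From mathcomp Require Import boolp classical_sets functions reals.
From mathcomp Require Import topology normedtype landau derive sequences realfun.
From mathcomp Require Import exp trigo measure lebesgue_measure lebesgue_integral ftc.
From mathcomp Require Import ring lra.
Import Order.TTheory GRing.Theory Num.Theory.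
Import numFieldNormedType.Exports.
Local Open Scope classical_set_scope.
Local Open Scope complex_scope.
Local Open Scope ring_scope.

Set Implicit Arguments.
Unset Strict Implicit.
Unset Printing Implicit Defensive.

(** * Norms valued in the real field *)

Section RealNorm.
Variable R : realType.
Implicit Types (V : normedZmodType R[i]).

(** Norms are elements of [R[i]], whose order is only partial; estimates are carried out in the
    ordered field [R] instead. *)
Definition nr V (v : V) : R := complex.Re `|v|.

Lemma nrE V (v : V) : `|v| = (nr v)%:C.
Proof. by rewrite /nr RRe_real// normr_real. Qed.

Lemma nr_le V (v : V) (a : R) : (`|v| <= a%:C) = (nr v <= a).
Proof. by rewrite nrE lecR. Qed.

Lemma nr_lt V (v : V) (a : R) : (`|v| < a%:C) = (nr v < a).
Proof. by rewrite nrE ltcR. Qed.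

Lemma nr_ge0 V (v : V) : 0 <= nr v.
Proof. by rewrite -lecR -nrE normr_ge0. Qed.

Lemma nr0 V : nr (0 : V) = 0.
Proof. by rewrite /nr normr0. Qed.

Lemma nr_eq0 V (v : V) : (nr v == 0) = (v == 0).
Proof. by rewrite -[RHS]normr_eq0 nrE (inj_eq (@complexI R)). Qed.

Lemma nr_gt0 V (v : V) : (0 < nr v) = (v != 0).
Proof. by rewrite lt0r nr_eq0 nr_ge0 andbT. Qed.

Lemma nrN V (v : V) : nr (- v) = nr v.
Proof. by rewrite /nr normrN. Qed.

Lemma nrBC V (u v : V) : nr (u - v) = nr (v - u).
Proof. by rewrite -nrN opprB. Qed.

Lemma nrD V (u v : V) : nr (u + v) <= nr u + nr v.
Proof. by rewrite -lecR rmorphD/= -!nrE ler_normD. Qed.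

Lemma nrB V (u v : V) : nr (u - v) <= nr u + nr v.
Proof. by rewrite -(nrN v) nrD. Qed.

Lemma nr_tri V (u v w : V) : nr (u - w) <= nr (u - v) + nr (v - w).
Proof. by rewrite (le_trans _ (nrD _ _))// addrA subrK. Qed.

Lemma nrZ (V : normedModType R[i]) (a : R[i]) (v : V) :
  nr (a *: v) = nr a * nr v.
Proof. by apply: (@complexI R); rewrite rmorphM/= -!nrE normrZ. Qed.

Lemma nrM (a b : R[i]) : nr (a * b) = nr a * nr b.
Proof. by apply: (@complexI R); rewrite rmorphM/= -!nrE normrM. Qed.

Lemma nrX (a : R[i]) n : nr (a ^+ n) = nr a ^+ n.
Proof. by apply: (@complexI R); rewrite rmorphXn/= -!nrE normrX. Qed.

Lemma nrV (a : R[i]) : nr a^-1 = (nr a)^-1.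
Proof. by apply: (@complexI R); rewrite fmorphV/= -!nrE normfV. Qed.

Lemma nrR (a : R) : nr a%:C = `|a|.
Proof. by apply: (@complexI R); rewrite -nrE normc_def/= expr0n addr0 sqrtr_sqr. Qed.

Lemma nr1 : nr (1 : R[i]) = 1.
Proof. by rewrite -[1]/(1%:C) nrR normr1. Qed.

Lemma nrS (a : R[i]) : nr a ^+ 2 = complex.Re a ^+ 2 + complex.Im a ^+ 2.
Proof.
apply: (@complexI R).
by rewrite rmorphXn/= -nrE normc_def -rmorphXn/= sqr_sqrtr// addr_ge0// sqr_ge0.
Qed.

Lemma nr_conj (a : R[i]) : nr a^* = nr a.
Proof.
apply/eqP; rewrite -(eqrXn2 (n := 2))// ?nr_ge0// !nrS.
by case: a => x y /=; rewrite sqrrN.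
Qed.

Lemma mul_conj (a : R[i]) : a * a^* = (nr a ^+ 2)%:C.
Proof.
rewrite nrS; case: a => x y /=; apply/eqP; rewrite eq_complex/=.
by apply/andP; split; apply/eqP; ring.
Qed.

Lemma Re_le_nr (a : R[i]) : `|complex.Re a| <= nr a.
Proof.
rewrite -(ler_pXn2r (n := 2)) ?nnegrE ?nr_ge0// nrS real_normK ?num_real//.
by rewrite lerDl sqr_ge0.
Qed.

Lemma Im_le_nr (a : R[i]) : `|complex.Im a| <= nr a.
Proof.
rewrite -(ler_pXn2r (n := 2)) ?nnegrE ?nr_ge0// nrS real_normK ?num_real//.
by rewrite lerDr sqr_ge0.
Qed.

Lemma nr_le_ReIm (a : R[i]) : nr a <= `|complex.Re a| + `|complex.Im a|.
Proof.
rewrite [a in nr a]complexE (le_trans (nrD _ _))// nrR nrM nrR lerD2l.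
rewrite (_ : nr 'i = 1) ?mul1r//; apply/eqP.
by rewrite -(eqrXn2 (n := 2))// ?nr_ge0// nrS/= expr0n add0r !expr1n.
Qed.

Lemma Re_add (a b : R[i]) : complex.Re (a + b) = complex.Re a + complex.Re b.
Proof. by case: a b => [? ?] [? ?]. Qed.
Lemma Im_add (a b : R[i]) : complex.Im (a + b) = complex.Im a + complex.Im b.
Proof. by case: a b => [? ?] [? ?]. Qed.
Lemma Re_opp (a : R[i]) : complex.Re (- a) = - complex.Re a.
Proof. by case: a. Qed.
Lemma Im_opp (a : R[i]) : complex.Im (- a) = - complex.Im a.
Proof. by case: a. Qed.
Lemma Re_mul (a b : R[i]) : complex.Re (a * b) =
  complex.Re a * complex.Re b - complex.Im a * complex.Im b.
Proof. by case: a b => [? ?] [? ?]. Qed.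
Lemma Im_mul (a b : R[i]) : complex.Im (a * b) =
  complex.Re a * complex.Im b + complex.Im a * complex.Re b.
Proof. by case: a b => [? ?] [? ?]. Qed.

End RealNorm.

(** * The Hahn-Banach theorem *)

Section HahnBanach.
Variables (R : realType) (V : normedModType R[i]).
Implicit Types (p : V -> R) (u v x y : V).

(** The bound by the norm keeps every chain of such functionals bounded below pointwise, as Zorn's
    lemma requires. Homogeneity is an inequality because the inverse scalar gives the converse. *)
Definition sublinear p := [/\ forall u v, p (u + v) <= p u + p v,
  forall (t : R) v, 0 < t -> p (t%:C *: v) <= t * p v & forall v, p v <= nr v].

Lemma sublinear0 p : sublinear p -> p 0 = 0.
Proof.
move=> [_ pZ _]; have := pZ 2 0 (ltr0n _ 2); have := pZ 2^-1 0.
rewrite !scaler0 invr_gt0 ltr0n => /(_ isT) ?; lra.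
Qed.

Lemma sublinear_ge p v : sublinear p -> - p (- v) <= p v.
Proof.
move=> sp; have p0 := sublinear0 sp; case: sp => pD _ _.
by have := pD v (- v); rewrite subrr p0; lra.
Qed.

Lemma sublinearZ p (t : R) v : sublinear p -> 0 <= t -> p (t%:C *: v) = t * p v.
Proof.
move=> sp; have p0 := sublinear0 sp; case: sp => _ pZ _.
rewrite le_eqVlt => /predU1P[<-|t0]; first by rewrite scale0r mul0r.
apply/eqP; rewrite eq_le pZ//=.
have := pZ t^-1 (t%:C *: v); rewrite invr_gt0 => /(_ t0).
rewrite scalerA -rmorphM mulVf ?gt_eqF// scale1r.
by rewrite [t^-1 * _]mulrC ler_pdivlMr// mulrC.
Qed.

(** For sublinear [p], the infimum of this set, as a function of [x], is the largest sublinear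
    functional below [p] with value [- p y] at [- y]. *)
Definition slope_set p y x := [set p (x + t%:C *: y) - t * p y | t in [set t : R | 0 <= t]].

Lemma slope_lb p y x : sublinear p -> has_inf (slope_set p y x).
Proof.
move=> sp; split; first by exists (p (x + 0%:C *: y) - 0 * p y), 0 => /=.
exists (- p (- x)) => _ [t /= t0 <-].
have := sublinearZ y sp t0; case: sp => pD _ _.
have := pD (x + t%:C *: y) (- x); rewrite addrAC subrr add0r; lra.
Qed.

Lemma slope_inf_le p y x (t : R) : sublinear p -> 0 <= t ->
  inf (slope_set p y x) <= p (x + t%:C *: y) - t * p y.
Proof. by move=> sp t0; apply: ge_inf; [case: (slope_lb y x sp)|exists t]. Qed.

Lemma le_slope_inf p y x (a : R) : sublinear p ->
  (forall t : R, 0 <= t -> a <= p (x + t%:C *: y) - t * p y) ->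
  a <= inf (slope_set p y x).
Proof.
by move=> sp H; apply: lb_le_inf; [case: (slope_lb y x sp)|move=> _ [t /= t0 <-]; exact: H].
Qed.

Lemma slope_sublinear p y : sublinear p ->
  sublinear (fun x => inf (slope_set p y x)).
Proof.
move=> sp; have [pD pZ pn] := sp; split=> [u v|t v t0|v].
- rewrite -lerBlDr; apply: le_slope_inf => // s s0.
  rewrite lerBlDr -lerBlDl; apply: le_slope_inf => // t t0.
  rewrite lerBlDl; apply: le_trans (slope_inf_le y (u + v) sp (addr_ge0 s0 t0)) _.
  have := pD (u + s%:C *: y) (v + t%:C *: y).
  by rewrite rmorphD scalerDl addrACA; lra.
- rewrite mulrC -ler_pdivrMr//; apply: le_slope_inf => // s s0.
  rewrite ler_pdivrMr//.
  apply: le_trans (slope_inf_le y _ sp (mulr_ge0 (ltW t0) s0)) _.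
  rewrite rmorphM/= -scalerA -scalerDr.
  by have := pZ t (v + s%:C *: y) t0; lra.
- apply: le_trans (pn v); have := slope_inf_le y v sp (lexx 0).
  by rewrite scale0r addr0 mul0r subr0.
Qed.

(* A pointwise minimal sublinear functional [q] is additive: comparing it with
   the smaller sublinear functional [x |-> inf_(t >= 0) q (x + t y) - t q y]
   gives [q x + q y <= q (x + y)]. *)
Lemma minimal_sublinear p : sublinear p ->
  exists2 q, sublinear q & (forall v, q v <= p v) /\
    forall u v, q (u + v) = q u + q v.
Proof.
move=> sp; pose T := {q : V -> R | sublinear q /\ forall v, q v <= p v}.
pose le (q r : T) : bool := `[< forall v, sval r v <= sval q v >].
have [||||[q [sq qp]] qmin] := @Zorn T le.
- by move=> q; apply/asboolP.
- by move=> q r s /asboolP qr /asboolP rs; apply/asboolP => v; apply: le_trans (rs v) (qr v).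
- move=> [q Hq] [r Hr] /asboolP/= qr /asboolP/= rq; apply: eq_exist.
  by apply/funext => v; apply/eqP; rewrite eq_le rq qr.
- move=> A totA; have [[q0 Aq0]|A0] := pselect (exists q, A q); last first.
    by exists (exist _ p (conj sp (fun=> lexx _))) => s As; case: A0; exists s.
  pose S v := [set sval q v | q in A].
  have Slb v : has_inf (S v).
    split; first by exists (sval q0 v), q0.
    exists (- nr v) => _ [q Aq <-]; have [sq _] := svalP q.
    by apply: le_trans (sublinear_ge v sq); rewrite lerN2 -(nrN v); case: sq.
  have infle q v : A q -> inf (S v) <= sval q v.
    by move=> Aq; apply: ge_inf; [case: (Slb v)|exists q].
  have leinf a v : (forall q, A q -> a <= sval q v) -> a <= inf (S v).
    by move=> H; apply: lb_le_inf; [case: (Slb v)|move=> _ [q Aq <-]; exact: H].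
  have sinf : sublinear (fun v => inf (S v)) /\ forall v, inf (S v) <= p v.
    split; last by move=> v; apply: le_trans (infle q0 v Aq0) _; case: (svalP q0).
    split=> [u v|t v t0|v]; last first.
    - by apply: le_trans (infle q0 v Aq0) _; case: (svalP q0) => -[].
    - rewrite mulrC -ler_pdivrMr//; apply: (leinf) => q Aq; rewrite ler_pdivrMr//.
      apply: le_trans (infle q _ Aq) _; rewrite mulrC.
      by case: (svalP q) => -[_ + _] _; apply.
    rewrite -lerBlDr; apply: (leinf) => q Aq.
    rewrite lerBlDr -lerBlDl; apply: (leinf) => r Ar.
    rewrite lerBlDl; case: (totA q r Aq Ar) => /asboolP qr.
      apply: le_trans (infle r _ Ar) _.
      case: (svalP r) => -[/(_ u v) rD _ _] _; apply: le_trans rD _.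
      by rewrite lerD2r.
    apply: le_trans (infle q _ Aq) _.
    case: (svalP q) => -[/(_ u v) qD _ _] _; apply: le_trans qD _.
    by rewrite lerD2l.
  exists (exist _ (fun v => inf (S v)) sinf) => s As; apply/asboolP => v /=.
  exact: infle.
exists q => //; split=> // u v.
have sslope := slope_sublinear v sq.
have slope_le w : inf (slope_set q v w) <= q w.
  by have := slope_inf_le v w sq (lexx 0); rewrite scale0r addr0 mul0r subr0.
have slope_p w : inf (slope_set q v w) <= p w by apply: le_trans (slope_le w) (qp w).
pose sl : T := exist _ (fun x => inf (slope_set q v x)) (conj sslope slope_p).
have := qmin sl.
have -> : le (exist _ q (conj sq qp)) sl.
  by apply/asboolP.
move=> /(_ isT)/(congr1 sval)/= qE.
have qD : q (u + v) <= q u + q v by have [] := sq.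
apply/eqP; rewrite eq_le qD/=.
have := slope_inf_le v u sq ler01; rewrite scale1r mul1r.
by move: (congr1 (@^~ u) qE) => /= ->; lra.
Qed.

(** A minimal functional is taken below the slope functional of the norm in direction [x], not below
    the norm itself: the former is at most [- nr x] at [- x], so an additive functional under it
    must attain the norm at [x]. *)
Lemma hahn_banach_real x : exists f : V -> R,
  [/\ forall u v, f (u + v) = f u + f v, forall (t : R) v, f (t%:C *: v) = t * f v,
      forall v, f v <= nr v & f x = nr x].
Proof.
have snr : sublinear (@nr R V).
  split=> // [|t v t0]; first exact: nrD.
  by rewrite nrZ nrR gtr0_norm.
have [q sq [qx qD]] := minimal_sublinear (slope_sublinear x snr).
have q0 := sublinear0 sq.
have qN v : q (- v) = - q v by have := qD v (- v); rewrite subrr q0; lra.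
have [_ _ qn] := sq; exists q; split=> //.
  move=> t v; have [t0|t0] := leP 0 t; first exact: sublinearZ.
  rewrite -[t]opprK rmorphN scaleNr qN sublinearZ ?oppr_ge0 ?ltW//; ring.
apply/eqP; rewrite eq_le qn/=.
have := le_trans (qx (- x)) (slope_inf_le x (- x) snr ler01).
by rewrite scale1r addNr nr0 mul1r sub0r qN lerN2.
Qed.

Lemma bounded_op_of (W : normedModType R[i]) (f : V -> W) (K : R) : linear f ->
  (forall v, nr (f v) <= K * nr v) -> exists A : bounded_op V W, A = f :> (V -> W).
Proof.
move=> lf fK.
pose L : {linear V -> W} := HB.pack f (GRing.isLinear.Build _ _ _ _ f lf).
have cf : continuous L.
  apply/linear_bounded_continuous/linear_boundedP.
  exists K%:C; split; first by apply/complex_realP; exists K.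
  move=> M KM v; apply: le_trans (_ : K%:C * `|v| <= _).
    by rewrite !nrE -rmorphM lecR; exact: fK.
  by rewrite ler_wpM2r// ltW.
by exists (BoundedOp (introT (bounded_op_predP f) (conj lf cf))).
Qed.

Lemma hahn_banach x : exists T : bounded_op V R[i]^o,
  T x = `|x| /\ forall v, nr (T v) <= nr v.
Proof.
have [f [fD fZ fle fx]] := hahn_banach_real x.
have fN v : f (- v) = - f v.
  by rewrite -scaleN1r -[-1](rmorphN1 (real_complex R)) fZ mulN1r.
(* The complex-linear functional whose real part is [f]. *)
pose T v : R[i]^o := f v +i* - f ('i *: v).
have TD u v : T (u + v) = T u + T v.
  rewrite /T scalerDr !fD; apply/eqP; rewrite eq_complex/= eqxx/=.
  by rewrite opprD.
have TZ (a : R[i]) u : T (a *: u) = a * T u.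
  have TR (t : R) w : T (t%:C *: w) = t%:C * T w.
    rewrite /T fZ scalerA ['i * _]mulrC -scalerA fZ; apply/eqP; rewrite eq_complex/=.
    by apply/andP; split; apply/eqP; ring.
  have Ti w : T ('i *: w) = 'i * T w.
    rewrite /T scalerA -expr2 sqr_i scaleN1r fN; apply/eqP; rewrite eq_complex/=.
    by apply/andP; split; apply/eqP; ring.
  by rewrite [in LHS](complexE a) scalerDl TD -scalerA TR Ti TR mulrA -mulrDl -complexE.
have Tle v : nr (T v) <= nr v.
  have [->|Tv0] := eqVneq (T v) 0; first by rewrite nr0 nr_ge0.
  (* A unit scalar that rotates [T v] onto the positive real axis, where [T] coincides with [f] and
     the real bound applies. *)
  pose a := (T v)^* / (nr (T v))%:C.
  have na : nr a = 1 by rewrite nrM nrV nr_conj nrR ger0_norm ?nr_ge0// divff// nr_eq0.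
  have : complex.Re (T (a *: v)) <= nr (a *: v) by exact: fle.
  rewrite TZ nrZ na mul1r /a mulrAC [_ * T v]mulrC mul_conj -fmorphV -rmorphM/=.
  by rewrite expr2 mulfK// nr_eq0.
have Tlin : linear T by move=> a u v; rewrite TD TZ.
have [|A AT] := @bounded_op_of _ T 1 Tlin; first by move=> v; rewrite mul1r.
exists A; split; last by move=> v; rewrite AT.
(* The real part of [T x] already has modulus [nr x], so the bound leaves no room for an imaginary
   part. *)
apply/eqP; rewrite AT eq_complex nrE/= fx eqxx/=.
have : complex.Re (T x) ^+ 2 + complex.Im (T x) ^+ 2 <= nr x ^+ 2.
  by rewrite -nrS ler_pXn2r// nnegrE nr_ge0.
rewrite /= fx gerDl => h; have := sqr_ge0 (- f ('i *: x)).
by move=> h2; rewrite -sqrf_eq0 eq_le h h2.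
Qed.

End HahnBanach.

(** * Derivatives along complex lines *)

Section Derivatives.
Variable R : realType.
Implicit Types (V W : normedModType R[i]).

Lemma nr_leM V W (u : V) (v : W) (e : R) :
  (`|u| <= e%:C * `|v|) = (nr u <= e * nr v).
Proof. by rewrite !nrE -rmorphM lecR. Qed.

Lemma opD V W (A : bounded_op V W) u v : A (u + v) = A u + A v.
Proof. exact: (raddfD A). Qed.

Lemma opB V W (A : bounded_op V W) u v : A (u - v) = A u - A v.
Proof. exact: (raddfB A). Qed.

Lemma opZ V W (A : bounded_op V W) a u : A (a *: u) = a *: A u.
Proof. by rewrite linearZ. Qed.

Lemma op0 V W (A : bounded_op V W) : A 0 = 0.
Proof. exact: (raddf0 A). Qed.

Lemma nr_op V W (A : bounded_op V W) v : nr (A v) <= nr A * nr v.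
Proof. by rewrite -nr_leM -nrE; exact: ler_opnorm. Qed.

Lemma nr_op_le V W (A : bounded_op V W) (M : R) : 0 <= M ->
  (forall v, nr (A v) <= M * nr v) -> nr A <= M.
Proof.
move=> M0 H; rewrite -nr_le; apply: opnorm_le => [|v]; first by rewrite ler0c.
by rewrite nr_leM.
Qed.

(** Three derivatives with real epsilons: Fréchet, along a complex parameter, and along a real
    parameter with values in a complex space. The non-strict bounds make [h = 0] harmless. *)
Definition hasD V W (f : V -> W) (x : V) (L : V -> W) := forall e : R, 0 < e ->
  exists2 r : R, 0 < r & forall h : V, nr h <= r -> nr (f (x + h) - f x - L h) <= e * nr h.

Definition vder W (f : R[i] -> W) (z : R[i]) (d : W) := forall e : R, 0 < e ->
  exists2 r : R, 0 < r & forall h : R[i], nr h <= r -> nr (f (z + h) - f z - h *: d) <= e * nr h.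

Definition rder W (f : R -> W) (t : R) (d : W) := forall e : R, 0 < e ->
  exists2 r : R, 0 < r & forall h : R, `|h| <= r ->
    nr (f (t + h) - f t - h%:C *: d) <= e * `|h|.

Lemma ltr0C (k : R) : (0 < k%:C) = (0 < k).
Proof. exact: (ltcR 0 k). Qed.

(** Absorbs a factor [n] that may be zero: tolerances are divided by [n + 1] throughout. *)
Lemma ler_shrink (e n k : R) : 0 < e -> 0 <= n -> 0 <= k ->
  e / (n + 1) * (k * n) <= e * k.
Proof.
move=> e0 n0 k0; rewrite mulrAC ler_pdivrMr; last by lra.
by have := mulr_ge0 (ltW e0) k0; nra.
Qed.

Lemma nbhs_nr V (x : V) (P : set V) :
  nbhs x P <-> exists2 r : R, 0 < r & forall h, nr h <= r -> P (x + h).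
Proof.
split.
  move=> /nbhs_normP[e /= e0 He].
  have eR : e = (complex.Re e)%:C by rewrite RRe_real// gtr0_real.
  rewrite eR ltr0C in e0; exists (complex.Re e / 2); first by rewrite divr_gt0.
  move=> h hr; apply: He => /=.
  rewrite opprD addrA subrr sub0r normrN eR nr_lt (le_lt_trans hr)//.
  by rewrite ltr_pdivrMr// mulr_natr mulr2n ltrDl.
move=> [r r0 H]; apply/nbhs_normP; exists r%:C; first by rewrite /= ltr0C.
move=> y /=; rewrite distrC nr_lt => /ltW/H.
by rewrite addrC subrK.
Qed.

Lemma differentiable_hasD V W (f : V -> W) x :
  differentiable f x -> hasD f x (frechet f x).
Proof.
move=> df e e0; have /eqaddoP/(_ e%:C) := diff_locally df.
rewrite ltr0C => /(_ e0)/nbhs_nr[r r0 H]; exists r => // h hr.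
have := H _ hr; rewrite add0r /= !fctE/= nr_leM frechetE//.
by rewrite opprD addrA (addrC h).
Qed.

Lemma hasD_frechet V W (f : V -> W) x (A : bounded_op V W) :
  hasD f x A -> differentiable f x /\ frechet f x = A.
Proof.
move=> fA; have Ac := @bounded_op_continuous _ _ _ A.
have H : f \o shift x = cst (f x) + (A : {linear V -> W}) +o_ 0 id.
  apply/eqaddoP => e e0.
  have eR : e = (complex.Re e)%:C by rewrite RRe_real// gtr0_real.
  rewrite eR ltr0C in e0; have [r r0 Hr] := fA _ e0.
  apply/nbhs_nr; exists r => // h /Hr; rewrite add0r eR nr_leM.
  by rewrite /= !fctE/= opprD addrA (addrC h).
have dE := @diff_unique _ _ _ f A x Ac H.
have df : differentiable f x.
  by apply/diff_locallyP; rewrite dE; split.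
by split=> //; apply: val_inj; rewrite /= frechetE.
Qed.

Lemma hasD_vder V W (f : V -> W) x h z (A : bounded_op V W) :
  hasD f (x + z *: h) A -> vder (fun z => f (x + z *: h)) z (A h).
Proof.
move=> fA e e0.
have n0 : 0 < nr h + 1 by rewrite ltr_wpDl// nr_ge0.
have [r r0 Hr] := fA (e / (nr h + 1)) (divr_gt0 e0 n0).
exists (r / (nr h + 1)); first exact: divr_gt0.
move=> k kr; rewrite scalerDl addrA -linearZ.
apply: le_trans (Hr _ _) _.
  rewrite nrZ; apply: le_trans (_ : nr k * (nr h + 1) <= _).
    by rewrite ler_wpM2l ?nr_ge0// lerDl.
  by rewrite -ler_pdivlMr.
by rewrite nrZ ler_shrink ?nr_ge0.
Qed.

Lemma vder_line W (f : R[i] -> W) (z v : R[i]) (t : R) d :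
  vder f (z + t%:C * v) d -> rder (fun t => f (z + t%:C * v)) t (v *: d).
Proof.
move=> fd e e0.
have n0 : 0 < nr v + 1 by rewrite ltr_wpDl// nr_ge0.
have [r r0 Hr] := fd (e / (nr v + 1)) (divr_gt0 e0 n0).
exists (r / (nr v + 1)); first exact: divr_gt0.
move=> k kr; rewrite rmorphD/= mulrDl addrA scalerA.
apply: le_trans (Hr _ _) _.
  rewrite nrM nrR; apply: le_trans (_ : `|k| * (nr v + 1) <= _).
    by rewrite ler_wpM2l ?normr_ge0// lerDl.
  by rewrite -ler_pdivlMr.
by rewrite nrM nrR ler_shrink ?nr_ge0.
Qed.

Lemma vder_line0 W (f : R[i] -> W) (v : R[i]) (t : R) d :
  vder f (t%:C * v) d -> rder (fun t => f (t%:C * v)) t (v *: d).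
Proof.
move=> fd; have := @vder_line _ f 0 v t d; rewrite add0r => /(_ fd).
by congr rder; apply/funext => s; rewrite add0r.
Qed.

Lemma vder_cont W (f : R[i] -> W) z d : vder f z d ->
  exists2 K : R, 0 <= K & exists2 r : R, 0 < r &
    forall h, nr h <= r -> nr (f (z + h) - f z) <= K * nr h.
Proof.
move=> /(_ 1 ltr01)[r r0 H]; exists (1 + nr d); first by rewrite addr_ge0 ?nr_ge0.
exists r => // h /H; have := nrD (f (z + h) - f z - h *: d) (h *: d).
by rewrite subrK nrZ mulrDl (mulrC (nr d)); lra.
Qed.

Lemma vder_cvg W (f : R[i] -> W) z d : vder f z d -> forall e : R, 0 < e ->
  exists2 r : R, 0 < r & forall h, nr h <= r -> nr (f (z + h) - f z) <= e.
Proof.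
move=> /vder_cont[K K0 [r r0 H]] e e0; exists (Order.min r (e / (K + 1))).
  by rewrite lt_min r0 divr_gt0// ltr_wpDl.
move=> h; rewrite le_min => /andP[hr he]; apply: le_trans (H _ hr) _.
move: he; rewrite ler_pdivlMr ?ltr_wpDl//; have := nr_ge0 h; nra.
Qed.

Lemma vder_cst W (c : W) z : vder (fun _ => c) z 0.
Proof.
move=> e e0; exists 1 => // h _; rewrite subrr scaler0 subr0 nr0.
by rewrite mulr_ge0 ?nr_ge0// ltW.
Qed.

Lemma vder_scalar (f : R[i] -> R[i]) z (d : R[i]) :
  (forall e : R, 0 < e -> exists2 r : R, 0 < r & forall h : R[i],
     nr h <= r -> nr (f (z + h) - f z - h * d) <= e * nr h) ->
  vder (W := R[i]^o) f z d.
Proof. by []. Qed.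

Lemma vder_id z : vder (W := R[i]^o) (fun z => z) z 1.
Proof.
apply: vder_scalar => e e0; exists 1 => // h _.
rewrite (_ : z + h - z - h * 1 = 0) ?nr0; last by ring.
by rewrite mulr_ge0 ?nr_ge0// ltW.
Qed.

Lemma vderD W (f g : R[i] -> W) z a b : vder f z a -> vder g z b ->
  vder (fun z => f z + g z) z (a + b).
Proof.
move=> fa gb e e0; have e2 : 0 < e / 2 by lra.
have [r r0 Hr] := fa _ e2; have [s s0 Hs] := gb _ e2.
exists (Order.min r s); first by rewrite lt_min r0.
move=> h; rewrite le_min => /andP[/Hr h1 /Hs h2].
have -> : f (z + h) + g (z + h) - (f z + g z) - h *: (a + b) =
    (f (z + h) - f z - h *: a) + (g (z + h) - g z - h *: b).
  by rewrite [RHS]addrACA [X in _ = X + _]addrACA -!opprD -scalerDr.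
by apply: le_trans (nrD _ _) _; lra.
Qed.

Lemma vder_op V W (A : bounded_op V W) (f : R[i] -> V) z d :
  vder f z d -> vder (fun z => A (f z)) z (A d).
Proof.
move=> fd e e0.
have n0 : 0 < nr A + 1 by rewrite ltr_wpDl// nr_ge0.
have [r r0 Hr] := fd (e / (nr A + 1)) (divr_gt0 e0 n0).
exists r => // h /Hr H.
have -> : A (f (z + h)) - A (f z) - h *: A d = A (f (z + h) - f z - h *: d).
  by rewrite !opB opZ.
apply: le_trans (nr_op _ _) _.
move: H; rewrite mulrAC ler_pdivlMr// => H.
apply: le_trans H; rewrite mulrC ler_wpM2l ?nr_ge0//; lra.
Qed.

Lemma vderZ W (f : R[i] -> R[i]) (F : R[i] -> W) z a b :
  vder (W := R[i]^o) f z a -> vder F z b ->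
  vder (fun z => f z *: F z) z (a *: F z + f z *: b).
Proof.
move=> fa Fb e e0.
have [K K0 [r0 r00 H0]] := vder_cont fa.
(* [M] dominates the coefficient of each of the three terms into which the error is split below, so
   that each costs at most [e / 3]. *)
pose M := nr (F z) + nr (f z) + nr b * K + K + 1.
have M0 : 0 < M.
  by rewrite ltr_wpDl// !addr_ge0 ?nr_ge0// mulr_ge0 ?nr_ge0.
have e3 : 0 < e / (M *+ 3) by rewrite divr_gt0// pmulrn_lgt0.
have [r1 r10 H1] := fa _ e3; have [r2 r20 H2] := Fb _ e3.
exists (Order.min (Order.min r0 1) (Order.min (Order.min r1 r2) (e / (M *+ 3)))).
  by rewrite !lt_min r00 r10 r20 ltr01 e3.
move=> h; rewrite !le_min => /andP[/andP[hr0 h1] /andP[/andP[hr1 hr2] he]].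
have E : f (z + h) *: F (z + h) - f z *: F z - h *: (a *: F z + f z *: b) =
  (f (z + h) - f z - h * a) *: F z + f (z + h) *: (F (z + h) - F z - h *: b)
  + (f (z + h) - f z) *: (h *: b).
  rewrite !scalerBr !scalerBl scalerDr !scalerA [f z * h]mulrC.
  rewrite -[RHS]addrA [X in _ = _ + X]addrA subrK [RHS]addrACA -[X in _ = _ + X]opprD.
  by rewrite [X in _ = X + _]addrC addrA subrK.
have n1 : nr (f (z + h) - f z) <= K * nr h by exact: H0.
have n2 : nr (f (z + h)) <= nr (f z) + K.
  rewrite -[f (z + h)](subrK (f z)) (le_trans (nrD _ _))// addrC lerD2l.
  by apply: le_trans n1 _; have := nr_ge0 h; nra.
rewrite E; apply: le_trans (nrD _ _) _.
apply: le_trans (lerD (nrD _ _) (lexx _)) _; rewrite !nrZ.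
have {}H1 := H1 _ hr1; have {}H2 := H2 _ hr2.
have e3M : e / (M *+ 3) * M = e / 3.
  by rewrite -mulr_natl; field; rewrite lt0r_neq0.
have h0 := nr_ge0 h; have B0 := nr_ge0 b; have F0 := nr_ge0 (F z).
have f0 := nr_ge0 (f z).
have := nr_ge0 (f (z + h) - f z - h * a).
have := nr_ge0 (F (z + h) - F z - h *: b).
have D0 := nr_ge0 (f (z + h)); have C0 := nr_ge0 (f (z + h) - f z).
move: D0 C0 H1 H2 n1 n2; rewrite [h *: a]/(h * a).
move: (nr (f (z + h) - f z - h * a)) (nr (F (z + h) - F z - h *: b))
  (nr (f (z + h) - f z)) (nr (f (z + h))) => A B C D D0 C0 A1 B1 C1 D1 A0 B0'.
have P1 : A * nr (F z) <= e / 3 * nr h.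
  apply: le_trans (_ : e / (M *+ 3) * nr h * M <= _); last by rewrite mulrAC e3M.
  by apply: ler_pM => //; rewrite /M; nra.
have P2 : D * B <= e / 3 * nr h.
  apply: le_trans (_ : M * (e / (M *+ 3) * nr h) <= _).
    by apply: ler_pM => //; apply: le_trans D1 _; rewrite /M; nra.
  by rewrite mulrA [M * _]mulrC e3M.
have P3 : C * (nr h * nr b) <= e / 3 * nr h.
  apply: le_trans (_ : K * nr h * (nr h * nr b) <= _).
    by rewrite ler_wpM2r ?mulr_ge0.
  rewrite -e3M (_ : K * nr h * (nr h * nr b) = nr h * (nr b * K) * nr h); last by ring.
  by rewrite ler_wpM2r// ler_pM ?mulr_ge0// /M; nra.
lra.
Qed.

End Derivatives.

Section Derivatives2.
Variable R : realType.
Implicit Types (V W : normedModType R[i]).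

Lemma vder_eq W (f : R[i] -> W) z a b : vder f z a -> a = b -> vder f z b.
Proof. by move=> + <-. Qed.

Lemma vder_near W (f g : R[i] -> W) z d (r : R) : 0 < r ->
  (forall h : R[i], nr h <= r -> f (z + h) = g (z + h)) -> vder f z d -> vder g z d.
Proof.
move=> r0 fg fd e /fd[s s0 H]; exists (Order.min r s); first by rewrite lt_min r0.
move=> h; rewrite le_min => /andP[hr /H]; rewrite fg//.
by have := fg 0; rewrite addr0 nr0 => ->//; exact: ltW.
Qed.

Lemma vder_comp W (f : R[i] -> R[i]) (F : R[i] -> W) z a b :
  vder (W := R[i]^o) f z a -> vder F (f z) b -> vder (fun z => F (f z)) z (a *: b).
Proof.
move=> fa Fb e e0.
have [K K0 [r0 r00 H0]] := vder_cont fa.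
have b0 := nr_ge0 b.
have e1 : 0 < e / 2 / (K + 1) by rewrite !divr_gt0// ltr_wpDl.
have e2 : 0 < e / 2 / (nr b + 1) by rewrite !divr_gt0// ltr_wpDl.
have [r1 r10 H1] := Fb _ e1; have [r2 r20 H2] := fa _ e2.
have K1 : 0 < K + 1 by rewrite ltr_wpDl.
exists (Order.min r0 (Order.min (r1 / (K + 1)) r2)).
  by rewrite !lt_min r00 r20 divr_gt0.
move=> h; rewrite !le_min => /andP[/H0 h0 /andP[h1 /H2 h2]].
have hh := nr_ge0 h.
have -> : F (f (z + h)) - F (f z) - h *: (a *: b) =
   (F (f z + (f (z + h) - f z)) - F (f z) - (f (z + h) - f z) *: b) +
   (f (z + h) - f z - h * a) *: b.
  by rewrite [f z + _]addrC subrK [(_ - h * a) *: b]scalerBl scalerA addrA subrK.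
apply: le_trans (nrD _ _) _; rewrite nrZ.
have kr : nr (f (z + h) - f z) <= r1.
  apply: le_trans h0 _; move: h1; rewrite ler_pdivlMr//; nra.
have {}H1 := H1 _ kr; have e20 : 0 < e / 2 by lra.
have s1 := ler_shrink e20 K0 hh; have s2 := ler_shrink e20 b0 hh.
apply: le_trans (_ : e / 2 * nr h + e / 2 * nr h <= _); last by lra.
apply: lerD.
  apply: le_trans H1 _; apply: le_trans s1; rewrite ler_wpM2l ?(ltW e1)//.
  by rewrite mulrC.
apply: le_trans s2; rewrite mulrA; apply: ler_wpM2r => //.
Qed.

Lemma vder_inv (z : R[i]) : z != 0 ->
  vder (W := R[i]^o) (fun z => z^-1) z (- z^-2).
Proof.
move=> z0; apply: vder_scalar => e e0.
have nz : 0 < nr z by rewrite nr_gt0.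
exists (Order.min (nr z / 2) (e * (nr z ^+ 3 / 2))).
  by rewrite lt_min !(divr_gt0, mulr_gt0)// exprn_gt0.
move=> h; rewrite le_min => /andP[h1 h2].
have zh : nr z / 2 <= nr (z + h).
  have := nr_tri z (- h) 0; rewrite !subr0 opprK nrN; lra.
have zh0 : z + h != 0 by rewrite -nr_gt0; lra.
have -> : (z + h)^-1 - z^-1 - h * - z^-2 = h * (h * (z^-2 * (z + h)^-1)).
  by field; apply/andP.
rewrite !nrM !nrV nrX mulrC ler_wpM2r ?nr_ge0//.
rewrite -invfM ler_pdivrMr; last by rewrite mulr_gt0 ?exprn_gt0//; lra.
apply: le_trans h2 _; rewrite ler_wpM2l ?(ltW e0)//.
rewrite exprSr -mulrA ler_wpM2l// exprn_ge0//; lra.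
Qed.

Lemma vderN W (f : R[i] -> W) z a : vder f z a -> vder (fun z => - f z) z (- a).
Proof.
move=> fa e /fa[r r0 H]; exists r => // h /H.
by rewrite -[leLHS]nrN !opprD scalerN !opprK.
Qed.

Lemma vderB W (f g : R[i] -> W) z a b : vder f z a -> vder g z b ->
  vder (fun z => f z - g z) z (a - b).
Proof. by move=> fa gb; apply: vderD => //; apply: vderN. Qed.

Lemma vderM (f g : R[i] -> R[i]) z (a b : R[i]) : vder (W := R[i]^o) f z a ->
  vder (W := R[i]^o) g z b ->
  vder (W := R[i]^o) (fun z => f z * g z) z (a * g z + f z * b).
Proof. exact: vderZ. Qed.

Lemma vderV (f : R[i] -> R[i]) z (a : R[i]) : vder (W := R[i]^o) f z a -> f z != 0 ->
  vder (W := R[i]^o) (fun z => (f z)^-1) z (- (a / f z ^+ 2)).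
Proof.
move=> fa f0; apply: vder_eq (vder_comp fa (vder_inv f0)) _.
by rewrite scalerN.
Qed.

Lemma vder_mull (c : R[i]) z : vder (W := R[i]^o) (fun z => c * z) z c.
Proof.
apply: vder_eq (vderM (@vder_cst R R[i]^o c z) (@vder_id R z)) _.
by rewrite mul0r add0r mulr1.
Qed.

Lemma vder_unique W (f : R[i] -> W) z a b : vder f z a -> vder f z b -> a = b.
Proof.
move=> fa fb; apply/eqP; rewrite -subr_eq0 -nr_eq0 eq_le nr_ge0 andbT.
apply/ler_addgt0Pl => e e0; rewrite addr0.
have e2 : 0 < e / 2 by lra.
have [r r0 H] := fa _ e2; have [s s0 H'] := fb _ e2.
pose t := Order.min r s; have t0 : 0 < t by rewrite lt_min r0.
have nt : nr t%:C = t by rewrite nrR gtr0_norm.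
have {}H : nr (f (z + t%:C) - f z - t%:C *: a) <= e / 2 * t.
  by rewrite -[in leRHS]nt; apply: H; rewrite nt ge_min lexx.
have {}H' : nr (f (z + t%:C) - f z - t%:C *: b) <= e / 2 * t.
  by rewrite -[in leRHS]nt; apply: H'; rewrite nt ge_min lexx orbT.
rewrite -(ler_pM2l t0) -[in leLHS]nt -nrZ scalerBr.
have -> : t%:C *: a - t%:C *: b = f (z + t%:C) - f z - t%:C *: b -
    (f (z + t%:C) - f z - t%:C *: a) by rewrite opprB [RHS]addrC [RHS]addrA subrK.
by apply: le_trans (nrB _ _) _; lra.
Qed.

(** The bridge to real calculus: the mean value theorem, the fundamental theorem and the elementary
    functions enter through it. *)
Lemma is_derive_eps (u : R -> R) (t d : R) : is_derive t 1 u d <->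
  forall e : R, 0 < e -> exists2 r : R, 0 < r & forall h : R, `|h| <= r ->
    `|u (t + h) - u t - h * d| <= e * `|h|.
Proof.
split.
  move=> [/derivable1_diffP du Du] e e0.
  have /eqaddoP/(_ _ e0)/nbhs_normP[r /= r0 H] := diff_locally du.
  have r2 : 0 < r / 2 by lra.
  exists (r / 2) => // h hr.
  have := H h; rewrite /ball_/= sub0r normrN => /(_ ltac:(lra)).
  rewrite /= !fctE/= opprD addrA (addrC h); congr (`|_ - _ - _| <= _).
  rewrite -Du deriveE// -[in LHS](mulr1 h) -[h * 1]/(h *: 1) linearZ//.
move=> H.
have cv : h^-1 *: (u (h *: 1 + t) - u t) @[h --> 0^'] --> d.
  apply/cvgrPdist_le => e e0; have [r r0 {}H] := H _ e0.
  rewrite near_withinE; apply/nbhs_normP; exists r => //= h; rewrite /= ?sub0r ?normrN => hr h0.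
  have -> : d - h^-1 *: (u (h *: 1 + t) - u t) = - (h^-1 * (u (t + h) - u t - h * d)).
    rewrite -[h *: 1]/(h * 1) mulr1 -[h^-1 *: _]/(h^-1 * _) [h + t]addrC.
    by field.
  by rewrite normrN normrM normfV mulrC ler_pdivrMr ?normr_gt0// H// ltW.
split; first by apply/cvg_ex; exists d.
exact/cvg_lim.
Qed.

End Derivatives2.

(** * The mean value inequality for vector-valued functions *)

Section MeanValue.
Variable R : realType.
Implicit Types (V W : normedModType R[i]).

(** Only real linearity is asked, so that the lemma covers real parts, imaginary parts and real
    Hahn-Banach functionals alike. *)
Lemma rder_functional W (phi : W -> R) (g : R -> W) (t : R) (d : W) :
  (forall u v, phi (u + v) = phi u + phi v) ->
  (forall (s : R) v, phi (s%:C *: v) = s * phi v) ->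
  (forall v, phi v <= nr v) -> rder g t d -> is_derive t 1 (phi \o g) (phi d).
Proof.
move=> pD pZ ple gd; apply/is_derive_eps => e /gd[r r0 H]; exists r => // h /H {}H.
have pN v : phi (- v) = - phi v.
  by rewrite -scaleN1r -[-1](rmorphN1 (real_complex R)) pZ mulN1r.
have pn v : `|phi v| <= nr v.
  by rewrite ler_norml ple andbT lerNl -pN -(nrN v) ple.
by apply: le_trans H; rewrite /= -pZ -!pN -!pD.
Qed.

(** A real functional norming the increment [g b - g a] reduces the inequality to the scalar mean
    value theorem. *)
Lemma mean_value_le W (g g' : R -> W) (a b M : R) : a <= b ->
  (forall t, a <= t <= b -> rder g t (g' t)) ->
  (forall t, a < t < b -> nr (g' t) <= M) -> nr (g b - g a) <= M * (b - a).
Proof.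
rewrite le_eqVlt => /predU1P[<-|ab] gd gM; first by rewrite !subrr nr0 mulr0.
have [phi [pD pZ ple pE]] := hahn_banach_real (g b - g a).
have D t : a <= t <= b -> is_derive t 1 (phi \o g) (phi (g' t)).
  by move=> /gd; exact: rder_functional.
have [||c cab] := @MVT _ (phi \o g) (fun t => phi (g' t)) a b ab.
- move=> x; rewrite in_itv/= => /andP[ax xb]; apply: D.
  by rewrite !ltW.
- apply: continuous_in_subspaceT => x; rewrite inE/= in_itv/= => /D[+ _].
  by move=> /derivable1_diffP/differentiable_continuous.
rewrite /= -pE => E.
have -> : phi (g b - g a) = phi (g b) - phi (g a).
  by have := pD (g b - g a) (g a); rewrite subrK => ->; rewrite addrK.
rewrite E; apply: ler_wpM2r; first by rewrite subr_ge0 ltW.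
by apply: le_trans (ple _) _; apply: gM; move: cab; rewrite in_itv.
Qed.

Lemma mean_value_segment W (f f' : R[i] -> W) (z w : R[i]) (M : R) :
  (forall t : R, 0 <= t <= 1 -> vder f (z + t%:C * (w - z)) (f' (z + t%:C * (w - z)))) ->
  (forall t : R, 0 <= t <= 1 -> nr (f' (z + t%:C * (w - z))) <= M) ->
  nr (f w - f z) <= M * nr (w - z).
Proof.
move=> fd fM.
have := @mean_value_le W (fun t => f (z + t%:C * (w - z)))
  (fun t => (w - z) *: f' (z + t%:C * (w - z))) 0 1 (M * nr (w - z)) ler01.
have -> : z + 1%:C * (w - z) = w by rewrite rmorph1; ring.
have -> : z + 0%:C * (w - z) = z by rewrite rmorph0; ring.
rewrite subr0 mulr1; apply.
  by move=> t /fd/vder_line.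
by move=> t /andP[t0 t1]; rewrite nrZ mulrC ler_wpM2r ?nr_ge0// fM// !ltW.
Qed.

End MeanValue.

(** * Completeness of spaces of bounded operators *)

Section Completeness.
Variable R : realType.

(** Completeness as a property instead of a structure: spaces of multilinear maps arise by recursion
    as mere normed modules, and the property is carried along the recursion. *)
Definition nr_complete (W : normedModType R[i]) := forall u : nat -> W,
  (forall e : R, 0 < e -> exists N, forall m n, (N <= m)%N -> (N <= n)%N ->
    nr (u m - u n) <= e) ->
  exists l, forall e : R, 0 < e -> exists N, forall n, (N <= n)%N -> nr (u n - l) <= e.

Lemma completeNormedModType_nr (X : completeNormedModType R[i]) : nr_complete X.
Proof.
move=> u uc; have /cauchy_cvgP/cvg_ex[l ul] : cauchy (u @ \oo).
  apply/cauchy_ballP => e e0.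
  have eR : e = (complex.Re e)%:C by rewrite RRe_real// gtr0_real.
  rewrite eR ltr0C in e0; have e2 : 0 < complex.Re e / 2 by lra.
  have [N HN] := uc _ e2.
  exists ([set y | exists2 n, (N <= n)%N & y = u n], [set y | exists2 n, (N <= n)%N & y = u n]) => /=.
    split; exists N => // n /= Nn; exists n => //.
  move=> [y1 y2] /= [[n Nn ->] [m Nm ->]].
  rewrite -ball_normE /= eR nr_lt; apply: le_lt_trans (HN _ _ Nn Nm) _; lra.
exists l => e e0.
move/cvgrPdist_le : ul => /(_ e%:C); rewrite ltr0C => /(_ e0)[N _ HN].
by exists N => n /HN /=; rewrite nr_le nrBC.
Qed.

Lemma bounded_op_complete (V W : normedModType R[i]) :
  nr_complete W -> nr_complete (bounded_op V W : normedModType R[i]).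
Proof.
move=> cW A Ac.
have Bop (B C : bounded_op V W) v : B v - C v = (B - C) v by [].
have cv v : exists l, forall e : R, 0 < e -> exists N, forall n, (N <= n)%N ->
    nr (A n v - l) <= e.
  apply: cW => e e0; have n0 : 0 < nr v + 1 by rewrite ltr_wpDl// nr_ge0.
  have [N HN] := Ac _ (divr_gt0 e0 n0); exists N => m n Nm Nn.
  rewrite Bop; apply: le_trans (nr_op _ _) _.
  apply: le_trans (ler_wpM2r (nr_ge0 _) (HN _ _ Nm Nn)) _.
  rewrite mulrAC ler_pdivrMr// ler_wpM2l ?(ltW e0)//; lra.
pose L v := sval (cid (cv v)).
have LP v : forall e : R, 0 < e -> exists N, forall n, (N <= n)%N -> nr (A n v - L v) <= e.
  exact: svalP (cid (cv v)).
(* Sending one index of the Cauchy estimate to infinity at each [v] separately still gives a bound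
   uniform in [v]. *)
have Lu (e : R) : 0 < e -> exists N, forall n, (N <= n)%N -> forall v, nr (A n v - L v) <= e * nr v.
  move=> e0; have [N HN] := Ac _ e0; exists N => n Nn v.
  apply/ler_addgt0Pl => d d0; have [N' HN'] := LP v _ d0.
  pose k := maxn N N'; have := HN' k (leq_maxr _ _).
  move=> H; apply: le_trans (nr_tri _ (A k v) _) _; rewrite addrC lerD// Bop.
  by apply: le_trans (nr_op _ _) _; rewrite ler_wpM2r ?nr_ge0// HN// leq_maxl.
have Llin : linear L.
  move=> a u v; apply/eqP; rewrite -subr_eq0 -nr_eq0 eq_le nr_ge0 andbT.
  apply/ler_addgt0Pl => e e0; rewrite addr0.
  pose M := nr (a *: u + v) + nr a * nr u + nr v + 1.
  have M0 : 0 < M by rewrite ltr_wpDl// !addr_ge0 ?mulr_ge0 ?nr_ge0.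
  have [N HN] := Lu _ (divr_gt0 e0 M0).
  have E : L (a *: u + v) - (a *: L u + L v) =
    a *: (A N u - L u) + (A N v - L v) - (A N (a *: u + v) - L (a *: u + v)).
    rewrite [A N (_ + _)]opD opZ scalerBr [X in _ = X - _]addrACA [- (_ - L _)]opprB -opprD.
    by rewrite [RHS]addrC [RHS]addrA subrK.
  have H1 := HN N (leqnn _) u; have H2 := HN N (leqnn _) v.
  have H3 := HN N (leqnn _) (a *: u + v).
  rewrite E; apply: le_trans (nrB _ _) _.
  apply: le_trans (lerD (nrD _ _) (lexx _)) _; rewrite nrZ.
  have {}H1 := ler_wpM2l (nr_ge0 a) H1.
  apply: le_trans (lerD (lerD H1 H2) H3) _.
  have eM : e = e / M * M by rewrite mulfVK// gt_eqF.
  rewrite [leRHS]eM; move: (e / M) (divr_gt0 e0 M0) => q q0; rewrite /M; lra.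
have [N0 HN0] := Lu 1 ltr01.
have [|B BL] := @bounded_op_of _ _ _ L (1 + nr (A N0)) Llin.
  move=> v; have := HN0 N0 (leqnn _) v; rewrite mul1r nrBC => H.
  rewrite -[L v](subrK (A N0 v)); apply: le_trans (nrD _ _) _.
  by rewrite mulrDl mul1r lerD// nr_op.
exists B => e e0; have [N HN] := Lu _ e0; exists N => n Nn.
apply: nr_op_le => [|v]; first exact: ltW.
by rewrite -Bop BL HN.
Qed.

End Completeness.

(** * Cauchy's theorem on rectangles *)

Section Primitive.
Variable R : realType.

(** The fundamental theorem works on bounded intervals. The integrals from [- n], shifted to vanish
    at 0, agree where both are primitives and glue to a primitive on the line. *)
Lemma real_primitive (u : R -> R) : continuous u ->
  exists U : R -> R, forall x : R, is_derive x 1 U (u x).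
Proof.
move=> cu.
pose mu := @lebesgue_measure R.
pose U (n : nat) (x : R) := (\int[mu]_(t in [set` `[- n%:R, x]]) (u t))%R.
have dU n (x : R) : `|x| < n%:R -> is_derive x 1 (U n) (u x).
  rewrite ltr_norml => /andP[nx xn].
  have [] := @continuous_FTC1_closed R u (- n%:R) x n%:R xn _ nx (cu x).
    apply: continuous_compact_integrable; first exact: segment_compact.
    by apply: continuous_subspaceT.
  by move=> d1 d2; split; [exact: d1|rewrite -derive1E; exact: d2].
pose V n x := U n x - U n 0.
have dV n (x : R) : `|x| < n%:R -> is_derive x 1 (V n) (u x).
  move=> /dU d; rewrite -[u x]subr0.
  exact: (is_deriveB d (is_derive_cst _ _ _)).
have VE n m (x : R) : `|x| < n%:R -> `|x| < m%:R -> V n x = V m x.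
  move=> xn xm; pose D y := V n y - V m y.
  have dD (y : R) : `|y| <= `|x| -> is_derive y 1 D 0.
    move=> yx; rewrite -(subrr (u y)).
    exact: (is_deriveB (dV _ _ (le_lt_trans yx xn)) (dV _ _ (le_lt_trans yx xm))).
  have D0 : D 0 = 0 by rewrite /D /V !subrr.
  apply/eqP; rewrite -subr_eq0 -/(D x).
  have cst0 a b : a <= b -> (forall y, a <= y <= b -> `|y| <= `|x|) -> D a = D b.
    move=> ab yab; have [||c _] := @MVT_segment R D (fun=> 0) a b ab.
    - by move=> y; rewrite in_itv/= => /andP[ay yb]; apply: dD; rewrite yab ?ltW.
    - apply: continuous_in_subspaceT => y; rewrite inE/= in_itv/= => /yab/dD[+ _].
      by move=> /derivable1_diffP/differentiable_continuous.
    - by rewrite mul0r => /subr0_eq ->.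
  rewrite -D0; have [x0|x0] := leP 0 x; apply/eqP.
    by rewrite -(cst0 0 x)// => y /andP[y0 yx]; rewrite !ger0_norm.
  rewrite (cst0 x 0)//; first exact: ltW.
  by move=> y /andP[xy y0]; rewrite !ler0_norm ?lerN2// ltW.
(* The index leaves a margin of 1 around [x], so one and the same [V (N x)] serves for all [x + h]
   with [|h| <= 1]. *)
pose N (x : R) := (Num.truncn `|x|).+2.
have xN x : `|x| + 1 < (N x)%:R.
  by rewrite /N -natr1 ltrD2r truncnS_gt.
exists (fun x => V (N x) x) => x.
apply/is_derive_eps => e e0.
have xN' : `|x| < (N x)%:R by apply: le_lt_trans (xN x); rewrite lerDl.
have /is_derive_eps/(_ _ e0)[r r0 H] := dV _ _ xN'.
exists (Order.min r 1); first by rewrite lt_min r0 ltr01.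
move=> h; rewrite le_min => /andP[/H {}H h1].
have xh : `|x + h| < (N x)%:R.
  by apply: le_lt_trans (xN x); rewrite (le_trans (ler_normD _ _))// lerD2l.
by rewrite (VE _ (N x))//; apply: le_lt_trans (xN _); rewrite lerDl.
Qed.

End Primitive.

(** * Integrals of complex functions of a real variable *)

Section ComplexIntegral.
Variable R : realType.
Implicit Types (f g : R -> R[i]).

Definition rcont f := forall (t e : R), 0 < e ->
  exists2 r : R, 0 < r & forall h : R, `|h| <= r -> nr (f (t + h) - f t) <= e.

Lemma rcont_primitive f : rcont f ->
  exists U : R -> R[i], forall t, rder (W := R[i]^o) U t (f t).
Proof.
move=> cf.
have cont (u : R -> R) : (forall s t, `|u s - u t| <= nr (f s - f t)) -> continuous u.
  move=> uf t; apply/cvgrPdist_le => e /(cf t)[r r0 H].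
  apply/nbhs_normP; exists r => //= s; rewrite /ball_/= => rs.
  rewrite distrC; apply: le_trans (uf _ _) _.
  by have := H (s - t); rewrite [t + _]addrC subrK distrC; apply; exact: ltW.
have [|U dU] := @real_primitive R (fun t => complex.Re (f t)).
  by apply: cont => s t; rewrite -Re_opp -Re_add Re_le_nr.
have [|V dV] := @real_primitive R (fun t => complex.Im (f t)).
  by apply: cont => s t; rewrite -Im_opp -Im_add Im_le_nr.
exists (fun t => U t +i* V t) => t e e0; have e2 : 0 < e / 2 by lra.
have /is_derive_eps/(_ _ e2)[r r0 HU] := dU t.
have /is_derive_eps/(_ _ e2)[s s0 HV] := dV t.
exists (Order.min r s); first by rewrite lt_min r0.
move=> h; rewrite le_min => /andP[/HU {}HU /HV {}HV].
apply: le_trans (nr_le_ReIm _) _; rewrite [e]splitr mulrDl.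
have -> : h%:C *: (f t : R[i]^o) = (h * complex.Re (f t)) +i* (h * complex.Im (f t)).
  by case: (f t) => a b; apply/eqP; rewrite eq_complex /= !mul0r subr0 addr0 !eqxx.
exact: lerD.
Qed.

(** Integration through a chosen primitive makes additivity over intervals hold for every [f];
    continuity is called on only where a primitive has to exist. *)
Definition cint f (a b : R) : R[i] :=
  let U := get (fun U : R -> R[i]^o => forall t, rder U t (f t)) in U b - U a.

Lemma rderD (W : normedModType R[i]) (f g : R -> W) t a b : rder f t a -> rder g t b ->
  rder (fun t => f t + g t) t (a + b).
Proof.
move=> fa gb e e0; have e2 : 0 < e / 2 by lra.
have [r r0 Hr] := fa _ e2; have [s s0 Hs] := gb _ e2.
exists (Order.min r s); first by rewrite lt_min r0.
move=> h; rewrite le_min => /andP[/Hr h1 /Hs h2].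
have -> : f (t + h) + g (t + h) - (f t + g t) - h%:C *: (a + b) =
    (f (t + h) - f t - h%:C *: a) + (g (t + h) - g t - h%:C *: b).
  by rewrite [RHS]addrACA [X in _ = X + _]addrACA -!opprD -scalerDr.
by apply: le_trans (nrD _ _) _; lra.
Qed.

Lemma rderZ (W : normedModType R[i]) (c : R[i]) (f : R -> W) t a : rder f t a ->
  rder (fun t => c *: f t) t (c *: a).
Proof.
move=> fa e e0; have n0 : 0 < nr c + 1 by rewrite ltr_wpDl// nr_ge0.
have [r r0 Hr] := fa _ (divr_gt0 e0 n0); exists r => // h /Hr H.
rewrite scalerA [h%:C * _]mulrC -scalerA -!scalerBr nrZ.
apply: le_trans (ler_wpM2l (nr_ge0 c) H) _.
apply: le_trans (ler_shrink e0 (nr_ge0 c) (normr_ge0 h)).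
by rewrite mulrCA [nr c * _]mulrC.
Qed.

Lemma rder_const (W : normedModType R[i]) (D : R -> W) a b :
  (forall t, rder D t 0) -> D a = D b.
Proof.
move=> D0; wlog ab : a b / a <= b.
  by move=> H; case: (leP a b) => [/H //|/ltW/H ->].
apply/eqP; rewrite eq_sym -subr_eq0 -nr_eq0 eq_le nr_ge0 andbT.
have := @mean_value_le R W D (fun=> 0) a b 0 ab (fun t _ => D0 t).
by rewrite mul0r; apply => t _; rewrite nr0.
Qed.

Lemma cintE f (U : R -> R[i]) a b : (forall t, rder (W := R[i]^o) U t (f t)) ->
  cint f a b = U b - U a.
Proof.
move=> Uf; rewrite /cint; set P := fun U : R -> R[i]^o => _.
have Pg : P (get P) by apply: getPex; exists U.
set G := get P in Pg *.
have := @rder_const R[i]^o (fun t => G t + (-1 : R[i]) *: (U t : R[i]^o)) a b.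
have H t : rder (fun t => (G t : R[i]^o) + (-1 : R[i]) *: (U t : R[i]^o)) t 0.
  have := rderD (Pg t) (rderZ (-1) (Uf t)); by rewrite scaleN1r subrr.
move=> /(_ H); rewrite !scaleN1r => E.
apply/eqP; rewrite -subr_eq0 -[X in _ == X](subrr (G a - U a)) {1}E.
by apply/eqP; ring.
Qed.

Lemma cint_ex f : rcont f -> exists U : R -> R[i],
  (forall t, rder (W := R[i]^o) U t (f t)) /\ forall a b, cint f a b = U b - U a.
Proof. by move=> /rcont_primitive[U Uf]; exists U; split=> // a b; exact: cintE. Qed.

Lemma cint_chasles f a b c : cint f a b + cint f b c = cint f a c.
Proof. by rewrite /cint; ring. Qed.

Lemma cintD f g a b : rcont f -> rcont g ->
  cint (fun t => f t + g t) a b = cint f a b + cint g a b.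
Proof.
move=> /cint_ex[U [Uf ->]] /cint_ex[V [Vg ->]].
by rewrite (@cintE _ (fun t => U t + V t)) => [|t]; [ring|exact: rderD].
Qed.

Lemma cintZ f (c : R[i]) a b : rcont f ->
  cint (fun t => c * f t) a b = c * cint f a b.
Proof.
move=> /cint_ex[U [Uf ->]].
by rewrite (@cintE _ (fun t => c * U t)) => [|t]; [ring|exact: rderZ].
Qed.

Lemma cint_le f (M : R) a b : rcont f -> a <= b ->
  (forall t, a <= t <= b -> nr (f t) <= M) -> nr (cint f a b) <= M * (b - a).
Proof.
move=> /cint_ex[U [Uf ->]] ab fM; apply: (@mean_value_le R R[i]^o U f) => //.
by move=> t /andP[at_ tb]; apply: fM; rewrite !ltW.
Qed.

Lemma cint_Re_ge0 f a b : rcont f -> a <= b ->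
  (forall t, a <= t <= b -> 0 <= complex.Re (f t)) -> 0 <= complex.Re (cint f a b).
Proof.
move=> /cint_ex[U [Uf ->]]; rewrite le_eqVlt => /predU1P[<- _|ab f0].
  by rewrite subrr.
have D (t : R) : is_derive t 1 ((fun v : R[i]^o => complex.Re v) \o U) (complex.Re (f t)).
  apply: (@rder_functional R R[i]^o) (Uf t).
  - by move=> u v; rewrite Re_add.
  - by move=> s [x y] /=; rewrite mul0r subr0.
  - by move=> v; apply: le_trans (Re_le_nr v); rewrite ler_norm.
have [|c cab] := @MVT _ _ (fun t => complex.Re (f t)) a b ab (fun t _ => D t).
  apply: continuous_subspaceT => x; have [+ _] := D x.
  by move=> /derivable1_diffP/differentiable_continuous.
rewrite /= => E; rewrite Re_add Re_opp E mulr_ge0//.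
  by apply: f0; move: cab; rewrite in_itv/= => /andP[ac cb]; rewrite !ltW.
by rewrite subr_ge0 ltW.
Qed.

Lemma rder_id t : rder (W := R[i]^o) (fun t => t%:C) t 1.
Proof.
move=> e e0; exists 1 => // h _.
have -> : (t + h)%:C - t%:C - h%:C *: (1 : R[i]^o) = 0 :> R[i]^o.
  by rewrite [h%:C *: _]mulr1 rmorphD; ring.
by rewrite nr0 mulr_ge0// ltW.
Qed.

Lemma cint_affine (u v : R[i]) a b :
  cint (fun t => u + v * t%:C) a b = u * (b - a)%:C + v * ((b ^+ 2 - a ^+ 2) / 2)%:C.
Proof.
rewrite (@cintE _ (fun t => u * t%:C + v * (t ^+ 2 / 2)%:C)).
  by rewrite !mulrBl !rmorphB/=; ring.
move=> t; apply: rderD.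
  by have := rderZ u (rder_id t); rewrite [u *: 1]mulr1.
apply: (@rderZ R[i]^o v) => e e0; exists e => // h he.
have -> : ((t + h) ^+ 2 / 2)%:C - (t ^+ 2 / 2)%:C - h%:C *: (t%:C : R[i]^o) = (h ^+ 2 / 2)%:C.
  by rewrite -[h%:C *: _]/(h%:C * _) -rmorphM -!rmorphB; congr (_%:C); field.
rewrite -[nr _]/(nr ((h ^+ 2 / 2)%:C : R[i])) nrR ger0_norm ?divr_ge0 ?sqr_ge0// -real_normK ?num_real//.
have := normr_ge0 h; nra.
Qed.

Lemma rcont_affine (u v : R[i]) : rcont (fun t => u + v * t%:C).
Proof.
move=> t e e0; exists (e / (nr v + 1)); first by rewrite divr_gt0// ltr_wpDl// nr_ge0.
move=> h; rewrite ler_pdivlMr; last by rewrite ltr_wpDl// nr_ge0.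
have -> : u + v * (t + h)%:C - (u + v * t%:C) = v * h%:C by rewrite rmorphD; ring.
by rewrite nrM nrR; have := nr_ge0 v; have := normr_ge0 h; nra.
Qed.

Lemma rcontD f g : rcont f -> rcont g -> rcont (fun t => f t + g t).
Proof.
move=> cf cg t e e0; have e2 : 0 < e / 2 by lra.
have [r r0 H] := cf t _ e2; have [s s0 H'] := cg t _ e2.
exists (Order.min r s); first by rewrite lt_min r0.
move=> h; rewrite le_min => /andP[/H h1 /H' h2].
have -> : f (t + h) + g (t + h) - (f t + g t) =
  (f (t + h) - f t) + (g (t + h) - g t) by ring.
by apply: le_trans (nrD _ _) _; lra.
Qed.

Lemma rcontZ f (c : R[i]) : rcont f -> rcont (fun t => c * f t).
Proof.
move=> cf t e e0; have n0 : 0 < nr c + 1 by rewrite ltr_wpDl// nr_ge0.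
have [r r0 H] := cf t _ (divr_gt0 e0 n0); exists r => // h /H.
rewrite ler_pdivlMr// -mulrBr nrM; have := nr_ge0 (f (t + h) - f t); nra.
Qed.

End ComplexIntegral.

(** * Boundary integrals over rectangles and Goursat's subdivision *)

Section Goursat.
Variable R : realType.

Definition rect_int (f : R -> R -> R[i]) (a b c d : R) : R[i] :=
  cint (f ^~ c) a b + 'i * cint (f b) c d - cint (f ^~ d) a b - 'i * cint (f a) c d.

Lemma rect_int_splitx (f : R -> R -> R[i]) a m b c d :
  rect_int f a b c d = rect_int f a m c d + rect_int f m b c d.
Proof.
rewrite /rect_int -(cint_chasles (f ^~ c) a m b) -(cint_chasles (f ^~ d) a m b).
by ring.
Qed.

Lemma rect_int_splity (f : R -> R -> R[i]) a b c m d :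
  rect_int f a b c d = rect_int f a b c m + rect_int f a b m d.
Proof.
rewrite /rect_int -(cint_chasles (f a) c m d) -(cint_chasles (f b) c m d).
by ring.
Qed.

(** Affine functions of [x + i y] integrate to zero around the rectangle, by direct computation, so
    only the deviation from one counts; it is multiplied by the perimeter. *)
Lemma rect_int_le (f : R -> R -> R[i]) (u v : R[i]) (a b c d M : R) :
  (forall y, rcont (f ^~ y)) -> (forall x, rcont (f x)) -> a <= b -> c <= d ->
  (forall x y, a <= x <= b -> c <= y <= d ->
     nr (f x y - (u + v * (x%:C + 'i * y%:C))) <= M) ->
  nr (rect_int f a b c d) <= M * 2 * ((b - a) + (d - c)).
Proof.
move=> cx cy ab cd fM.
pose hor y := fun t : R => (u + v * 'i * y%:C) + v * t%:C.
pose ver x := fun t : R => (u + v * x%:C) + v * 'i * t%:C.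
have Hh y : c <= y <= d -> exists2 e : R[i], nr e <= M * (b - a) &
    cint (f ^~ y) a b = e + cint (hor y) a b.
  move=> yb; exists (cint (fun t => f t y + -1 * hor y t) a b).
    apply: cint_le => //; first by apply: rcontD => //; apply: rcontZ; exact: rcont_affine.
    move=> t tb; apply: le_trans (fM t y tb yb).
    by rewrite le_eqVlt; apply/orP; left; apply/eqP; congr nr; rewrite /hor; ring.
  rewrite cintD//; last by apply: rcontZ; exact: rcont_affine.
  by rewrite cintZ; [ring|exact: rcont_affine].
have Hv x : a <= x <= b -> exists2 e : R[i], nr e <= M * (d - c) &
    cint (f x) c d = e + cint (ver x) c d.
  move=> xb; exists (cint (fun t => f x t + -1 * ver x t) c d).
    apply: cint_le => //; first by apply: rcontD => //; apply: rcontZ; exact: rcont_affine.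
    move=> t tb; apply: le_trans (fM x t xb tb).
    by rewrite le_eqVlt; apply/orP; left; apply/eqP; congr nr; rewrite /ver; ring.
  rewrite cintD//; last by apply: rcontZ; exact: rcont_affine.
  by rewrite cintZ; [ring|exact: rcont_affine].
have [|e1 E1 F1] := Hh c; first by rewrite lexx.
have [|e2 E2 F2] := Hh d; first by rewrite lexx cd.
have [|e3 E3 F3] := Hv a; first by rewrite lexx.
have [|e4 E4 F4] := Hv b; first by rewrite lexx ab.
have -> : rect_int f a b c d = (e1 - e2) + 'i * (e4 - e3).
  rewrite /rect_int F1 F2 F3 F4 /hor /ver !cint_affine.
  have i2 : ('i : R[i]) * 'i = -1 by rewrite -expr2 sqr_i.
  rewrite !rmorphB !rmorphM/= !rmorphB/= !rmorphXn/=.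
  set I := 'i in i2 *.
  transitivity (e1 - e2 + I * (e4 - e3) + (I * I + 1) * v * (c%:C - d%:C) * 0
     + v * (I * c%:C - I * d%:C) * (b%:C - a%:C) + I * v * (b%:C - a%:C) * (d%:C - c%:C)).
    by field.
  by field.
have ni : nr ('i : R[i]) = 1.
  by apply/eqP; rewrite -(eqrXn2 (n := 2))// ?nr_ge0// nrS/= expr0n add0r !expr1n.
apply: le_trans (nrD _ _) _; rewrite nrM ni mul1r.
have := nrB e1 e2; have := nrB e4 e3; lra.
Qed.

Lemma nested_intervals (x w : nat -> R) : (forall n, 0 <= w n) ->
  (forall n, x n <= x n.+1) -> (forall n, x n.+1 + w n.+1 <= x n + w n) ->
  exists X, forall n, x n <= X <= x n + w n.
Proof.
move=> w0 xS wS.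
have xm m n : (m <= n)%N -> x m <= x n.
  by elim: n => [|n IH]; [rewrite leqn0 => /eqP ->|rewrite leq_eqVlt => /predU1P[->//|/IH/le_trans]; apply].
have wm m n : (m <= n)%N -> x n + w n <= x m + w m.
  elim: n => [|n IH]; first by rewrite leqn0 => /eqP ->.
  by rewrite leq_eqVlt => /predU1P[->//|/IH]; apply: le_trans.
have ub n m : x m <= x n + w n.
  apply: le_trans (xm m (maxn m n) (leq_maxl _ _)) _.
  by apply: le_trans (wm n (maxn m n) (leq_maxr _ _)); rewrite lerDl.
have hs : has_sup (range x).
  by split; [exists (x 0%N), 0%N|exists (x 0%N + w 0%N) => _ [n _ <-]; exact: ub].
exists (sup (range x)) => n; apply/andP; split.
  by apply: (sup_upper_bound hs); exists n.
by apply: ge_sup; [case: hs|move=> _ [m _ <-]; exact: ub].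
Qed.

Lemma half_pow_small (L d : R) : 0 <= L -> 0 < d -> exists n, L / 2 ^+ n <= d.
Proof.
move=> L0 d0; exists (Num.truncn (L / d)).+1.
rewrite ler_pdivrMr ?exprn_gt0//.
have h : L / d < (Num.truncn (L / d)).+1%:R by rewrite truncnS_gt.
rewrite mulrC -ler_pdivrMr//; apply/ltW/(lt_le_trans h).
by rewrite -natrX ler_nat ltnW// ltn_expl.
Qed.

(** Repeated quartering keeps at least a fourth of the integral, while near the limit point the
    deviation from an affine function makes it smaller than that. Differentiability is relative to
    the closed rectangle, because the lemma will be applied to a function made constant in [x]
    beyond one side. *)
Lemma goursat (f : R -> R -> R[i]) (a b c d : R) :
  (forall y, rcont (f ^~ y)) -> (forall x, rcont (f x)) -> a <= b -> c <= d ->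
  (forall X Y, a <= X <= b -> c <= Y <= d -> exists D : R[i], forall e : R, 0 < e ->
    exists2 r : R, 0 < r & forall x y, a <= x <= b -> c <= y <= d ->
    nr ((x - X)%:C + 'i * (y - Y)%:C) <= r ->
    nr (f x y - f X Y - D * ((x - X)%:C + 'i * (y - Y)%:C)) <=
      e * nr ((x - X)%:C + 'i * (y - Y)%:C)) ->
  rect_int f a b c d = 0.
Proof.
move=> cx cy ab cd fD; apply/eqP; rewrite -nr_eq0 eq_le nr_ge0 andbT leNgt.
apply/negP; set eta := nr _ => eta0.
pose w n : R := (b - a) / 2 ^+ n; pose h n : R := (d - c) / 2 ^+ n.
have w0 n : 0 <= w n by rewrite divr_ge0 ?exprn_ge0// subr_ge0.
have h0 n : 0 <= h n by rewrite divr_ge0 ?exprn_ge0// subr_ge0.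
have wS n : w n = w n.+1 + w n.+1 by rewrite /w exprS; field; rewrite expf_neq0 ?pnatr_eq0.
have hS n : h n = h n.+1 + h n.+1 by rewrite /h exprS; field; rewrite expf_neq0 ?pnatr_eq0.
pose Q n (p : R * R) := nr (rect_int f p.1 (p.1 + w n) p.2 (p.2 + h n)).
(* [p] and [q] are lower left corners; the integral is the sum over the four quarters, so one of
   them carries a fourth of it. *)
have step n (p : R * R) : {q : R * R | [/\ p.1 <= q.1, q.1 + w n.+1 <= p.1 + w n,
    p.2 <= q.2, q.2 + h n.+1 <= p.2 + h n & Q n p / 4 <= Q n.+1 q]}.
  apply: cid; pose x := p.1; pose y := p.2; pose W := w n.+1; pose H := h n.+1.
  have W0 : 0 <= W := w0 _; have H0 : 0 <= H := h0 _.
  have E : Q n p <= Q n.+1 (x, y) + Q n.+1 (x + W, y) + (Q n.+1 (x, y + H) + Q n.+1 (x + W, y + H)).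
    have wE : p.1 + w n = x + W + W by rewrite wS addrA.
    have hE : p.2 + h n = y + H + H by rewrite hS addrA.
    rewrite /Q/= -/x -/y wE hE (rect_int_splity f x _ y (y + H)).
    rewrite (rect_int_splitx f x (x + W) (x + W + W) y (y + H)).
    rewrite (rect_int_splitx f x (x + W) (x + W + W) (y + H) (y + H + H)).
    by apply: le_trans (nrD _ _) (lerD (nrD _ _) (nrD _ _)).
  have [q1|] := leP (Q n p / 4) (Q n.+1 (x, y)).
    by exists (x, y); split=> //=; rewrite -/x -/y ?(wS n) ?(hS n) -/W -/H; lra.
  have [q2 _|] := leP (Q n p / 4) (Q n.+1 (x + W, y)).
    by exists (x + W, y); split=> //=; rewrite -/x -/y ?(wS n) ?(hS n) -/W -/H; lra.
  have [q3 _ _|] := leP (Q n p / 4) (Q n.+1 (x, y + H)).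
    by exists (x, y + H); split=> //=; rewrite -/x -/y ?(wS n) ?(hS n) -/W -/H; lra.
  have [q4 _ _ _|] := leP (Q n p / 4) (Q n.+1 (x + W, y + H)).
    by exists (x + W, y + H); split=> //=; rewrite -/x -/y ?(wS n) ?(hS n) -/W -/H; lra.
  lra.
pose P := fix P n := if n is m.+1 then sval (step m (P m)) else (a, c).
have PS n := svalP (step n (P n)).
have PQ n : eta / 4 ^+ n <= Q n (P n).
  elim: n => [|n IH].
    by rewrite /Q /= expr0 divr1 /w /h expr0 !divr1 !(addrC _ (_ - _)) !subrK.
  have [_ _ _ _] := PS n; apply: le_trans.
  by rewrite exprSr invfM mulrA ler_wpM2r ?invr_ge0 ?ler0n.
have Pa n : a <= (P n).1 by elim: n => //= n IH; have [+ _ _ _ _] := PS n; exact: le_trans.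
have Pc n : c <= (P n).2 by elim: n => //= n IH; have [_ _ + _ _] := PS n; exact: le_trans.
have Pb n : (P n).1 + w n <= b.
  elim: n => [|n IH]; first by rewrite /= /w expr0 divr1 addrC subrK.
  by have [_ + _ _ _] := PS n => /le_trans; apply.
have Pd n : (P n).2 + h n <= d.
  elim: n => [|n IH]; first by rewrite /= /h expr0 divr1 addrC subrK.
  by have [_ _ _ + _] := PS n => /le_trans; apply.
have [||X HX] := @nested_intervals (fun n => (P n).1) w w0.
- by move=> n; have [] := PS n.
- by move=> n; have [] := PS n.
have [||Y HY] := @nested_intervals (fun n => (P n).2) h h0.
- by move=> n; have [] := PS n.
- by move=> n; have [] := PS n.
have [||D HD] := fD X Y.
- have /andP[h1 h2] := HX 0%N; have := Pb 0%N; have := Pa 0%N; lra.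
- have /andP[h1 h2] := HY 0%N; have := Pd 0%N; have := Pc 0%N; lra.
pose L := (b - a) + (d - c).
have L0 : 0 <= L by rewrite addr_ge0// subr_ge0.
(* At level [n] the bound is [e] times [2 L^2 / 4^n], which this choice puts strictly below
   [eta / 4^n]; the added 1 also covers [L = 0]. *)
pose e := eta / (2 * L ^+ 2 + 1).
have L2 : 0 < 2 * L ^+ 2 + 1 by have := sqr_ge0 L; lra.
have [r r0 Hr] := HD e (divr_gt0 eta0 L2).
have [n Hn] := half_pow_small L0 r0.
have wh : w n + h n = L / 2 ^+ n by rewrite /w /h /L -mulrDl.
have dist x y : (P n).1 <= x <= (P n).1 + w n -> (P n).2 <= y <= (P n).2 + h n ->
    nr ((x - X)%:C + 'i * (y - Y)%:C) <= w n + h n.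
  move=> /andP[x1 x2] /andP[y1 y2]; apply: le_trans (nr_le_ReIm _) _.
  rewrite Re_add Im_add Re_mul Im_mul/= !mul0r !mul1r !subr0 ?add0r ?addr0 ?oppr0 ?addr0.
  have /andP[X1 X2] := HX n; have /andP[Y1 Y2] := HY n.
  by apply: lerD; rewrite ler_norml; lra.
have := PQ n; rewrite leNgt => /negP; apply.
have := @rect_int_le f (f X Y - D * (X%:C + 'i * Y%:C)) D
  (P n).1 ((P n).1 + w n) (P n).2 ((P n).2 + h n) (e * (w n + h n)) cx cy.
rewrite !lerDl => /(_ (w0 n) (h0 n)) H.
apply: le_lt_trans (H _) _.
  move=> x y xb yb; have dxy := dist x y xb yb.
  have -> : f x y - (f X Y - D * (X%:C + 'i * Y%:C) + D * (x%:C + 'i * y%:C)) =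
     f x y - f X Y - D * ((x - X)%:C + 'i * (y - Y)%:C).
    by rewrite !rmorphB/=; ring.
  have ee : 0 <= e by rewrite ltW// divr_gt0.
  apply: le_trans (Hr _ _ _ _ _) (ler_wpM2l ee dxy).
  - have := Pa n; have := Pb n; lra.
  - have := Pc n; have := Pd n; lra.
  - by apply: le_trans dxy _; rewrite wh.
have -> : (P n).1 + w n - (P n).1 + ((P n).2 + h n - (P n).2) = w n + h n by ring.
rewrite wh.
have -> : e * (L / 2 ^+ n) * 2 * (L / 2 ^+ n) = e * (2 * L ^+ 2) / 4 ^+ n.
  rewrite (_ : 4 = 2 * 2 :> R); last by ring.
  by rewrite exprMn; field; rewrite expf_neq0 ?pnatr_eq0.
rewrite ltr_pM2r ?invr_gt0 ?exprn_gt0//.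
rewrite [ltRHS](_ : eta = e * (2 * L ^+ 2 + 1)); last by rewrite mulfVK// gt_eqF.
by rewrite ltr_pM2l ?divr_gt0//; lra.
Qed.

End Goursat.

(** * The complex exponential *)

Section ComplexExponential.
Variable R : realType.

Definition ccont (f : R[i] -> R[i]) z := forall e : R, 0 < e ->
  exists2 r : R, 0 < r & forall h : R[i], nr h <= r -> nr (f (z + h) - f z) <= e.

Lemma vder_ccont (f : R[i] -> R[i]) z (d : R[i]) : vder (W := R[i]^o) f z d -> ccont f z.
Proof. by move=> fd e; exact: (vder_cvg fd). Qed.

Lemma rcont_comp (f : R[i] -> R[i]) (g : R -> R[i]) :
  rcont g -> (forall t, ccont f (g t)) -> rcont (fun t => f (g t)).
Proof.
move=> cg cf t e /(cf t)[r r0 H]; have [s s0 H'] := cg t _ r0.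
by exists s => // h /H' /H; rewrite [g t + _]addrC subrK.
Qed.

Definition cexp (w : R[i]) : R[i] :=
  (expR (complex.Re w))%:C * (cos (complex.Im w) +i* sin (complex.Im w)).

Lemma cexpD u v : cexp (u + v) = cexp u * cexp v.
Proof.
case: u v => [a b] [c d]; rewrite /cexp /= expRD cosD sinD.
by apply/eqP; rewrite eq_complex/=; apply/andP; split; apply/eqP; ring.
Qed.

Lemma cexp0 : cexp 0 = 1.
Proof. by rewrite /cexp/= expR0 cos0 sin0 mul1r. Qed.

Lemma nr_cexp w : nr (cexp w) = expR (complex.Re w).
Proof.
rewrite /cexp nrM nrR ger0_norm ?expR_ge0// -[RHS]mulr1; congr (_ * _).
by apply/eqP; rewrite -(eqrXn2 (n := 2))// ?nr_ge0// nrS/= cos2Dsin2 expr1n.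
Qed.

Lemma cexp_neq0 w : cexp w != 0.
Proof. by rewrite -nr_gt0 nr_cexp expR_gt0. Qed.

Lemma cexpN w : cexp (- w) = (cexp w)^-1.
Proof.
apply: (mulfI (cexp_neq0 w)); rewrite -cexpD subrr cexp0 divff//.
exact: cexp_neq0.
Qed.

Lemma cexp_2pi w : cexp (w + 'i * (pi *+ 2)%:C) = cexp w.
Proof.
have -> : 'i * (pi *+ 2)%:C = 0 +i* (pi *+ 2) :> R[i].
  by apply/eqP; rewrite eq_complex/=; apply/andP; split; apply/eqP; ring.
by rewrite cexpD {2}/cexp/= expR0 mul1r cos2pi sin2pi mulr1.
Qed.

(** The functional equation moves the question to the point 0, where the real derivatives of [expR],
    [cos] and [sin] suffice. *)
Lemma vder_cexp w : vder (W := R[i]^o) cexp w (cexp w).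
Proof.
have cE (h : R[i]) : cexp h - 1 - h = ((expR (complex.Re h) - 1 - complex.Re h) +
       expR (complex.Re h) * (cos (complex.Im h) - 1)) +i*
       (expR (complex.Re h) * (sin (complex.Im h) - complex.Im h) +
        (expR (complex.Re h) - 1) * complex.Im h).
  rewrite /cexp; case: h => a b /=; apply/eqP; rewrite eq_complex/=.
  by apply/andP; split; apply/eqP; ring.
have E0 : forall e : R, 0 < e -> exists2 r : R, 0 < r & forall h : R[i],
     nr h <= r -> nr (cexp h - 1 - h) <= e * nr h.
  (* The four error terms below add up to [9 q n], with [q] serving both as tolerance and as radius;
     [q <= e / 16] leaves a margin, and [q <= 1 / 16] keeps the exponential factor below 3. *)
  move=> e e0; have [q [q0 qe q1]] : exists q : R, [/\ 0 < q, q <= e / 16 & q <= 1 / 16].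
    exists (Order.min (e / 16) (1 / 16)); rewrite !ge_min !lexx orbT; split=> //.
    by rewrite lt_min; apply/andP; split; lra.
  have /is_derive_eps/(_ _ q0)[r1 r10 H1] := @is_derive_expR R 0.
  have /is_derive_eps/(_ _ q0)[r2 r20 H2] := @is_derive_cos R 0.
  have /is_derive_eps/(_ _ q0)[r3 r30 H3] := @is_derive_sin R 0.
  exists (Order.min (Order.min r1 r2) (Order.min r3 (Order.min 1 q))).
    by rewrite !lt_min r10 r20 r30 ltr01 q0.
  move=> h; rewrite !le_min => /andP[/andP[h1 h2] /andP[h3 /andP[h4 h5]]].
  have Rh := Re_le_nr h; have Ih := Im_le_nr h.
  have {}H1 := H1 _ (le_trans Rh h1).
  have {}H2 := H2 _ (le_trans Ih h2).
  have {}H3 := H3 _ (le_trans Ih h3).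
  move: H1 H2 H3; rewrite !add0r expR0 cos0 sin0 oppr0 mulr0 !mulr1 !subr0 ?addr0.
  move: h4 h5 Rh Ih (nr_ge0 h); set n := nr h.
  rewrite cE.
  move: (complex.Re h) (complex.Im h) (expR _) (cos _) (sin _) => x y E c s.
  move=> n1 n8 xn yn n0 E1 c1 s1.
  apply: le_trans (nr_le_ReIm _) _ => /=.
  have bnd (u v : R) : `|u| <= q * `|v| -> `|v| <= n -> `|u| <= q * n.
    by move=> uv vn; apply: le_trans uv _; rewrite ler_wpM2l// ltW.
  have {}E1 := bnd _ _ E1 xn; have {}c1 := bnd _ _ c1 yn; have {}s1 := bnd _ _ s1 yn.
  have qn : q * n <= n by apply: ler_piMl => //; lra.
  have E3 : `|E - 1| <= n *+ 2.
    rewrite -[E - 1](subrK x); apply: le_trans (ler_normD _ _) _.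
    by rewrite mulr2n lerD// (le_trans E1).
  have E4 : `|E| <= 3.
    rewrite -[E](subrK 1); apply: le_trans (ler_normD _ _) _; rewrite normr1; lra.
  have m1 : `|E * (c - 1)| <= 3 * (q * n) by rewrite normrM ler_pM.
  have m2 : `|E * (s - y)| <= 3 * (q * n) by rewrite normrM ler_pM.
  have m3 : `|(E - 1) * y| <= 2 * (q * n).
    rewrite normrM; apply: le_trans (ler_pM _ _ E3 yn) _ => //.
    by rewrite -[n *+ 2]mulr_natl -mulrA ler_wpM2l// ler_wpM2r.
  have qe' : q * n * 16 <= e * n.
    by rewrite mulrAC; apply: ler_wpM2r => //; lra.
  apply: le_trans (lerD (ler_normD _ _) (ler_normD _ _)) _. have := mulr_ge0 (ltW q0) n0; lra.
rewrite /=; apply: vder_scalar => e e0.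
have n0 : 0 < nr (cexp w) by rewrite nr_gt0 cexp_neq0.
have [r r0 H] := E0 _ (divr_gt0 e0 n0); exists r => // h /H {}H.
rewrite cexpD (_ : _ - _ - _ = cexp w * (cexp h - 1 - h)); last by ring.
by rewrite nrM mulrC -ler_pdivlMr// mulrAC.
Qed.

End ComplexExponential.

(** * Cauchy's formula *)

Section CircleAverage.
Variable R : realType.
Implicit Types (f g : R[i] -> R[i]).

Definition avg f : R[i] :=
  cint (fun t => f (cexp ('i * t%:C))) 0 (pi *+ 2) / (pi *+ 2)%:C.

Definition circle_cont f := forall z, nr z = 1 -> ccont f z.

Lemma nr_circle (t : R) : nr (cexp ('i * t%:C)) = 1.
Proof. by rewrite nr_cexp Re_mul/= mul0r mul1r subr0 expR0. Qed.

Lemma rcont_circle f : circle_cont f -> rcont (fun t : R => f (cexp ('i * t%:C))).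
Proof.
move=> cf; apply: (rcont_comp (g := fun t => cexp ('i * t%:C))); last first.
  by move=> t; apply: cf; exact: nr_circle.
apply: (rcont_comp (f := @cexp R) (g := fun t => 'i * t%:C)).
  by have := @rcont_affine R 0 'i; congr rcont; apply/funext => t; rewrite add0r.
by move=> t; apply: vder_ccont; exact: vder_cexp.
Qed.

Lemma pi2_gt0 : 0 < (pi *+ 2 : R). Proof. by rewrite pmulrn_lgt0// pi_gt0. Qed.

Lemma pi2C_neq0 : (pi *+ 2)%:C != 0 :> R[i].
Proof. by rewrite -nr_gt0 nrR normr_gt0 gt_eqF// pi2_gt0. Qed.

Lemma avg_ext f g : (forall z, nr z = 1 -> f z = g z) -> avg f = avg g.
Proof.
move=> fg; rewrite /avg; congr (cint _ _ _ / _); apply/funext => t.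
by rewrite fg// nr_circle.
Qed.

Lemma avgD f g : circle_cont f -> circle_cont g ->
  avg (fun z => f z + g z) = avg f + avg g.
Proof.
by move=> cf cg; rewrite /avg cintD ?mulrDl//; exact: rcont_circle.
Qed.

Lemma avgZ f c : circle_cont f -> avg (fun z => c * f z) = c * avg f.
Proof. by move=> cf; rewrite /avg cintZ ?mulrA//; exact: rcont_circle. Qed.

Lemma avg_le f (M : R) : circle_cont f -> (forall z, nr z = 1 -> nr (f z) <= M) ->
  nr (avg f) <= M.
Proof.
move=> cf fM; rewrite /avg nrM nrV nrR (gtr0_norm pi2_gt0) ler_pdivrMr ?pi2_gt0//.
rewrite -[pi *+ 2 in leRHS]subr0; apply: cint_le; first exact: rcont_circle.
  exact/ltW/pi2_gt0.
by move=> t _; apply: fM; exact: nr_circle.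
Qed.

Lemma avg_Re_ge0 f : circle_cont f ->
  (forall z, nr z = 1 -> 0 <= complex.Re (f z)) -> 0 <= complex.Re (avg f).
Proof.
move=> cf f0; rewrite /avg -fmorphV mulrC Re_mul/= mul0r subr0 mulr_ge0//.
  by rewrite invr_ge0 ltW// pi2_gt0.
apply: cint_Re_ge0; first exact: rcont_circle.
  exact/ltW/pi2_gt0.
by move=> t _; apply: f0; exact: nr_circle.
Qed.

(** Truncating the real part at 0 keeps its exponential in the closed unit disc while giving
    continuity along whole lines, as Goursat's lemma asks. *)
Lemma rcont_min0 (y : R) : rcont (fun t : R => (Order.min t 0)%:C + 'i * y%:C).
Proof.
move=> t e e0; exists e => // h he.
have -> : (Order.min (t + h) 0)%:C + 'i * y%:C - ((Order.min t 0)%:C + 'i * y%:C) =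
  (Order.min (t + h) 0 - Order.min t 0)%:C :> R[i] by rewrite rmorphB; ring.
rewrite nrR; apply: le_trans he; rewrite !minEle.
case: (leP (t + h) 0); case: (leP t 0) => h1 h2; rewrite ?subrr ?normr0// ler_norml.
- have -> : t + h - t = h by ring.
  by rewrite -ler_norml.
- have [h0|h0] := leP 0 h; first lra.
  by rewrite (ltr0_norm h0); lra.
- have [h0|h0] := leP 0 h; [rewrite (ger0_norm h0)|rewrite (ltr0_norm h0)]; lra.
Qed.

(* In the logarithmic coordinate w = x + i y the boundary integral over a
   rectangle of height 2 pi only sees its vertical sides; letting the left one
   go to -oo yields the mean value property without assuming that the function
   is differentiable at the centre. *)
Lemma avg_mean f : (forall z, z != 0 -> nr z <= 1 ->
    exists d : R[i], vder (W := R[i]^o) f z d) ->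
  ccont f 0 -> avg f = f 0.
Proof.
move=> fd f0.
pose m (x : R) := Order.min x 0.
pose F (x y : R) := f (cexp ((m x)%:C + 'i * y%:C)).
have m0 x : m x <= 0 by rewrite ge_min lexx orbT.
have Fin x y : nr (cexp ((m x)%:C + 'i * y%:C)) <= 1.
  by rewrite nr_cexp Re_add Re_mul/= mul0r mulr0 subr0 addr0 -expR0 ler_expR.
have Fc x y : ccont f (cexp ((m x)%:C + 'i * y%:C)).
  have [d] := fd _ (cexp_neq0 _) (Fin x y); exact: vder_ccont.
have cexpc w : ccont (@cexp R) w by apply: vder_ccont; exact: vder_cexp.
have cx y : rcont (F ^~ y).
  apply: (rcont_comp (g := fun x => cexp ((m x)%:C + 'i * y%:C))) => //.
  exact: (rcont_comp (@rcont_min0 y)).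
have cy x : rcont (F x).
  apply: (rcont_comp (g := fun y => cexp ((m x)%:C + 'i * y%:C))) => //.
  apply: (rcont_comp (g := fun y => (m x)%:C + 'i * y%:C)) => //.
  exact: rcont_affine.
have A x : x <= 0 -> cint (F x) 0 (pi *+ 2) = cint (F 0) 0 (pi *+ 2).
  move=> x0; have := @goursat R F x 0 0 (pi *+ 2) cx cy x0 (ltW pi2_gt0).
  have mE y : y <= 0 -> m y = y by move=> y0; apply/min_idPl.
  have HF X Y : x <= X <= 0 -> 0 <= Y <= pi *+ 2 -> exists D : R[i], forall e : R, 0 < e ->
    exists2 r : R, 0 < r & forall x1 y, x <= x1 <= 0 -> 0 <= y <= pi *+ 2 ->
    nr ((x1 - X)%:C + 'i * (y - Y)%:C) <= r ->
    nr (F x1 y - F X Y - D * ((x1 - X)%:C + 'i * (y - Y)%:C)) <=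
      e * nr ((x1 - X)%:C + 'i * (y - Y)%:C).
    move=> /andP[_ X0] _; have [d Hd] := fd _ (cexp_neq0 _) (Fin X Y).
    have := vder_comp (@vder_cexp R _) Hd; set D := (_ *: _) => HD.
    exists D => e /HD[r r0 Hr]; exists r => // x1 y /andP[_ x10] _ /Hr.
    rewrite -[_ *: D]/(_ * D) [_ * D]mulrC /F !mE//.
    by rewrite (_ : X%:C + 'i * Y%:C + _ = x1%:C + 'i * y%:C) // !rmorphB/=; ring.
  move=> /(_ HF); rewrite /rect_int.
  have -> : F ^~ (pi *+ 2) = F ^~ 0.
    by apply/funext => s; rewrite /F rmorph0 mulr0 addr0 cexp_2pi.
  rewrite [X in X = _ -> _](_ : _ = 'i * (cint (F 0) 0 (pi *+ 2) - cint (F x) 0 (pi *+ 2))); last by ring.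
  move=> /eqP; rewrite mulf_eq0 subr_eq0.
  by rewrite eq_complex/= oner_eq0 andbF/= => /eqP ->.
apply/eqP; rewrite -subr_eq0 -nr_eq0 eq_le nr_ge0 andbT.
apply/ler_addgt0Pl => e e0; rewrite addr0.
have [r r0 Hr] := f0 _ e0.
pose x := Order.min (ln r) 0.
have x0 : x <= 0 by rewrite ge_min lexx orbT.
have -> : avg f = cint (F x) 0 (pi *+ 2) / (pi *+ 2)%:C.
  rewrite A// /avg; congr (cint _ _ _ / _); apply/funext => t.
  by rewrite /F /m minxx rmorph0 add0r.
have c0 : cint (fun=> f 0) 0 (pi *+ 2) = f 0 * (pi *+ 2)%:C.
  have := @cint_affine R (f 0) 0 0 (pi *+ 2); rewrite mul0r addr0 subr0 => <-.
  by congr cint; apply/funext => t; rewrite mul0r addr0.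
have cc : rcont (fun=> f 0).
  by move=> t d d0; exists 1 => // h _; rewrite subrr nr0 ltW.
have -> : cint (F x) 0 (pi *+ 2) / (pi *+ 2)%:C - f 0 =
    cint (fun t => F x t + -1 * f 0) 0 (pi *+ 2) / (pi *+ 2)%:C.
  rewrite (@cintD _ (F x) (fun=> -1 * f 0))//; last exact: rcontZ.
  rewrite (@cintZ _ (fun=> f 0))// c0.
  by move: (cint _ _ _) ((pi *+ 2)%:C) pi2C_neq0 => C P P0; field.
rewrite nrM nrV nrR (gtr0_norm pi2_gt0) ler_pdivrMr ?pi2_gt0//.
rewrite -[pi *+ 2 in leRHS]subr0; apply: cint_le; last first.
- move=> t _; rewrite mulN1r; have := Hr (cexp ((m x)%:C + 'i * t%:C)).
  rewrite add0r; apply; rewrite nr_cexp Re_add Re_mul/= mul0r mulr0 subr0 addr0.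
  by rewrite -[r in leRHS]lnK ?posrE// ler_expR /m /x !ge_min lexx.
- exact/ltW/pi2_gt0.
- by apply: rcontD => //; apply: rcontZ.
Qed.

End CircleAverage.

(** * Cauchy's formula for the first derivative and Cauchy estimates *)

Section CauchyEstimates.
Variable R : realType.

Lemma circle_cont_vder (f : R[i] -> R[i]) :
  (forall z, nr z = 1 -> exists d : R[i], vder (W := R[i]^o) f z d) -> circle_cont f.
Proof. by move=> fd z /fd[d]; exact: vder_ccont. Qed.

Lemma nr1_neq0 (z : R[i]) : nr z = 1 -> z != 0.
Proof. by move=> z1; rewrite -nr_gt0 z1 ltr01. Qed.

Lemma avg_cexp (g : R[i] -> R[i]) (v : R[i]) : v != 0 -> cexp ((pi *+ 2)%:C * v) = 1 ->
  (forall t : R, g (cexp ('i * t%:C)) = cexp (t%:C * v)) -> avg g = 0.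
Proof.
move=> v0 v1 gE; rewrite /avg.
have -> : (fun t : R => g (cexp ('i * t%:C))) = (fun t => cexp (t%:C * v)).
  by apply/funext => t; rewrite gE.
rewrite (@cintE _ _ (fun t => v^-1 * cexp (t%:C * v))).
  by rewrite v1 rmorph0 mul0r cexp0 subrr mul0r.
move=> t; have := rderZ v^-1 (vder_line0 (@vder_cexp R (t%:C * v))).
by rewrite scalerA mulVf// scale1r.
Qed.

Lemma avg_inv n : (0 < n <= 2)%N -> avg (fun z : R[i] => z ^- n) = 0.
Proof.
move=> /andP[n0 n2].
have cn w k : cexp (w *+ k) = cexp w ^+ k :> R[i].
  by elim: k => [|k IH]; rewrite ?expr0 ?mulr0n ?cexp0// mulrSr exprSr cexpD IH.
apply: (@avg_cexp _ ((- 'i) *+ n)).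
- rewrite mulrn_eq0 negb_or -lt0n n0 oppr_eq0/=.
  by rewrite eq_complex/= oner_eq0 andbF.
- rewrite mulrnAr cn mulrN cexpN mulrC -[_ * _]add0r cexp_2pi cexp0 invr1 expr1n//.
- move=> t; rewrite mulrnAr cn mulrN cexpN exprVn; congr (_ ^- _).
  by rewrite mulrC.
Qed.

(** The mean value property of the difference quotient, completed at the centre by the derivative;
    continuity there is all it requires. The remaining term [f 0 / z] has mean zero. *)
Lemma cauchy_formula (f f' : R[i] -> R[i]) (rho r : R) :
  (forall z, nr z < rho -> vder (W := R[i]^o) f z (f' z)) -> 0 < r < rho ->
  avg (fun z => f (r%:C * z) * z^-1) = r%:C * f' 0.
Proof.
move=> fd /andP[r0 rrho].
have rin z : nr z <= 1 -> nr (r%:C * z) < rho.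
  by move=> z1; apply: le_lt_trans rrho; rewrite nrM nrR gtr0_norm// ger_pMr.
pose G z := if z == 0 then r%:C * f' 0 else (f (r%:C * z) - f 0) * z^-1.
have Gd z : z != 0 -> nr z <= 1 -> exists d : R[i], vder (W := R[i]^o) G z d.
  move=> z0 z1; eexists.
  apply: (@vder_near R R[i]^o (fun z => (f (r%:C * z) - f 0) * z^-1) _ _ _ (nr z / 2)).
  - by rewrite divr_gt0// nr_gt0.
  - move=> h hz; rewrite /G ifF//; apply/negbTE; rewrite -nr_gt0.
    have := nr_tri z (- h) 0; rewrite !subr0 opprK nrN.
    have : 0 < nr z by rewrite nr_gt0.
    lra.
  - apply: vderM; last exact: vder_inv.
    apply: vderB; last exact: vder_cst.
    by apply: vder_comp; [exact: vder_mull|apply: fd; exact: rin].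
have G0 : ccont G 0.
  move=> e e0; have er : 0 < e / r by rewrite divr_gt0.
  have rho0 : nr (0 : R[i]) < rho by rewrite nr0 (lt_trans r0).
  have [s s0 H] := fd _ rho0 _ er; exists (s / r); first by rewrite divr_gt0.
  move=> h hs; rewrite add0r /G eqxx; case: eqVneq => [_|h0].
    by rewrite subrr nr0 ltW.
  have nh : 0 < nr h by rewrite nr_gt0.
  have := H (r%:C * h); rewrite nrM nrR gtr0_norm// add0r.
  rewrite mulrC -ler_pdivlMr// => /(_ hs).
  rewrite -[_ *: f' 0]/(r%:C * h * f' 0) => {}H.
  have -> : (f (r%:C * h) - f 0) / h - r%:C * f' 0 =
     (f (r%:C * h) - f 0 - r%:C * h * f' 0) / h by field.
  rewrite nrM nrV ler_pdivrMr//; apply: le_trans H _.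
  by rewrite le_eqVlt; apply/orP; left; apply/eqP; field; rewrite gt_eqF.
have := avg_mean Gd G0; rewrite {2}/G eqxx => <-.
have Gc : circle_cont G.
  by apply: circle_cont_vder => z z1; apply: Gd; [exact: nr1_neq0|rewrite z1].
have ic : circle_cont (fun z : R[i] => z^-1).
  apply: circle_cont_vder => z /nr1_neq0 z0; eexists; exact: vder_inv.
have fc : circle_cont (fun z => f 0 * z^-1).
  apply: circle_cont_vder => z /nr1_neq0 z0; eexists.
  by apply: vderM; [exact: vder_cst|exact: vder_inv].
rewrite -[RHS]addr0 -[X in _ = _ + X](mulr0 (f 0)).
rewrite -[X in _ = _ + _ * X](@avg_inv 1%N)//.
rewrite -avgZ// -avgD//; apply: avg_ext => z /nr1_neq0 z0.
by rewrite /G (negbTE z0) expr1; ring.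
Qed.

(** Cauchy's formula is applied to [T \o F] with [T] norming [F' 0]. The factor 2 comes from using
    the circle of radius [rho / 2]. *)
Lemma cauchy_le (W : normedModType R[i]) (F F' : R[i] -> W) (rho M : R) : 0 < rho ->
  (forall z, nr z < rho -> vder F z (F' z)) ->
  (forall z, nr z < rho -> nr (F z) <= M) -> nr (F' 0) <= 2 * M / rho.
Proof.
move=> rho0 Fd FM; have [T [TE Tle]] := hahn_banach (F' 0).
have Td z : nr z < rho -> vder (W := R[i]^o) (fun z => T (F z)) z (T (F' z)).
  by move=> /Fd; exact: vder_op.
have r2 : 0 < rho / 2 < rho by apply/andP; split; lra.
have := cauchy_formula Td r2; rewrite TE nrE => E.
have rin z : nr z <= 1 -> nr ((rho / 2)%:C * z) < rho.
  move=> z1; rewrite nrM nrR gtr0_norm; last lra.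
  by have := nr_ge0 z; nra.
have : nr (avg (fun z => T (F ((rho / 2)%:C * z)) / z)) <= M.
  apply: avg_le.
    apply: circle_cont_vder => z z1; eexists.
    have zr : nr z <= 1 by rewrite z1.
    exact: (vderM (vder_comp (@vder_mull R _ z) (Td _ (rin z zr)))
      (vder_inv (nr1_neq0 z1))).
  move=> z z1; rewrite nrM nrV z1 invr1 mulr1.
  by apply: le_trans (Tle _) (FM _ _); apply: rin; rewrite z1.
rewrite E nrM !nrR (ger0_norm (nr_ge0 _)) gtr0_norm; last lra.
by rewrite ler_pdivlMr//; lra.
Qed.

Lemma vder_shift (W : normedModType R[i]) (F : R[i] -> W) (z w : R[i]) d :
  vder F (z + w) d -> vder (fun w => F (z + w)) w d.
Proof. by move=> Fd e /Fd[r r0 H]; exists r => // h /H; rewrite addrA. Qed.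

(** A second-order bound without a second derivative: discs of radius [rho / 4] give
    [|F'| <= 8 M / rho], hence increments [F (w + u) - F u] of size [8 M / rho * |w|]; the same
    estimate for this increment as a function of [u] gives [64 M / rho^2 * |w|] for [F' w - F' 0],
    and the mean value inequality concludes. *)
Lemma cauchy_taylor (W : normedModType R[i]) (F F' : R[i] -> W) (rho M : R) : 0 < rho ->
  (forall z, nr z < rho -> vder F z (F' z)) ->
  (forall z, nr z < rho -> nr (F z) <= M) ->
  forall z, nr z <= rho / 2 -> nr (F z - F 0 - z *: F' 0) <= 64 * M / rho ^+ 2 * nr z ^+ 2.
Proof.
move=> rho0 Fd FM z zr.
have rho4 : 0 < rho / 4 by lra.
have F'M w : nr w < rho * 3 / 4 -> nr (F' w) <= 8 * M / rho.
  move=> wr.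
  have win u : nr u < rho / 4 -> nr (w + u) < rho by have := nrD w u; lra.
  have := @cauchy_le W (fun u => F (w + u)) (fun u => F' (w + u)) (rho / 4) M rho4.
  rewrite addr0 (_ : 2 * M / (rho / 4) = 8 * M / rho); last by field; rewrite gt_eqF.
  apply=> u /win uin; last exact: FM.
  by apply: vder_shift; apply: Fd.
have F'L w : nr w <= rho / 2 -> nr (F' w - F' 0) <= 64 * M / rho ^+ 2 * nr w.
  move=> wr.
  have := @cauchy_le W (fun u => F (w + u) - F u) (fun u => F' (w + u) - F' u)
     (rho / 4) (8 * M / rho * nr w) rho4.
  rewrite addr0 (_ : 2 * _ / (rho / 4) = 64 * M / rho ^+ 2 * nr w); last first.
    by field; rewrite gt_eqF.
  apply=> u ur.
    have wu : nr (w + u) < rho by have := nrD w u; lra.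
    by apply: vderB; [apply: vder_shift|]; apply: Fd => //; lra.
  have seg (t : R) : 0 <= t <= 1 -> nr (u + t%:C * (w + u - u)) < rho * 3 / 4.
    move=> /andP[t0 t1]; rewrite addrK; have := nrD u (t%:C * w).
    by rewrite nrM nrR ger0_norm//; have := nr_ge0 w; nra.
  have := @mean_value_segment R W F F' u (w + u) (8 * M / rho).
  rewrite addrK; apply=> t t01; have := seg t t01; rewrite addrK => st.
    by apply: Fd; lra.
  exact: F'M.
have seg (t : R) : 0 <= t <= 1 -> nr (t%:C * z) <= nr z.
  by move=> /andP[t0 t1]; rewrite nrM nrR ger0_norm// ler_piMl ?nr_ge0.
have := @mean_value_segment R W (fun w => F w - w *: F' 0) (fun w => F' w - F' 0) 0 z
  (64 * M / rho ^+ 2 * nr z).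
rewrite subr0 scale0r subr0 -[_ * nr z * nr z]mulrA -expr2 [F z - _ - F 0]addrAC; apply=> t t01; rewrite add0r.
  apply: vderB; first by apply: Fd; have := seg t t01; lra.
  have := vderZ (@vder_id R (t%:C * z)) (@vder_cst R W (F' 0) (t%:C * z)).
  by rewrite scale1r scaler0 addr0.
apply: le_trans (F'L _ _) _; first by apply: le_trans (seg _ t01) _.
apply: ler_wpM2l (seg _ t01).
have M0 : 0 <= M by apply: le_trans (nr_ge0 _) (FM 0 _); rewrite nr0.
by rewrite divr_ge0 ?mulr_ge0 ?exprn_ge0// ltW.
Qed.

End CauchyEstimates.

(** * Fréchet differentiability of holomorphic maps *)

Lemma subrBB (U : zmodType) (a b c d : U) : (a - b) - (c - d) = (a - c) - (b - d).
Proof. by rewrite !opprB addrACA [RHS]addrACA [- b - c]addrC. Qed.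

Section FrechetHolomorphy.
Variables (R : realType) (V W : normedModType R[i]).
Implicit Types (F G : V -> W) (x y h k : V).

Lemma hasD_shift F x (a : V) (L : V -> W) : hasD F (x + a) L -> hasD (fun y => F (y + a)) x L.
Proof. by move=> Fd e /Fd[r r0 H]; exists r => // h /H; rewrite [x + a + h]addrAC. Qed.

Lemma hasDB F G x (A B : V -> W) : hasD F x A -> hasD G x B ->
  hasD (fun y => F y - G y) x (fun h => A h - B h).
Proof.
move=> fa gb e e0; have e2 : 0 < e / 2 by lra.
have [r r0 Hr] := fa _ e2; have [s s0 Hs] := gb _ e2.
exists (Order.min r s); first by rewrite lt_min r0.
move=> h; rewrite le_min => /andP[/Hr h1 /Hs h2].
rewrite [X in nr (X - _)]subrBB [X in nr X]subrBB.
by apply: le_trans (nrB _ _) _; lra.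
Qed.

Lemma hasD_scale F x (A : V -> W) (c : R[i]) : hasD F x A ->
  hasD (fun y => c *: F y) x (fun h => c *: A h).
Proof.
move=> fa e e0; have n0 : 0 < nr c + 1 by rewrite ltr_wpDl// nr_ge0.
have [r r0 Hr] := fa _ (divr_gt0 e0 n0); exists r => // h /Hr H.
rewrite -!scalerBr nrZ; apply: le_trans (ler_wpM2l (nr_ge0 c) H) _.
apply: le_trans (ler_shrink e0 (nr_ge0 c) (nr_ge0 h)).
by rewrite mulrCA [nr c * _]mulrC.
Qed.

Lemma frechet_vder F x h z : differentiable F (x + z *: h) ->
  vder (fun z => F (x + z *: h)) z (frechet F (x + z *: h) h).
Proof. by move=> /differentiable_hasD; exact: hasD_vder. Qed.

(** On the complex line through [x] in direction [k], the ball of radius [rho] cuts out a disc of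
    radius [rho / nr k], where the one-variable estimate applies. *)
Lemma frechet_le F x (rho M : R) : 0 < rho ->
  (forall y, nr (y - x) < rho -> differentiable F y) ->
  (forall y, nr (y - x) < rho -> nr (F y) <= M) ->
  forall k, nr (frechet F x k) <= 2 * M / rho * nr k.
Proof.
move=> rho0 Fd FM k; have [->|k0] := eqVneq k 0; first by rewrite op0 !nr0 mulr0.
have nk : 0 < nr k by rewrite nr_gt0.
have zin z : nr z < rho / nr k -> nr (x + z *: k - x) < rho.
  by rewrite addrAC subrr add0r nrZ ltr_pdivlMr.
have := @cauchy_le R W (fun z => F (x + z *: k)) (fun z => frechet F (x + z *: k) k)
  (rho / nr k) M (divr_gt0 rho0 nk).
rewrite scale0r addr0 invf_div mulrA mulrAC; apply=> z /zin zr; last exact: FM.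
by apply: frechet_vder; exact: Fd.
Qed.

Lemma frechet_taylor F x (rho M : R) : 0 < rho ->
  (forall y, nr (y - x) < rho -> differentiable F y) ->
  (forall y, nr (y - x) < rho -> nr (F y) <= M) ->
  forall k, nr k <= rho / 2 ->
    nr (F (x + k) - F x - frechet F x k) <= 64 * M / rho ^+ 2 * nr k ^+ 2.
Proof.
move=> rho0 Fd FM k kr; have [->|k0] := eqVneq k 0.
  by rewrite op0 addr0 subrr subr0 !nr0 expr0n/= mulr0.
have nk : 0 < nr k by rewrite nr_gt0.
have zin z : nr z < rho / nr k -> nr (x + z *: k - x) < rho.
  by rewrite addrAC subrr add0r nrZ ltr_pdivlMr.
have := @cauchy_taylor R W (fun z => F (x + z *: k)) (fun z => frechet F (x + z *: k) k)
  (rho / nr k) M (divr_gt0 rho0 nk).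
move=> /(_ _ _ 1); rewrite scale0r addr0 !scale1r nr1 expr1n mulr1.
have -> : 64 * M / (rho / nr k) ^+ 2 = 64 * M / rho ^+ 2 * nr k ^+ 2.
  by field; rewrite !gt_eqF.
apply=> [z /zin zr|z /zin zr|]; [|exact: FM|].
  by apply: frechet_vder; exact: Fd.
by rewrite mulrAC ler_pdivlMr// mul1r.
Qed.

End FrechetHolomorphy.

(** * Differentiability of the Fréchet derivative *)

Section FrechetTwice.
Variables (R : realType) (V W : normedModType R[i]).
Hypothesis cW : nr_complete W.
Variables (F : V -> W) (x : V) (rho M : R).
Hypotheses (rho0 : 0 < rho) (Fd : forall y, nr (y - x) < rho -> differentiable F y)
  (FM : forall y, nr (y - x) < rho -> nr (F y) <= M).

Let D y := frechet F y.
Let K1 := 4 * M / rho.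
Let K2 := 256 * M / rho ^+ 2.
Let s0 := rho / 8.

Let M0 : 0 <= M.
Proof. by apply: le_trans (nr_ge0 _) (@FM x _); rewrite subrr nr0. Qed.

Let K20 : 0 <= K2.
Proof. by rewrite divr_ge0 ?mulr_ge0 ?exprn_ge0// ltW. Qed.

Let in_ball y k : nr (y - x) < rho / 2 -> nr k < rho / 2 -> nr (y + k - x) < rho.
Proof.
move=> yr kr; have := nrD (y - x) k; rewrite addrAC; move: yr kr; lra.
Qed.

Let D_le y : nr (y - x) < rho / 2 -> nr (D y) <= K1.
Proof.
move=> yr; have r2 : 0 < rho / 2 by rewrite divr_gt0.
apply: nr_op_le => [|k]; first by rewrite divr_ge0 ?mulr_ge0// ltW.
have -> : K1 = 2 * M / (rho / 2) by rewrite /K1; field; rewrite gt_eqF.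
by apply: frechet_le => // z zr; [apply: Fd|apply: FM];
  have := in_ball yr zr; rewrite [y + _]addrC subrK.
Qed.

Let D_taylor y k : nr (y - x) < rho / 2 -> nr k <= rho / 4 ->
  nr (F (y + k) - F y - D y k) <= K2 * nr k ^+ 2.
Proof.
move=> yr kr; have r2 : 0 < rho / 2 by rewrite divr_gt0.
have -> : K2 = 64 * M / (rho / 2) ^+ 2 by rewrite /K2; field; rewrite gt_eqF.
have zin z : nr (z - y) < rho / 2 -> nr (z - x) < rho.
  by move=> zr; have := in_ball yr zr; rewrite [y + _]addrC subrK.
apply: frechet_taylor => // [z /zin|z /zin|]; [exact: Fd|exact: FM|by move: kr; lra].
Qed.

(** [G s h] is the difference quotient of [F] in direction [h], and [B s h] is its derivative at
    [x], an approximation of the second derivative at [h]. By the Cauchy estimates, bounds on [G]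
    near [x] become operator-norm bounds on [B]. *)
Let G (s : R) h y := s^-1%:C *: (F (y + s%:C *: h) - F y).
Let B (s : R) h : bounded_op V W := s^-1%:C *: (D (x + s%:C *: h) - D x).

Let s_in (s : R) (h : V) : 0 < s <= s0 -> nr h <= 1 -> nr (s%:C *: h) <= s.
Proof. by move=> /andP[sp _] h1; rewrite nrZ nrR gtr0_norm// ler_piMr// ltW. Qed.

Let G_hasD (s : R) (h y : V) : 0 < s <= s0 -> nr h <= 1 -> nr (y - x) < rho / 2 ->
  hasD (G s h) y (s^-1%:C *: (D (y + s%:C *: h) - D y) : bounded_op V W).
Proof.
move=> ss h1 yr; have sh := s_in ss h1; move/andP: (ss) => [sp sle].
have d1 : differentiable F (y + s%:C *: h).
  by apply: Fd; apply: in_ball => //; move: sh sle; rewrite /s0; lra.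
have d2 : differentiable F y by apply: Fd; move: rho0 yr; lra.
by apply/hasD_scale/hasDB; [apply: hasD_shift|]; exact: differentiable_hasD.
Qed.

Let G_frechet (s : R) (h y : V) : 0 < s <= s0 -> nr h <= 1 -> nr (y - x) < rho / 2 ->
  differentiable (G s h) y /\
  frechet (G s h) y = s^-1%:C *: (D (y + s%:C *: h) - D y).
Proof. by move=> ss h1 yr; apply: hasD_frechet; exact: G_hasD. Qed.

Let G_near (s : R) (h y : V) : 0 < s <= s0 -> nr h <= 1 -> nr (y - x) < rho / 2 ->
  nr (G s h y - D y h) <= K2 * s.
Proof.
move=> ss h1 yr; have sh := s_in ss h1; move/andP: (ss) => [sp sle].
have -> : G s h y - D y h =
    s^-1%:C *: (F (y + s%:C *: h) - F y - D y (s%:C *: h)).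
  by rewrite scalerBr opZ scalerA -rmorphM mulVf ?gt_eqF// scale1r.
rewrite nrZ nrR gtr0_norm ?invr_gt0// mulrC ler_pdivrMr//.
apply: le_trans (D_taylor _ _) _ => //; first by move: sh sle; rewrite /s0; lra.
by rewrite -[leRHS]mulrA -expr2 ler_wpM2l// ler_pXn2r ?nnegrE ?nr_ge0// ltW.
Qed.

(** Near [x] both [G s h] and [G t h] are close to [D y h], uniformly in [y]; their difference is
    therefore small on a ball, and so is its derivative at the centre. *)
Let B_cauchy (s t : R) (h : V) : 0 < s <= s0 -> 0 < t <= s0 -> nr h <= 1 ->
  nr (B s h - B t h) <= 4 * K2 / rho * (s + t).
Proof.
move=> ss tt h1; have r2 : 0 < rho / 2 by rewrite divr_gt0.
have x0 : nr (x - x) < rho / 2 by rewrite subrr nr0.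
have st0 : 0 <= s + t by move: ss tt; lra.
apply: nr_op_le => [|k]; first by apply: mulr_ge0 => //; apply: divr_ge0; [exact: mulr_ge0|exact: ltW].
have HD y : nr (y - x) < rho / 2 -> differentiable (fun y => G s h y - G t h y) y /\
   frechet (fun y => G s h y - G t h y) y =
     s^-1%:C *: (D (y + s%:C *: h) - D y) - t^-1%:C *: (D (y + t%:C *: h) - D y).
  move=> yr; apply: hasD_frechet; apply: hasDB; exact: G_hasD.
have := @frechet_le _ _ _ (fun y => G s h y - G t h y) x (rho / 2) (K2 * s + K2 * t) r2.
rewrite (HD _ x0).2 -/(B s h) -/(B t h).
have -> : 2 * (K2 * s + K2 * t) / (rho / 2) = 4 * K2 / rho * (s + t).
  by field; rewrite gt_eqF.
apply=> y yr; first by have [] := HD _ yr.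
apply: le_trans (nr_tri _ (D y h) _) _; apply: lerD; first exact: G_near.
by rewrite nrBC; exact: G_near.
Qed.

Let K3 := 256 * (K2 * s0 + K1) / rho ^+ 2.

Let s00 : 0 < s0. Proof. by rewrite divr_gt0. Qed.

Let K10 : 0 <= K1.
Proof. by apply: divr_ge0; [exact: mulr_ge0|exact: ltW]. Qed.

Let K30 : 0 <= K3.
Proof.
apply: divr_ge0; last by apply: exprn_ge0; exact: ltW.
apply: mulr_ge0 => //; apply: addr_ge0 => //.
by apply: mulr_ge0 => //; exact: ltW.
Qed.

Let G_taylor (s : R) (h k : V) : 0 < s <= s0 -> nr h <= 1 -> nr k <= rho / 4 ->
  nr (G s h (x + k) - G s h x - B s h k) <= K3 * nr k ^+ 2.
Proof.
move=> ss h1 kr; have r2 : 0 < rho / 2 by rewrite divr_gt0.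
have x0 : nr (x - x) < rho / 2 by rewrite subrr nr0.
have := @frechet_taylor _ _ _ (G s h) x (rho / 2) (K2 * s0 + K1) r2.
rewrite (G_frechet ss h1 x0).2 -/(B s h).
have -> : 64 * (K2 * s0 + K1) / (rho / 2) ^+ 2 = K3 by rewrite /K3; field; rewrite gt_eqF.
apply=> [y yr|y yr|]; [by have [] := G_frechet ss h1 yr| |by move: kr; lra].
rewrite -[G s h y](subrK (D y h)); apply: le_trans (nrD _ _) _; apply: lerD.
  apply: le_trans (G_near ss h1 yr) _; rewrite ler_wpM2l//.
  by case/andP: ss.
apply: le_trans (nr_op _ _) _; apply: le_trans (D_le yr).
by rewrite ler_piMr ?nr_ge0.
Qed.

(** Both operators approximate the same second difference of [F], which is symmetric in [h] and
    [k]. *)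
Let B_sym (s : R) (h k : V) : 0 < s <= s0 -> nr h <= 1 -> nr k <= 1 ->
  nr (B s h k - B s k h) <= 2 * K3 * s.
Proof.
move=> ss h1 k1; move/andP: (ss) => [sp sle].
have T u v : nr u <= 1 -> nr v <= 1 -> nr (s^-1%:C *: (G s u (x + s%:C *: v) - G s u x) - B s u v) <= K3 * s.
  move=> u1 v1; have sv := s_in ss v1.
  have -> : s^-1%:C *: (G s u (x + s%:C *: v) - G s u x) - B s u v =
    s^-1%:C *: (G s u (x + s%:C *: v) - G s u x - B s u (s%:C *: v)).
    by rewrite [RHS]scalerBr opZ scalerA -rmorphM mulVf ?gt_eqF// scale1r.
  rewrite nrZ nrR gtr0_norm ?invr_gt0// mulrC ler_pdivrMr//.
  apply: le_trans (G_taylor _ _ _) _ => //; first by move: sv sle; rewrite /s0; lra.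
  by rewrite -[leRHS]mulrA -expr2 ler_wpM2l// ler_pXn2r ?nnegrE ?nr_ge0// ltW.
have E : G s h (x + s%:C *: k) - G s h x = G s k (x + s%:C *: h) - G s k x.
  rewrite /G -!scalerBr; congr (_ *: _).
  by rewrite subrBB [x + _ + s%:C *: h]addrAC.
have := T k h k1 h1; rewrite -E => Tk; have := T h k h1 k1; rewrite nrBC => Th.
apply: le_trans (nr_tri _ (s^-1%:C *: (G s h (x + s%:C *: k) - G s h x)) _) _.
by apply: le_trans (lerD Th Tk) _; lra.
Qed.

Let C1 := 4 * K2 / rho.

Let C10 : 0 <= C1.
Proof. by apply: divr_ge0; [exact: mulr_ge0|exact: ltW]. Qed.

Let B_lim (h : V) : nr h <= 1 -> exists L : bounded_op V W,
  forall s, 0 < s <= s0 -> nr (B s h - L) <= C1 * s.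
Proof.
move=> h1; pose u n : R := s0 / n.+1%:R.
have u0 n : 0 < u n <= s0.
  rewrite divr_gt0//= ler_pdivrMr// ler_peMr ?(ltW s00)// ler1n //.
have usmall (e : R) : 0 < e -> exists N, forall n, (N <= n)%N -> u n <= e.
  move=> e0; exists (Num.truncn (s0 / e)) => n Nn.
  rewrite ler_pdivrMr// mulrC -ler_pdivrMr//.
  apply/ltW/(lt_le_trans (_ : s0 / e < (Num.truncn (s0 / e)).+1%:R)).
    by rewrite truncnS_gt.
  by rewrite ler_nat ltnS.
have C11 : 0 < C1 + C1 + 1 by move: C10; lra.
have [|L HL] := @bounded_op_complete R V W cW (fun n => B (u n) h).
  move=> e e0; have [N HN] := usmall _ (divr_gt0 e0 C11); exists N => m n /HN Nm /HN Nn.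
  apply: le_trans (B_cauchy (u0 m) (u0 n) h1) _; rewrite -/C1.
  apply: le_trans (ler_wpM2l C10 (lerD Nm Nn)) _.
  rewrite -mulr2n -mulr_natl mulrA mulrCA ler_piMr ?(ltW e0)// ler_pdivrMr//.
  by move: C10; lra.
exists L => s ss; apply/ler_addgt0Pl => e e0.
have [N HN] := HL _ (divr_gt0 e0 (ltr0n R 2)).
have e2 : 0 < e / 2 / (C1 + 1) by rewrite !divr_gt0//; move: C10; lra.
have [N' HN'] := usmall _ e2; pose n := maxn N N'.
have h2 := HN n (leq_maxl _ _); have h3 := HN' n (leq_maxr _ _).
apply: le_trans (nr_tri _ (B (u n) h) _) _.
apply: le_trans (lerD (B_cauchy ss (u0 n) h1) h2) _; rewrite -/C1.
have : C1 * u n <= e / 2.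
  move: h3; rewrite ler_pdivlMr; last by move: C10; lra.
  by case/andP: (u0 n); move: (u n) => v v0 _; lra.
by rewrite mulrDr; lra.
Qed.

Let Bu (h : V) : bounded_op V W :=
  if pselect (nr h <= 1) is left h1 then sval (cid (B_lim h1)) else 0.

Let BuP (h : V) s : nr h <= 1 -> 0 < s <= s0 -> nr (B s h - Bu h) <= C1 * s.
Proof.
by move=> h1 ss; rewrite /Bu; case: pselect => // h1'; case: cid => L /= /(_ _ ss).
Qed.

Let small_eq0 (U : normedModType R[i]) (v : U) (C : R) : 0 <= C ->
  (forall s, 0 < s <= s0 -> nr v <= C * s) -> v = 0.
Proof.
move=> C0 H; apply/eqP; rewrite -nr_eq0 eq_le nr_ge0 andbT.
apply/ler_addgt0Pl => e e0; rewrite addr0.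
have e1 : 0 < e / (C + 1) by rewrite divr_gt0// ltr_wpDl.
pose s := Order.min s0 (e / (C + 1)).
have ss : 0 < s <= s0 by rewrite lt_min s00 e1 ge_min lexx.
apply: le_trans (H s ss) _.
have : s <= e / (C + 1) by rewrite ge_min lexx orbT.
by rewrite ler_pdivlMr ?ltr_wpDl//; case/andP: ss; move: (s) => t t0 _; lra.
Qed.

Let Bu_sym (h k : V) : nr h <= 1 -> nr k <= 1 -> Bu h k = Bu k h.
Proof.
move=> h1 k1; apply/eqP; rewrite -subr_eq0; apply/eqP.
apply: (@small_eq0 _ _ (2 * C1 + 2 * K3)) => [|s ss].
  by rewrite addr_ge0// mulr_ge0.
have app (A A' : bounded_op V W) v : nr v <= 1 -> nr (A v - A' v) <= nr (A - A').
  move=> v1; have -> : A v - A' v = (A - A') v by [].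
  by apply: le_trans (nr_op _ _) _; rewrite ler_piMr ?nr_ge0.
have := le_trans (app _ _ _ k1) (BuP h1 ss).
have := le_trans (app _ _ _ h1) (BuP k1 ss).
rewrite nrBC => e1; rewrite nrBC => e2.
apply: le_trans (nr_tri _ (B s h k) _) _.
apply: le_trans (lerD e2 (nr_tri _ (B s k h) _)) _.
apply: le_trans (lerD (lexx _) (lerD (B_sym ss h1 k1) _)) _; first by rewrite nrBC; exact: e1.
lra.
Qed.

Let n1 (h : V) : R := nr h + 1.

Let n10 h : 0 < n1 h. Proof. by rewrite ltr_wpDl// nr_ge0. Qed.

Let unit_le h : nr ((n1 h)^-1%:C *: h) <= 1.
Proof.
rewrite nrZ nrR gtr0_norm ?invr_gt0// mulrC ler_pdivrMr// mul1r /n1.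
by rewrite lerDl ler01.
Qed.

Let n1K h : (n1 h)%:C *: ((n1 h)^-1%:C *: h) = h.
Proof. by rewrite scalerA -rmorphM mulfV ?gt_eqF// scale1r. Qed.

(** Limits were taken for directions in the unit ball only; the scale [nr h + 1] brings every [h]
    there and never vanishes. *)
Let D2 (h : V) : bounded_op V W := (n1 h)%:C *: Bu ((n1 h)^-1%:C *: h).

Let D2_sym h k : D2 h k = D2 k h.
Proof.
have E u v : D2 u v = ((n1 u)%:C * (n1 v)%:C) *:
    Bu ((n1 u)^-1%:C *: u) ((n1 v)^-1%:C *: v).
  by rewrite -scalerA -opZ n1K.
by rewrite !E Bu_sym ?unit_le// mulrC.
Qed.

(** Linearity in [k] is free, as each [D2 h] is an operator; the symmetry carries it over to [h]. *)
Let D2_linear : linear D2.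
Proof.
move=> a u v; apply: val_inj; apply/funext => k /=.
rewrite -[LHS]/(D2 (a *: u + v) k) D2_sym opD opZ.
by rewrite -(D2_sym u) -(D2_sym v).
Qed.

Let D2_near h s : 0 < s -> s * n1 h <= s0 ->
  nr (s^-1%:C *: (D (x + s%:C *: h) - D x) - D2 h) <= C1 * s * n1 h ^+ 2.
Proof.
move=> sp sh; have ss : 0 < s * n1 h <= s0 by rewrite mulr_gt0.
have := BuP (unit_le h) ss.
have -> : B (s * n1 h) ((n1 h)^-1%:C *: h) - Bu ((n1 h)^-1%:C *: h) =
  (n1 h)^-1%:C *: (s^-1%:C *: (D (x + s%:C *: h) - D x) - D2 h).
  have hE : (s * n1 h)%:C *: ((n1 h)^-1%:C *: h) = s%:C *: h.
    by rewrite scalerA -rmorphM mulfK ?gt_eqF.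
  have e1 : (n1 h)^-1%:C * (n1 h)%:C = 1 by rewrite -rmorphM mulVf ?gt_eqF.
  have e2 : (n1 h)^-1%:C * s^-1%:C = (s * n1 h)^-1%:C :> R[i].
    by rewrite -rmorphM invfM mulrC.
  by rewrite /B hE [RHS]scalerBr /D2 2![in RHS]scalerA e1 e2 scale1r.
rewrite nrZ nrR gtr0_norm ?invr_gt0// mulrC ler_pdivrMr// => H.
by apply: le_trans H _; rewrite expr2 !mulrA.
Qed.

Lemma frechet_differentiable_bounded :
  differentiable (frechet F : V -> (bounded_op V W : normedModType R[i])) x.
Proof.
have x0 : nr (x - x) < rho / 2 by rewrite subrr nr0 divr_gt0.
(* The difference quotient at a single step bounds [D2 h]; the step [s0 / 2] is admissible because
   [n1 h <= 2]. *)
have unit_bound (h : V) : nr h <= 1 -> nr (D2 h) <= 4 * C1 * (s0 / 2) + 2 * K1 / (s0 / 2).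
  move=> h1; pose s := s0 / 2.
  have sp : 0 < s by rewrite divr_gt0.
  have n2 : n1 h <= 2 by rewrite /n1; lra.
  have sn : s * n1 h <= s0.
    by apply: le_trans (_ : s * 2 <= _); [rewrite ler_pM2l|rewrite /s; lra].
  have := D2_near sp sn; rewrite nrBC => H.
  rewrite -[D2 h](subrK (s^-1%:C *: (D (x + s%:C *: h) - D x))).
  apply: le_trans (nrD _ _) _; apply: lerD.
    apply: le_trans H _; rewrite -/s.
    have : n1 h ^+ 2 <= 4.
      by rewrite (_ : 4 = 2 ^+ 2 :> R); [rewrite ler_pXn2r// nnegrE ltW|ring].
    by have := mulr_ge0 C10 (ltW sp); move: (n1 h ^+ 2) => q; nra.
  rewrite nrZ nrR gtr0_norm ?invr_gt0// mulrC ler_pM2r ?invr_gt0//.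
  apply: le_trans (nrB _ _) _; rewrite mulr_natl mulr2n; apply: lerD; last exact: D_le.
  apply: D_le; rewrite addrAC subrr add0r nrZ nrR gtr0_norm//.
  have := ler_piMr (ltW sp) h1; rewrite /s /s0; move: rho0; lra.
have D20 : D2 0 = 0.
  have := D2_linear 1 0 0; rewrite scaler0 addr0 scale1r => /eqP.
  by rewrite -subr_eq0 opprD addrA subrr add0r oppr_eq0 => /eqP.
have D2Z (c : R[i]) h : D2 (c *: h) = c *: D2 h.
  by have := D2_linear c h 0; rewrite !addr0 D20 addr0.
set K := 4 * C1 * (s0 / 2) + 2 * K1 / (s0 / 2) in unit_bound.
have [|A AE] := @bounded_op_of R V (bounded_op V W : normedModType R[i]) D2 K D2_linear.
  move=> h; have [->|h0] := eqVneq h 0; first by rewrite D20 !nr0 mulr0.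
  have nh : 0 < nr h by rewrite nr_gt0.
  rewrite -ler_pdivrMr// mulrC -[X in X * _]ger0_norm ?invr_ge0 ?nr_ge0//.
  rewrite -nrR -nrZ -D2Z; apply: unit_bound.
  by rewrite nrZ nrR ger0_norm ?invr_ge0 ?nr_ge0// mulVf// gt_eqF.
apply: (proj1 (@hasD_frechet R V (bounded_op V W : normedModType R[i]) D x A _)).
move=> e e0; rewrite AE.
have e1 : 0 < e / (4 * C1 + 1).
  by rewrite divr_gt0//; move: C10; lra.
exists (Order.min (s0 / 2) (e / (4 * C1 + 1))); first by rewrite lt_min e1 divr_gt0.
move=> h; rewrite le_min => /andP[hs he].
have [->|h0] := eqVneq h 0; first by rewrite addr0 subrr D20 subr0 !nr0 mulr0.
have nh : 0 < nr h by rewrite nr_gt0.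
(* With [h = t u] and [u] a unit vector, the step of the quotient is the length of [h], and the
   error becomes [4 C1 t^2]. *)
pose t := nr h; pose u := t^-1%:C *: h.
have tu : t%:C *: u = h by rewrite scalerA -rmorphM mulfV ?gt_eqF// scale1r.
have nu : nr u = 1 by rewrite nrZ nrR gtr0_norm ?invr_gt0// mulVf ?gt_eqF.
have nu2 : n1 u = 2 by rewrite /n1 nu.
have := @D2_near u t nh; rewrite nu2 => /(_ _)H.
have {}H : nr (t^-1%:C *: (D (x + t%:C *: u) - D x) - D2 u) <= C1 * t * 2 ^+ 2.
  by apply: H; move: hs; rewrite /t; lra.
have -> : D (x + h) - D x - D2 h =
    t%:C *: (t^-1%:C *: (D (x + t%:C *: u) - D x) - D2 u).
  by rewrite tu [RHS]scalerBr -D2Z tu scalerA -rmorphM mulfV ?gt_eqF// scale1r.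
rewrite nrZ nrR gtr0_norm// mulrC; apply: le_trans (ler_wpM2r (ltW nh) H) _.
rewrite ler_pM2r//; move: he; rewrite ler_pdivlMr; last by move: C10; lra.
by rewrite -/t; move: nh; rewrite -/t; nra.
Qed.

End FrechetTwice.

(** The local bound required above comes from differentiability at [x] itself. *)
Theorem frechet_differentiable (R : realType) (V W : normedModType R[i])
    (F : V -> W) (x : V) (rho : R) : nr_complete W -> 0 < rho ->
  (forall y, nr (y - x) < rho -> differentiable F y) ->
  differentiable (frechet F : V -> (bounded_op V W : normedModType R[i])) x.
Proof.
move=> cW rho0 Fd.
have dx : differentiable F x by apply: Fd; rewrite subrr nr0.
have [r r0 H] := differentiable_hasD dx ltr01.
pose s := Order.min r (Order.min rho 1).
have s0 : 0 < s by rewrite !lt_min r0 rho0 ltr01.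
apply: (@frechet_differentiable_bounded R V W cW F x s (nr (F x) + (1 + nr (frechet F x)))) => //.
  by move=> y; rewrite !lt_min => /and3P[_ yr _]; exact: Fd.
move=> y; rewrite !lt_min => /and3P[yr _ y1].
have := H (y - x) (ltW yr); rewrite [x + _]addrC subrK mul1r => Hy.
rewrite -[F y](subrK (F x)) addrC; apply: le_trans (nrD _ _) _; rewrite lerD2l.
rewrite -[F y - F x](subrK (frechet F x (y - x))); apply: le_trans (nrD _ _) _.
apply: lerD; first by apply: le_trans Hy (ltW y1).
by apply: le_trans (nr_op _ _) _; rewrite ler_piMr ?nr_ge0 ?ltW.
Qed.

(** * The first three coefficients of a Schur function *)

Section Differentiability.
Variable R : realType.
Implicit Types (f g : R[i] -> R[i]) (z : R[i]).

Definition cdif f z := exists d : R[i], vder (W := R[i]^o) f z d.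

Lemma vder_cdif f z (d : R[i]) : vder (W := R[i]^o) f z d -> cdif f z.
Proof. by exists d. Qed.

Lemma cdif_ccont f z : cdif f z -> ccont f z.
Proof. by move=> [d]; exact: vder_ccont. Qed.

Lemma cdif_cst c z : cdif (fun=> c) z.
Proof. exact: vder_cdif (@vder_cst R R[i]^o c z). Qed.

Lemma cdif_id z : cdif (fun z => z) z.
Proof. exact: vder_cdif (@vder_id R z). Qed.

Lemma cdifD f g z : cdif f z -> cdif g z -> cdif (fun z => f z + g z) z.
Proof. by move=> [a fa] [b gb]; exact: vder_cdif (vderD fa gb). Qed.

Lemma cdifN f z : cdif f z -> cdif (fun z => - f z) z.
Proof. by move=> [a fa]; exact: vder_cdif (vderN fa). Qed.

Lemma cdifM f g z : cdif f z -> cdif g z -> cdif (fun z => f z * g z) z.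
Proof. by move=> [a fa] [b gb]; exact: vder_cdif (vderM fa gb). Qed.

Lemma cdifV f z : cdif f z -> f z != 0 -> cdif (fun z => (f z)^-1) z.
Proof. by move=> [a fa] f0; exact: vder_cdif (vderV fa f0). Qed.

Lemma cdifX f n z : cdif f z -> cdif (fun z => f z ^+ n) z.
Proof.
move=> df; elim: n => [|n IH]; first exact: cdif_cst.
have := cdifM df IH; congr cdif; apply/funext => w; by rewrite exprS.
Qed.

Lemma cdif_comp f g z : cdif f z -> cdif g (f z) -> cdif (fun z => g (f z)) z.
Proof. by move=> [a fa] [b gb]; exact: vder_cdif (vder_comp fa gb). Qed.

Lemma cdif_near f g z (r : R) : 0 < r ->
  (forall h : R[i], nr h <= r -> f (z + h) = g (z + h)) -> cdif f z -> cdif g z.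
Proof. by move=> r0 fg [a fa]; exists a; exact: (@vder_near R R[i]^o f g z a r). Qed.

Lemma cdif_off0 f g z : z != 0 -> (forall w, w != 0 -> f w = g w) -> cdif f z -> cdif g z.
Proof.
move=> z0 fg; apply: (@cdif_near _ _ _ (nr z / 2)); first by rewrite divr_gt0// nr_gt0.
move=> h hz; apply: fg; rewrite -nr_gt0.
have := nr_tri z (- h) 0; rewrite !subr0 opprK nrN.
have : 0 < nr z by rewrite nr_gt0.
lra.
Qed.

Lemma circle_cont_cdif f : (forall z, nr z = 1 -> cdif f z) -> circle_cont f.
Proof. exact: circle_cont_vder. Qed.

Lemma avg_laurent (f : R[i] -> R[i]) c1 c2 : (forall z, cdif f z) ->
  avg (fun z => f z + c1 * z ^- 1 + c2 * z ^- 2) = f 0.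
Proof.
move=> df.
have ic n c : circle_cont (fun z : R[i] => c * z ^- n).
  apply: circle_cont_cdif => z /nr1_neq0 z0; apply: cdifM; first exact: cdif_cst.
  by apply: cdifV; [apply: cdifX; exact: cdif_id|rewrite expf_neq0].
have i0 n : (0 < n <= 2)%N -> forall c, avg (fun z : R[i] => c * z ^- n) = 0.
  move=> n2 c; rewrite avgZ ?avg_inv ?mulr0// => z z1.
  by have := ic n 1 z z1; congr ccont; apply/funext => w; rewrite mul1r.
have fc : circle_cont f by apply: circle_cont_cdif => z _; exact: df.
rewrite !avgD ?i0 ?addr0//; last first.
  apply: circle_cont_cdif => z z1; apply: cdifD; first exact: df.
  apply: cdifM; first exact: cdif_cst.
  apply: cdifV; [apply: cdifX; exact: cdif_id|rewrite expf_neq0//; exact: nr1_neq0].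
by apply: avg_mean => [z _ _|]; [exact: df|apply: cdif_ccont; exact: df].
Qed.

End Differentiability.

(* Matching on the syntax avoids costly failed unifications. *)
Ltac cdif_poly := lazymatch goal with
  | |- cdif (fun _ => ?c) _ => exact: cdif_cst
  | |- cdif (fun z => z) _ => exact: cdif_id
  | |- cdif (fun z => @?f z + @?g z) ?w => apply: (@cdifD _ f g w); cbv beta; cdif_poly
  | |- cdif (fun z => - @?f z) ?w => apply: (@cdifN _ f w); cbv beta; cdif_poly
  | |- cdif (fun z => @?f z * @?g z) ?w => apply: (@cdifM _ f g w); cbv beta; cdif_poly
  | |- cdif (fun z => @?f z ^+ ?n) ?w => apply: (@cdifX _ f n w); cbv beta; cdif_poly
  | |- _ => idtac
  end.

Section ThirdCoefficient.
Variable R : realType.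

(** Up to the factor [r], the form on the left is the coefficient of [z^2] in [phi (r z) u(z)^2],
    hence a mean over the unit circle, where [r |phi (r z)| <= 1]. It is bounded by the mean of
    [|u|^2], which is the right-hand side. Taking [r < 1] keeps the circle inside the domain. *)
Lemma schur_toeplitz (phi : R[i] -> R[i]) (b1 b2 : R[i]) (r : R) (u0 u1 u2 : R[i]) :
  (forall z, nr z < 1 -> cdif phi z) ->
  (forall z, nr z < 1 -> nr (z * phi z) <= 1) ->
  (forall e : R, 0 < e -> exists2 s : R, 0 < s & forall h : R[i], nr h <= s ->
     nr (phi h - phi 0 - b1 * h - b2 * h ^+ 2) <= e * nr h ^+ 2) ->
  0 < r < 1 ->
  nr (phi 0 * r%:C * (2 * u0 * u2 + u1 ^+ 2) + b1 * r%:C ^+ 2 * (2 * u0 * u1) +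
      b2 * r%:C ^+ 3 * u0 ^+ 2) <= nr u0 ^+ 2 + nr u1 ^+ 2 + nr u2 ^+ 2.
Proof.
move=> pd ple ptaylor /andP[r0 r1].
pose u z := u0 + u1 * z + u2 * z ^+ 2.
pose Psi z := phi (r%:C * z) * u z ^+ 2.
pose b0 := phi 0.
pose a0 := b0 * u0 ^+ 2.
pose a1 := b0 * (2 * u0 * u1) + b1 * r%:C * u0 ^+ 2.
pose A := b0 * (2 * u0 * u2 + u1 ^+ 2) + b1 * r%:C * (2 * u0 * u1) + b2 * r%:C ^+ 2 * u0 ^+ 2.
(* The expected coefficient [A] fills the removable singularity; its mean over the circle will be
   [A]. *)
pose G z := if z == 0 then A else (Psi z - (a0 + a1 * z)) * z ^- 2.
have rin z : nr z <= 1 -> nr (r%:C * z) < 1.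
  by move=> z1; apply: le_lt_trans r1; rewrite nrM nrR gtr0_norm// ger_pMr.
have Psid z : nr z <= 1 -> cdif Psi z.
  move=> z1; apply: cdifM; last by rewrite /u; cdif_poly.
  apply: (@cdif_comp _ (fun z => r%:C * z)); first by cdif_poly.
  exact/pd/rin.
have Gd z : z != 0 -> nr z <= 1 -> cdif G z.
  move=> z0 z1; apply: (@cdif_off0 _ (fun z => (Psi z - (a0 + a1 * z)) * z ^- 2)) => //.
    by move=> w w0; rewrite /G (negbTE w0).
  apply: cdifM; first by apply: cdifD; [exact: Psid|cdif_poly].
  by apply: cdifV; [cdif_poly|rewrite expf_neq0].
pose p h := phi h - b0 - b1 * h - b2 * h ^+ 2.
pose w1 := 2 * u0 * u1; pose w2 := 2 * u0 * u2 + u1 ^+ 2.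
pose w3 := 2 * u1 * u2; pose w4 := u2 ^+ 2; pose c := r%:C : R[i].
(* A polynomial vanishing at 0: what is left of [G - A] after the Taylor remainder [p] of [phi] has
   been split off. *)
pose Q z := z * (b0 * (w3 + w4 * z) + b1 * c * (w2 + w3 * z + w4 * z ^+ 2) +
   b2 * c ^+ 2 * (w1 + w2 * z + w3 * z ^+ 2 + w4 * z ^+ 3)).
have GE z : z != 0 -> G z - A = p (c * z) * z ^- 2 * u z ^+ 2 + Q z.
  move=> z0; rewrite /G (negbTE z0) /Psi /p /Q /A /a0 /a1 /u -/c /w1 /w2 /w3 /w4.
  by field.
have G0 : ccont G 0.
  move=> e e0; have e2 : 0 < e / 2 by lra.
  have uQ : cdif Q 0 by rewrite /Q; cdif_poly.
  have [s1 s10 H1] := cdif_ccont uQ e2.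
  have uc : cdif (fun z => u z ^+ 2) 0 by rewrite /u; cdif_poly.
  have [s2 s20 H2] := cdif_ccont uc ltr01.
  pose K := nr (u 0 ^+ 2) + 1.
  have K0 : 0 < K by rewrite ltr_wpDl// nr_ge0.
  have [s3 s30 H3] := ptaylor _ (divr_gt0 e2 K0).
  exists (Order.min s1 (Order.min s2 s3)); first by rewrite !lt_min s10 s20.
  move=> h; rewrite !le_min => /andP[/H1 h1 /andP[/H2 h2 h3]].
  rewrite add0r in h1 h2 *; rewrite {2}/G eqxx.
  have [->|h0] := eqVneq h 0; first by rewrite /G eqxx subrr nr0 ltW.
  rewrite GE//; apply: le_trans (nrD _ _) _.
  have Q0 : Q 0 = 0 by rewrite /Q mul0r.
  rewrite Q0 subr0 in h1.
  have uK : nr (u h ^+ 2) <= K.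
    rewrite -[u h ^+ 2](subrK (u 0 ^+ 2)); apply: le_trans (nrD _ _) _.
    by rewrite addrC lerD2l.
  have ch : nr (c * h) <= nr h.
    by rewrite nrM nrR gtr0_norm// ler_piMl ?nr_ge0// ltW.
  have nh : 0 < nr h by rewrite nr_gt0.
  have pK : nr (p (c * h) * h ^- 2) <= e / 2 / K.
    rewrite nrM nrV nrX ler_pdivrMr ?exprn_gt0//.
    apply: le_trans (H3 _ (le_trans ch h3)) _.
    rewrite ler_wpM2l ?ler_pXn2r ?nnegrE ?nr_ge0// ltW// divr_gt0//.
  rewrite [e]splitr; apply: lerD => //; rewrite nrM.
  apply: le_trans (ler_pM (nr_ge0 _) (nr_ge0 _) pK uK) _.
  by rewrite mulfVK// gt_eqF.
have GA : avg G = A by rewrite (avg_mean Gd G0) /G eqxx.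
have Gc : circle_cont G.
  by apply: circle_cont_cdif => z z1; apply: Gd; [exact: nr1_neq0|rewrite z1].
pose ub z := u0^* + u1^* * z^-1 + u2^* * z ^- 2.
pose p1 := u1 * u0^* + u2 * u1^*; pose p2 := u2 * u0^*.
pose q1 := u0 * u1^* + u1 * u2^*; pose q2 := u0 * u2^*.
pose n := nr u0 ^+ 2 + nr u1 ^+ 2 + nr u2 ^+ 2.
have uub z : nr z = 1 -> (nr (u z) ^+ 2)%:C = n%:C + p1 * z + p2 * z ^+ 2 + q1 * z ^- 1 + q2 * z ^- 2.
  move=> z1; have z0 := nr1_neq0 z1.
  have zc : z^* = z^-1.
    apply: (mulfI z0); rewrite mul_conj z1 expr1n mulfV//.
  have uc : (u z)^* = u0^* + u1^* * z^-1 + u2^* * z^-1 ^+ 2.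
    by rewrite /u !expr2 !(rmorphD, rmorphM)/= zc.
  rewrite -mul_conj uc /u /n !rmorphD/= -!mul_conj.
  rewrite /p1 /p2 /q1 /q2; field.
  exact: z0.
(* On the circle this is [|u|^2 - k Psi / z^2], arranged as functions with known means plus a
   principal part that averages to zero. *)
pose f k z := (n%:C + p1 * z + p2 * z ^+ 2 - k * G z) + (q1 - k * a1) * z ^- 1 + (q2 - k * a0) * z ^- 2.
have rAE : phi 0 * c * (2 * u0 * u2 + u1 ^+ 2) + b1 * c ^+ 2 * (2 * u0 * u1) +
      b2 * c ^+ 3 * u0 ^+ 2 = c * A by rewrite /A /b0 -/c; ring.
rewrite -/c rAE.
have [->|cA0] := eqVneq (c * A) 0.
  by rewrite nr0 !addr_ge0// sqr_ge0.
(* The phase makes [k A] equal to the modulus of [c A]. *)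
pose k := c * ((c * A)^* / (nr (c * A))%:C).
have nk : nr ((c * A)^* / (nr (c * A))%:C) = 1.
  move: (c * A) cA0 => w w0.
  by rewrite nrM nrV nr_conj nrR ger0_norm ?nr_ge0// divff// nr_eq0.
have fpos z : nr z = 1 -> 0 <= complex.Re (f k z).
  move=> z1; have z0 := nr1_neq0 z1.
  have -> : f k z = (nr (u z) ^+ 2)%:C - k * (Psi z * z ^- 2).
    by rewrite uub// /f /G (negbTE z0); field.
  rewrite Re_add Re_opp subr_ge0/=; apply: le_trans (ler_norm _) _.
  apply: le_trans (Re_le_nr _) _.
  have zr : nr (r%:C * z) < 1 by apply: rin; rewrite z1.
  have nkc : nr k = nr c by rewrite /k nrM nk mulr1.
  have H : nr c * nr (phi (r%:C * z)) <= 1.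
    by have := ple _ zr; rewrite !nrM z1 mulr1.
  rewrite nrM nkc [nr (Psi z * _)]nrM nrV nrX z1 expr1n invr1 mulr1.
  by rewrite /Psi nrM nrX mulrA -[leRHS]mul1r ler_wpM2r// exprn_ge0// nr_ge0.
have fc : circle_cont (f k).
  apply: circle_cont_cdif => z z1; have z0 := nr1_neq0 z1.
  have Gz : cdif G z by apply: Gd => //; rewrite z1.
  have Vz m : cdif (fun z => z ^- m) z by apply: cdifV; [cdif_poly|rewrite expf_neq0].
  apply: cdifD; [apply: cdifD|].
  - apply: cdifD; first by cdif_poly.
    by apply: cdifN; apply: cdifM => //; exact: cdif_cst.
  - by apply: cdifM => //; exact: cdif_cst.
  - by apply: cdifM => //; exact: cdif_cst.
have := avg_Re_ge0 fc fpos.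
have -> : avg (f k) = n%:C - k * A.
  pose g z := n%:C + p1 * z + p2 * z ^+ 2.
  transitivity (avg (fun z => (- k) * G z + (g z + (q1 - k * a1) * z ^- 1 + (q2 - k * a0) * z ^- 2))).
    by apply: avg_ext => z z1; rewrite /f /g; ring.
  have gd z : cdif g z by rewrite /g; cdif_poly.
  rewrite avgD; last 2 first.
  - move=> z z1; apply: cdif_ccont; apply: cdifM; first exact: cdif_cst.
    by apply: Gd; [exact: nr1_neq0|rewrite z1].
  - move=> z z1; have z0 := nr1_neq0 z1; apply: cdif_ccont.
    have Vz m : cdif (fun z => z ^- m) z by apply: cdifV; [cdif_poly|rewrite expf_neq0].
    by apply: cdifD; [apply: cdifD|]; first exact: gd; apply: cdifM => //; exact: cdif_cst.
  by rewrite avgZ// GA avg_laurent// /g; ring.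
have -> : k * A = (nr (c * A))%:C.
  rewrite /k; have -> : c * ((c * A)^* / (nr (c * A))%:C) * A = c * A * (c * A)^* / (nr (c * A))%:C by ring.
  rewrite mul_conj -fmorphV -rmorphM/= expr2 mulfK// nr_eq0//.
by rewrite Re_add Re_opp/= subr_ge0.
Qed.

End ThirdCoefficient.

(** * From Schur's inequality to the sharp coefficient bound *)

Section CoefficientBound.
Variable R : realType.

Lemma schur_third (c1 c2 c3 t : R[i]) (D : R) : nr c1 < 1 ->
  D = 1 - nr c1 ^+ 2 -> c2 = D%:C * t ->
  (forall u0 u1 u2 : R[i], nr (c1 * (2 * u0 * u2 + u1 ^+ 2) + c2 * (2 * u0 * u1) +
      c3 * u0 ^+ 2) <= nr u0 ^+ 2 + nr u1 ^+ 2 + nr u2 ^+ 2) ->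
  nr (c3 + D%:C * c1^* * t ^+ 2) <= D * (1 - nr t ^+ 2).
Proof.
move=> c11 DE0 c2E H.
set e := c3 + _.
have main (eps : R[i]) : nr eps = 1 -> complex.Re (e * eps^*) <= D * (1 - nr t ^+ 2).
  move=> eps1.
  have ee : eps * eps^* = 1 by rewrite mul_conj eps1 expr1n.
  (* With [u0 = 1], these [u1] and [u2] maximize the real part of [eps^*] times the form minus the
     sum of squares; the maximum is the expression in [E] below. *)
  have := H 1 (t^* * eps + c1^* * t) (c1^* * eps).
  set L := _ + _ + _; set N := _ + _ + _ => LN.
  have conjK (a : R[i]) : a^*^* = a by exact: conjcK.
  have DE : D%:C = 1 - c1 * c1^* by rewrite mul_conj -rmorphB -DE0.
  have NE : N%:C = 1 + (t^* * eps + c1^* * t) * (t * eps^* + c1 * t^*) + c1 * c1^*.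
    rewrite /N [nr (c1^* * eps)]nrM nr_conj eps1 mulr1 nr1 expr1n.
    by rewrite !rmorphD/= -!mul_conj !(rmorphD, rmorphM)/= !conjK.
  have E : L * eps^* - N%:C = e * eps^* - D%:C * (1 - t * t^*).
    rewrite NE /L /e c2E DE; ring: ee.
  have := congr1 (@complex.Re R) E; rewrite mul_conj -rmorphB -rmorphM !Re_add !Re_opp/= => E1.
  have : complex.Re (L * eps^*) <= N.
    apply: le_trans LN; apply: le_trans (ler_norm _) _; apply: le_trans (Re_le_nr _) _.
    by rewrite nrM nr_conj eps1 mulr1.
  lra.
have [e0|e0] := eqVneq e 0.
  by have := main 1 (nr1 _); rewrite e0 mul0r nr0.
have ne : nr e != 0 by rewrite nr_eq0.
have := main (e / (nr e)%:C).
rewrite nrM nrV nrR ger0_norm ?nr_ge0// divff// => /(_ erefl).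
have -> : (e / (nr e)%:C)^* = e^* / (nr e)%:C.
  have cr : ((nr e)%:C : R[i])^* = (nr e)%:C := conjc_real _.
  by rewrite rmorphM fmorphV/= cr.
by rewrite mulrA mul_conj -fmorphV -rmorphM/= expr2 mulfK.
Qed.

(** The maximum over [t] lies at [t = 1] when [2 (1 - c) <= mu c], which leaves the cubic in [c].
    Otherwise it is interior and gives [W c], increasing in [c]; at the threshold [d] the interior
    point reaches 1, so [W d] is again a value of the cubic. The cubic itself is controlled by the
    double root of [(x - s)^2 (x + 2 s)]. *)
Lemma coefficient_max (mu n s c t : R) : 2 <= mu -> 0 <= n -> n < 1 + mu -> 0 <= s ->
  3 * (1 + mu - n) * s ^+ 2 = 1 + mu -> 0 <= c <= 1 -> 0 <= t <= 1 ->
  (1 - c ^+ 2) * (1 - t ^+ 2 + c * t ^+ 2 + mu * c * t) + n * c ^+ 3 <=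
    2 / 3 * (1 + mu) * s.
Proof.
move=> mu2 n0 nmu s0 sE /andP[c0 c1] /andP[t0 t1].
have cubic x : 0 <= x -> (1 + mu) * x - (1 + mu - n) * x ^+ 3 <= 2 / 3 * (1 + mu) * s.
  move=> x0.
  have : 0 <= (1 + mu - n) * ((x - s) ^+ 2 * (x + 2 * s)).
    by apply: mulr_ge0; [lra|apply: mulr_ge0; [exact: sqr_ge0|lra]].
  have -> : (1 + mu - n) * ((x - s) ^+ 2 * (x + 2 * s)) =
    (1 + mu - n) * x ^+ 3 - (3 * (1 + mu - n) * s ^+ 2) * (x - 2 / 3 * s) by field.
  by rewrite sE; lra.
have [h|h] := leP (2 * (1 - c)) (mu * c).
  apply: le_trans (cubic c c0).
  have ft : 1 - t ^+ 2 + c * t ^+ 2 + mu * c * t <= c + mu * c.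
    have : 0 <= (1 - t) * (mu * c - (1 - c) * (1 + t)).
      by apply: mulr_ge0; [lra|nra].
    lra.
  have c2 : 0 <= 1 - c ^+ 2 by rewrite subr_ge0 expr_le1.
  apply: le_trans (lerD (ler_wpM2l c2 ft) (lexx _)) _.
  by rewrite le_eqVlt; apply/orP; left; apply/eqP; ring.
pose d := 2 / (2 + mu).
have d0 : 0 <= d by rewrite divr_ge0//; lra.
have mud : mu * d = 2 - 2 * d by rewrite /d; field; lra.
have cd : c <= d by rewrite /d ler_pdivlMr; lra.
pose W x := 1 + (mu ^+ 2 / 4 - 1) * x ^+ 2 + (mu ^+ 2 / 4 + n) * x ^+ 3.
have mu4 : 1 <= mu ^+ 2 / 4 by nra.
apply: le_trans (cubic d d0); apply: (@le_trans _ _ (W c)).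
  have : 0 <= (1 + c) * ((1 - c) * t - mu * c / 2) ^+ 2.
    by apply: mulr_ge0; [lra|exact: sqr_ge0].
  by rewrite /W; lra.
apply: (@le_trans _ _ (W d)).
  rewrite /W; apply: lerD; first apply: lerD => //.
    by rewrite ler_wpM2l ?ler_pXn2r ?nnegrE//; lra.
  by rewrite ler_wpM2l ?ler_pXn2r ?nnegrE//; lra.
have -> : (1 + mu) * d - (1 + mu - n) * d ^+ 3 = (d + mu * d) * (1 - d ^+ 2) + n * d ^+ 3 by ring.
have -> : W d = 1 - d ^+ 2 + (mu * d) ^+ 2 / 4 * (1 + d) + n * d ^+ 3 by rewrite /W; field.
by rewrite mud; lra.
Qed.

Lemma third_coefficient_le (c1 c2 c3 : R[i]) (mu n s : R) : 2 <= mu -> 0 <= n ->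
  n < 1 + mu -> 0 <= s -> 3 * (1 + mu - n) * s ^+ 2 = 1 + mu -> nr c1 < 1 ->
  (forall u0 u1 u2 : R[i], nr (c1 * (2 * u0 * u2 + u1 ^+ 2) + c2 * (2 * u0 * u1) +
      c3 * u0 ^+ 2) <= nr u0 ^+ 2 + nr u1 ^+ 2 + nr u2 ^+ 2) ->
  nr (c3 + mu%:C * c1 * c2 - n%:C * c1 ^+ 3) <= 2 / 3 * (1 + mu) * s.
Proof.
move=> mu2 n0 nmu s0 sE c11 H.
pose D := 1 - nr c1 ^+ 2; pose t := c2 / D%:C.
have D0 : 0 < D by rewrite subr_gt0 expr_lt1// nr_ge0.
have DC : D%:C != 0 :> R[i] by rewrite -nr_gt0 nrR normr_gt0 gt_eqF.
have c2E : c2 = D%:C * t by rewrite mulrC mulfVK.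
have e_le := schur_third c11 erefl c2E H; rewrite -/D in e_le.
(* The right-hand side of Schur's inequality bounds a norm, so it cannot be negative. *)
have t1 : nr t <= 1.
  have : 0 <= D * (1 - nr t ^+ 2) by apply: le_trans (nr_ge0 _) e_le.
  by rewrite pmulr_rge0// subr_ge0 expr_le1// nr_ge0.
have c01 : 0 <= nr c1 <= 1 by rewrite nr_ge0 ltW.
have t01 : 0 <= nr t <= 1 by rewrite nr_ge0.
apply: le_trans (coefficient_max mu2 n0 nmu s0 sE c01 t01).
have -> : c3 + mu%:C * c1 * c2 - n%:C * c1 ^+ 3 =
  (c3 + D%:C * c1^* * t ^+ 2) - D%:C * c1^* * t ^+ 2 + mu%:C * c1 * D%:C * t - n%:C * c1 ^+ 3.
  by rewrite c2E; ring.
apply: le_trans (nrB _ _) _; apply: le_trans (lerD (nrD _ _) (lexx _)) _.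
apply: le_trans (lerD (lerD (nrB _ _) (lexx _)) (lexx _)) _.
rewrite [nr (D%:C * _ * _)]nrM [nr (D%:C * _)]nrM [nr (n%:C * _)]nrM [nr (mu%:C * _ * _ * _)]nrM.
rewrite [nr (mu%:C * _ * _)]nrM [nr (mu%:C * _)]nrM nr_conj !nrX !nrR.
rewrite (gtr0_norm D0) (ger0_norm n0) (ger0_norm (_ : 0 <= mu)); last lra.
move: e_le; rewrite -/D; set E := nr (c3 + _) => e_le.
apply: le_trans (lerD (lerD (lerD e_le (lexx _)) (lexx _)) (lexx _)) _.
by rewrite le_eqVlt; apply/orP; left; apply/eqP; ring.
Qed.

End CoefficientBound.

(** * The upper bound *)

Section Slices.
Variables (R : realType) (X : completeNormedModType R[i]).

Lemma bounded_mlin_complete n (W : normedModType R[i]) :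
  nr_complete W -> nr_complete (bounded_mlin X n W).
Proof. by move=> cW; elim: n => //= n IH; exact: bounded_op_complete. Qed.

Lemma unit_ballE (x : X) : unit_ball x <-> nr x < 1.
Proof. by rewrite /unit_ball/= -(nr_lt x 1). Qed.

Lemma frechetn_holomorphic n (F : X -> X) : holomorphic F ->
  holomorphic (frechetn n F : X -> bounded_mlin X n X).
Proof.
move=> hF; elim: n => [//|n IH] x /unit_ballE xb /=.
have r0 : 0 < 1 - nr x by rewrite subr_gt0.
apply: (@frechet_differentiable R X (bounded_mlin X n X) _ x (1 - nr x)) => //.
  apply: bounded_mlin_complete; exact: completeNormedModType_nr.
move=> y yx; apply: IH; apply/unit_ballE.
by have := nrD (y - x) x; rewrite subrK; lra.
Qed.

Lemma vder_eval (V W : normedModType R[i]) (A : R[i] -> (bounded_op V W : normedModType R[i]))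
    z (d : bounded_op V W) (x : V) :
  vder A z d -> vder (fun z => A z x) z (d x).
Proof.
move=> Ad e e0; have n0 : 0 < nr x + 1 by rewrite ltr_wpDl// nr_ge0.
have [r r0 H] := Ad _ (divr_gt0 e0 n0); exists r => // h /H {}H.
have -> : A (z + h) x - A z x - h *: d x = (A (z + h) - A z - h *: d) x by [].
apply: le_trans (nr_op _ _) _; apply: le_trans (ler_wpM2r (nr_ge0 x) H) _.
apply: le_trans (ler_shrink e0 (nr_ge0 x) (nr_ge0 h)).
by rewrite mulrA.
Qed.

Lemma vder_mlin_diag n (W : normedModType R[i]) (A : R[i] -> bounded_mlin X n W)
    z (d : bounded_mlin X n W) (x : X) :
  vder A z d -> vder (fun z => mlin_diag (A z) x) z (mlin_diag d x).
Proof.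
elim: n A d => [|n IH] A d Ad //=.
by apply: IH; exact: (vder_eval x Ad).
Qed.

Lemma slice_vder n (F : X -> X) (x : X) z : holomorphic F -> nr (z *: x) < 1 ->
  vder (fun z => mlin_diag (frechetn n F (z *: x)) x) z
    (mlin_diag (frechetn n.+1 F (z *: x)) x).
Proof.
move=> hF zx; apply: (@vder_mlin_diag n X (fun z => frechetn n F (z *: x))
  z (frechet (frechetn n F) (z *: x) x)).
have := @frechet_vder R X (bounded_mlin X n X) (frechetn n F) 0 x z.
rewrite add0r => /(_ _)H; have {}H := H (@frechetn_holomorphic n F hF _ (iffRL (unit_ballE _) zx)).
by move: H; congr vder; apply/funext => w; rewrite add0r.
Qed.

End Slices.

(** * Taylor coefficients of the function phi *)

Section Expansion.
Variable R : realType.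

(** Taylor's formula with Peano remainder: the mean value inequality is applied to [phi] minus its
    linear and quadratic terms, so the second derivative is needed at 0 only. *)
Lemma taylor_young (phi phi1 : R[i] -> R[i]) (d2 : R[i]) (rho : R) : 0 < rho ->
  (forall z, nr z < rho -> vder (W := R[i]^o) phi z (phi1 z)) ->
  vder (W := R[i]^o) phi1 0 d2 ->
  forall e : R, 0 < e -> exists2 s : R, 0 < s & forall h : R[i], nr h <= s ->
     nr (phi h - phi 0 - phi1 0 * h - d2 / 2 * h ^+ 2) <= e * nr h ^+ 2.
Proof.
move=> rho0 d1 dd2 e e0; have [r r0 H] := dd2 _ e0.
exists (Order.min r (rho / 2)); first by rewrite lt_min r0 divr_gt0.
move=> h; rewrite le_min => /andP[hr hrho].
have seg (t : R) : 0 <= t <= 1 -> nr (t%:C * h) <= nr h.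
  by move=> /andP[t0 t1]; rewrite nrM nrR ger0_norm// ler_piMl ?nr_ge0.
have := @mean_value_segment R R[i]^o
  (fun w => phi w - phi1 0 * w - d2 / 2 * w ^+ 2)
  (fun w => phi1 w - phi1 0 - d2 * w) 0 h (e * nr h).
rewrite !subr0 -[e * nr h * nr h]mulrA -expr2 => H1.
rewrite (_ : phi h - phi 0 - _ - _ = phi h - phi1 0 * h - d2 / 2 * h ^+ 2 -
  (phi 0 - phi1 0 * 0 - d2 / 2 * 0 ^+ 2)); last by ring.
apply: H1 => t t01; rewrite add0r; set w := t%:C * h.
  have wr : nr w < rho by have := seg t t01; rewrite -/w; lra.
  have e1 := vderM (@vder_cst R R[i]^o (phi1 0) w) (@vder_id R w).
  have e2 := vderM (@vder_cst R R[i]^o (d2 / 2) w) (vderM (@vder_id R w) (@vder_id R w)).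
  have := vderB (vderB (d1 w wr) e1) e2.
  move=> HD; apply: (vder_eq HD).
  by rewrite -[LHS]/(phi1 w - (0 * w + phi1 0 * 1) - (0 * (w * w) + d2 / 2 * (1 * w + w * 1))); field.
have := H w (le_trans (seg t t01) hr); rewrite add0r.
rewrite -[w *: d2]/(w * d2) [w * d2]mulrC => H2; apply: le_trans H2 _.
by rewrite ler_wpM2l ?(ltW e0)// seg.
Qed.

(** The denominator equals [m] at 0 and has no zero, so the quotient rule applies twice; the
    identity is then rational in [m] and the derivatives of [f] at 0. *)
Lemma phi_expansion (f : nat -> R[i] -> R[i]) (m : R[i]) (rho : R) : 0 < rho ->
  (forall n z, nr z < rho -> vder (W := R[i]^o) (f n) z (f n.+1 z)) ->
  (forall z, nr z < rho -> z * f 2%N z + m * f 1%N z != 0) -> f 1%N 0 = 1 ->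
  let phi z := f 2%N z / (z * f 2%N z + m * f 1%N z) in
  (forall z, nr z < rho -> cdif phi z) /\ exists b1 b2,
  (forall e : R, 0 < e -> exists2 s : R, 0 < s & forall h : R[i], nr h <= s ->
     nr (phi h - phi 0 - b1 * h - b2 * h ^+ 2) <= e * nr h ^+ 2) /\
  f 2%N 0 / 2 * (f 3%N 0 / 6) - f 4%N 0 / 24 =
    - (m / 12) * (b2 + (2 + m / 2) * phi 0 * b1 - (1 + m) * (m - 2) / 2 * phi 0 ^+ 3).
Proof.
move=> rho0 fd den0 f10 phi.
pose den z := z * f 2%N z + m * f 1%N z.
pose den1 z := (1 + m) * f 2%N z + z * f 3%N z.
pose den2 z := (2 + m) * f 3%N z + z * f 4%N z.
have dden z : nr z < rho -> vder (W := R[i]^o) den z (den1 z).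
  move=> zr; have H := vderD (vderM (@vder_id R z) (fd 2%N z zr))
    (vderM (@vder_cst R R[i]^o m z) (fd 1%N z zr)).
  apply: (vder_eq H); rewrite -[LHS]/((1 * f 2%N z + z * f 3%N z) + (0 * f 1%N z + m * f 2%N z)).
  by rewrite /den1; ring.
have dden1 z : nr z < rho -> vder (W := R[i]^o) den1 z (den2 z).
  move=> zr; have H := vderD (vderM (@vder_cst R R[i]^o (1 + m) z) (fd 2%N z zr))
    (vderM (@vder_id R z) (fd 3%N z zr)).
  apply: (vder_eq H); rewrite -[LHS]/((0 * f 2%N z + (1 + m) * f 3%N z) + (1 * f 3%N z + z * f 4%N z)).
  by rewrite /den2; ring.
pose phi1 z := (f 3%N z - phi z * den1 z) / den z.
have dphi z : nr z < rho -> vder (W := R[i]^o) phi z (phi1 z).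
  move=> zr; have d0 := den0 z zr; have H := vderM (fd 2%N z zr) (vderV (dden z zr) d0).
  apply: (vder_eq H).
  rewrite -[LHS]/(f 3%N z * (den z)^-1 + f 2%N z * - (den1 z / den z ^+ 2)).
  rewrite /phi1 /phi -/(den z); have : den z != 0 by [].
  by move: (den z) (den1 z) => a b a0; field.
have z0 : nr (0 : R[i]) < rho by rewrite nr0.
pose d2 := (f 4%N 0 - (phi1 0 * den1 0 + phi 0 * den2 0)) / den 0 -
  (f 3%N 0 - phi 0 * den1 0) * den1 0 / den 0 ^+ 2.
have dphi1 : vder (W := R[i]^o) phi1 0 d2.
  have H := vderM (vderB (fd 3%N 0 z0) (vderM (dphi 0 z0) (dden1 0 z0)))
    (vderV (dden 0 z0) (den0 0 z0)).
  apply: (vder_eq H).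
  rewrite -[LHS]/((f 4%N 0 - (phi1 0 * den1 0 + phi 0 * den2 0)) * (den 0)^-1 +
    (f 3%N 0 - phi 0 * den1 0) * - (den1 0 / den 0 ^+ 2)).
  by rewrite /d2; ring.
split; first by move=> z zr; exists (phi1 z); exact: dphi.
exists (phi1 0), (d2 / 2); split; first exact: (taylor_young rho0 dphi dphi1).
have m0 : m != 0 by have := den0 0 z0; rewrite f10 mul0r add0r mulr1.
rewrite /d2 /phi1 /den2 /den1 /phi /den f10 !mul0r !add0r !addr0 mulr1.
move: (f 2%N 0) (f 3%N 0) (f 4%N 0) => a b c.
by field.
Qed.

End Expansion.

(** * The estimate for one complex variable *)

Section UpperBound.
Variable R : realType.

Definition jbound (lambda : R) : R :=
  (1 + 2 * lambda) * (7 + 2 * lambda) `^ (3 / 2) /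
      (36 * Num.sqrt (3 * (9 - 4 * lambda ^+ 2))).

(** The stated bound is [m / 12] times the maximum of the cubic, with [s] its critical point; the
    power 3/2 is only [s] in closed form. *)
Lemma jbound_sqrt (lambda s : R) : 1 / 2 <= lambda <= 1 -> 0 <= s ->
  3 * (9 - 4 * lambda ^+ 2) * s ^+ 2 = 7 + 2 * lambda ->
  jbound lambda = (1 + 2 * lambda) / 12 * (2 / 3 * (1 + (2 + (1 + 2 * lambda) / 2)) * s).
Proof.
move=> /andP[l1 l2] s0 sE; rewrite /jbound.
have a0 : 0 < 7 + 2 * lambda by lra.
have Q0 : 0 < 3 * (9 - 4 * lambda ^+ 2) by nra.
have -> : (7 + 2 * lambda) `^ (3 / 2) = (7 + 2 * lambda) * Num.sqrt (7 + 2 * lambda).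
  rewrite (_ : 3 / 2 = 1 + 2^-1); last by field.
  by rewrite powRD ?powRr1 ?(ltW a0)// ?powR12_sqrt ?(ltW a0)// (gt_eqF a0) implybT.
have q0 : 0 < Num.sqrt (3 * (9 - 4 * lambda ^+ 2)) by rewrite sqrtr_gt0.
rewrite -[in Num.sqrt (7 + _)]sE sqrtrM ?(ltW Q0)// sqrtr_sqr ger0_norm//.
by field; rewrite gt_eqF.
Qed.

Lemma scalar_upper (f : nat -> R[i] -> R[i]) (lambda : R) : 1 / 2 <= lambda <= 1 ->
  (forall n z, nr z < 1 -> vder (W := R[i]^o) (f n) z (f n.+1 z)) -> f 1%N 0 = 1 ->
  (forall z, z != 0 -> nr z < 1 -> f 1%N z != 0 /\
    1 / 2 - lambda <= complex.Re (1 + z * f 2%N z / f 1%N z)) ->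
  nr (f 2%N 0 / 2 * (f 3%N 0 / 6) - f 4%N 0 / 24) <= jbound lambda.
Proof.
move=> lb fd f10 fre; have /andP[l1 l2] := lb.
pose m : R := 1 + 2 * lambda.
have m0 : 0 < m by rewrite /m; lra.
(* A half plane as a comparison of distances: [Re p >= - m / 2] exactly when [p] is no farther from
   0 than from [- m]. *)
have key z : nr z < 1 -> z * f 2%N z + m%:C * f 1%N z != 0 /\
    nr (z * f 2%N z) <= nr (z * f 2%N z + m%:C * f 1%N z).
  move=> z1; have [->|z0] := eqVneq z 0.
    rewrite !mul0r add0r f10 mulr1 nr0 nr_ge0; split=> //.
    by rewrite -nr_gt0 nrR normr_gt0 gt_eqF.
  have [f1 re] := fre z z0 z1; set p := z * f 2%N z / f 1%N z in re.
  have pE : z * f 2%N z = p * f 1%N z by rewrite /p mulfVK.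
  have {}re : - (m / 2) <= complex.Re p by move: re; rewrite Re_add/= /m; lra.
  rewrite pE -mulrDl mulf_eq0 negb_or f1 andbT (nrM p) (nrM (p + _)); split.
    rewrite -nr_gt0; apply: lt_le_trans (Re_le_nr _).
    by rewrite normr_gt0 Re_add/=; apply/eqP => h; lra.
  apply: ler_wpM2r; first exact: nr_ge0.
  rewrite -(ler_pXn2r (n := 2)) ?nnegrE ?nr_ge0// !nrS Re_add Im_add/= addr0.
  by nra.
have den0 z : nr z < 1 -> z * f 2%N z + m%:C * f 1%N z != 0 by move=> /key[].
have [pd [b1 [b2 [pexp JE]]]] := @phi_expansion R f m%:C 1 ltr01 fd den0 f10.
set phi := fun z => f 2%N z / _ in pd pexp JE.
have ple z : nr z < 1 -> nr (z * phi z) <= 1.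
  move=> z1; have [d0 dle] := key z z1; rewrite /phi mulrA nrM nrV.
  by rewrite ler_pdivrMr ?nr_gt0// mul1r.
have toep (r : R) : 0 < r < 1 -> forall u0 u1 u2 : R[i],
  nr (phi 0 * r%:C * (2 * u0 * u2 + u1 ^+ 2) + b1 * r%:C ^+ 2 * (2 * u0 * u1) +
      b2 * r%:C ^+ 3 * u0 ^+ 2) <= nr u0 ^+ 2 + nr u1 ^+ 2 + nr u2 ^+ 2.
  by move=> r01 u0 u1 u2; exact: (@schur_toeplitz R phi b1 b2 r u0 u1 u2 pd ple pexp r01).
pose mu := 2 + m / 2; pose n := (1 + m) * (m - 2) / 2.
have Q0 : 0 < 3 * (9 - 4 * lambda ^+ 2) by nra.
pose s := Num.sqrt ((7 + 2 * lambda) / (3 * (9 - 4 * lambda ^+ 2))).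
have s0 : 0 <= s by exact: sqrtr_ge0.
have sE : 3 * (9 - 4 * lambda ^+ 2) * s ^+ 2 = 7 + 2 * lambda.
  by rewrite sqr_sqrtr; [rewrite mulrC mulfVK// gt_eqF|rewrite divr_ge0 ?(ltW Q0)//; lra].
(* At radius [r] the coefficients pick up the factors [r], [r^2], [r^3], and each monomial of the
   functional has total weight 3. *)
have bnd (r : R) : 0 < r < 1 ->
  r ^+ 3 * nr (b2 + mu%:C * phi 0 * b1 - n%:C * phi 0 ^+ 3) <= 2 / 3 * (1 + mu) * s.
  move=> r01; have /andP[r0 r1] := r01.
  (* The test vector [(0, 1, 0)] at the larger radius [(1 + r) / 2] makes the inequality strict. *)
  have c11 : nr (phi 0 * r%:C) < 1.
    have r' : 0 < (1 + r) / 2 < 1 by apply/andP; split; lra.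
    have := toep _ r' 0 1 0; rewrite !nr0 nr1 !(expr0n, expr1n)/= !(mulr0, mul0r, addr0, add0r) mulr1.
    rewrite !nrM !nrR !gtr0_norm//; last lra.
    by have := nr_ge0 (phi 0); nra.
  have := @third_coefficient_le R (phi 0 * r%:C) (b1 * r%:C ^+ 2) (b2 * r%:C ^+ 3) mu n s.
  move=> /(_ _ _ _ s0 _ c11 (toep r r01))H.
  have rE : b2 * r%:C ^+ 3 + mu%:C * (phi 0 * r%:C) * (b1 * r%:C ^+ 2) - n%:C * (phi 0 * r%:C) ^+ 3
     = r%:C ^+ 3 * (b2 + mu%:C * phi 0 * b1 - n%:C * phi 0 ^+ 3) by ring.
  rewrite -[r in r ^+ 3](ger0_norm (ltW r0)) -nrR -nrX -nrM -rE.
  apply: H; rewrite /mu /n /m.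
  - lra.
  - by apply: divr_ge0 => //; apply: mulr_ge0; lra.
  - nra.
  - rewrite [LHS](_ : _ = 3 * (9 - 4 * lambda ^+ 2) * s ^+ 2 / 2); last by field.
    by rewrite sE; field.
have bnd1 : nr (b2 + mu%:C * phi 0 * b1 - n%:C * phi 0 ^+ 3) <= 2 / 3 * (1 + mu) * s.
  set N := nr _ in bnd *; set C := 2 / 3 * _ * _ in bnd *.
  have N0 : 0 <= N by exact: nr_ge0.
  apply/ler_addgt0Pl => e e0.
  (* Letting [r] tend to 1: [1 - r^3 <= 3 (1 - r)] makes the loss at most [e]. *)
  pose r := 1 - Order.min (1 / 2) (e / (3 * (N + 1))).
  have N3 : 0 < 3 * (N + 1) by lra.
  have e1 : 0 < e / (3 * (N + 1)) by rewrite divr_gt0.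
  have d0 : 0 < 1 - r.
    by rewrite opprB addrCA subrr addr0 lt_min e1 andbT; lra.
  have d1 : 1 - r <= 1 / 2 by rewrite opprB addrCA subrr addr0 ge_min lexx.
  have d2 : 1 - r <= e / (3 * (N + 1)) by rewrite opprB addrCA subrr addr0 ge_min lexx orbT.
  have := bnd r ltac:(lra).
  move: d2; rewrite ler_pdivlMr// => d2 H.
  have r3 : 1 - r ^+ 3 <= 3 * (1 - r).
    have : 0 <= (1 - r) ^+ 2 * (r + 2) by rewrite mulr_ge0 ?sqr_ge0//; lra.
    lra.
  have := ler_wpM2r N0 r3; lra.
rewrite JE (jbound_sqrt lb s0 sE) -/m -/mu.
have -> : - (m%:C / 12) * (b2 + (2 + m%:C / 2) * phi 0 * b1 - (1 + m%:C) * (m%:C - 2) / 2 * phi 0 ^+ 3)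
  = - (m / 12)%:C * (b2 + mu%:C * phi 0 * b1 - n%:C * phi 0 ^+ 3).
  rewrite /mu /n !(rmorphD, rmorphM, rmorphB)/= !fmorphV/= !rmorph_nat !rmorph1.
  by ring.
rewrite nrM nrN nrR gtr0_norm ?divr_gt0// ler_pM2l ?divr_gt0//.
Qed.

End UpperBound.

(** * Reduction of the Banach space case to a slice *)

Section BanachUpperBound.
Variables (R : realType) (X : completeNormedModType R[i]).

(** The class condition evaluates the inverse derivative at multiples of [x] only, and for the maps
    considered [x] is an eigenvector. *)
Lemma op_inv_eigen (A : bounded_op X X) (x : X) (a : R[i]) :
  op_inverses A !=set0 -> x != 0 -> A x = a *: x -> a != 0 /\ op_inv A x = a^-1 *: x.
Proof.
move=> [B AB] x0 Ax; rewrite (op_inv_unique AB).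
have BA : x = a *: B x by rewrite -opZ -Ax AB.1.
have a0 : a != 0 by apply: contraNneq x0 => a0; rewrite BA a0 scale0r.
by split=> //; rewrite [in RHS]BA scalerA mulVf// scale1r.
Qed.

Lemma support_rotate (x0 : X) (T : bounded_op X R[i]^o) (z : R[i]) :
  `|x0| = 1 -> support_functionals x0 T -> z != 0 ->
  support_functionals (z *: x0) ((`|z| / z) *: T : bounded_op X R[i]^o).
Proof.
move=> x1 [Tx T1] z0; split; last by rewrite normrZ T1 mulr1 normrM normfV normr_id divff// normr_eq0.
rewrite normrZ x1 mulr1 -[LHS]/(`|z| / z * T (z *: x0)) opZ Tx x1.
by rewrite -[z *: 1]/(z * 1) mulr1 mulfVK.
Qed.

(** As [F] maps the line of [x0] into itself, every derivative along that line is a multiple of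
    [x0], recovered by [T]. The rotated functional turns the condition at [z *: x0] into the scalar
    one. *)
Lemma F_class_slice (lambda : R) (g : X -> R[i]^o) (F : X -> X) (x0 : X)
    (T : bounded_op X R[i]^o) :
  (forall x, unit_ball x -> F x = g x *: x) -> F_class lambda F ->
  `|x0| = 1 -> support_functionals x0 T ->
  let f n z := T (mlin_diag (frechetn n F (z *: x0)) x0) : R[i] in
  [/\ forall n z, nr z < 1 -> vder (W := R[i]^o) (f n) z (f n.+1 z), f 1%N 0 = 1 &
  forall z, z != 0 -> nr z < 1 -> f 1%N z != 0 /\
    1 / 2 - lambda <= complex.Re (1 + z * f 2%N z / f 1%N z)].
Proof.
move=> Fg [hF [F0 F1] Fb Fre] x1 sT f; have [Tx T1] := sT.
have nx0 : nr x0 = 1 by rewrite /nr x1.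
have x0n : x0 != 0 by rewrite -nr_gt0 nx0 ltr01.
have zb z : nr z < 1 -> nr (z *: x0) < 1 by move=> z1; rewrite nrZ nx0 mulr1.
pose psi n z := mlin_diag (frechetn n F (z *: x0)) x0 : X.
have dpsi n z : nr z < 1 -> vder (psi n) z (psi n.+1 z).
  by move=> /zb; exact: slice_vder.
have df n z : nr z < 1 -> vder (W := R[i]^o) (f n) z (f n.+1 z).
  by move=> z1; apply: vder_op; exact: dpsi.
have psiE n z : nr z < 1 -> psi n z = f n z *: x0.
  elim: n z => [|n IH] z z1.
    rewrite /f /psi/= (Fg _ (iffRL (unit_ballE _) (zb z z1))) !opZ Tx x1.
    by rewrite -[z *: 1]/(z * 1) -[g _ *: (z * 1 : R[i]^o)]/(g _ * (z * 1)) mulr1 scalerA.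
  apply: (@vder_unique R X (psi n) z); first exact: dpsi.
  have r0 : 0 < (1 - nr z) / 2 by lra.
  have := vderZ (df n z z1) (@vder_cst R X x0 z); rewrite scaler0 addr0.
  apply: (@vder_near R X _ _ _ _ ((1 - nr z) / 2)) => // h hr.
  by rewrite -IH//; have := nrD z h; lra.
have f1E z : nr z < 1 -> frechet F (z *: x0) x0 = f 1%N z *: x0.
  exact: (psiE 1%N).
have f2E z : nr z < 1 -> mlin_diag (frechetn 2 F (z *: x0)) x0 = f 2%N z *: x0.
  exact: (psiE 2%N).
split=> //.
  have := F1 x0; rewrite -(scale0r x0) f1E ?nr0// => /(congr1 T).
  by rewrite opZ Tx x1 => <-; rewrite -[LHS]mulr1.
move=> z z0 z1.
have [f10 oi] := op_inv_eigen (Fb _ (iffRL (unit_ballE _) (zb z z1))) x0n (f1E z z1).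
split=> //.
have zx0 : z *: x0 != 0 by rewrite scaler_eq0 negb_or z0.
have := Fre _ _ (iffRL (unit_ballE _) (zb z z1)) zx0 (support_rotate x1 sT z0).
have -> : mlin_diag (frechetn 2 F (z *: x0)) (z *: x0) = (z ^+ 2 * f 2%N z) *: x0.
  transitivity (z ^+ 2 *: mlin_diag (frechetn 2 F (z *: x0)) x0); last by rewrite f2E// scalerA.
  rewrite -[LHS]/(frechet (frechetn 1 F) (z *: x0) (z *: x0) (z *: x0)).
  by rewrite !opZ expr2 -scalerA.
rewrite [frechet F _ _]opZ f1E// scalerA -scalerDl !opZ oi normrZ x1 mulr1.
rewrite -[X in complex.Re X]/(`|z|^-1 * ((z ^+ 2 * f 2%N z + z * f 1%N z) *
  (`|z| / z * T ((f 1%N z)^-1 *: x0)))).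
have -> : T ((f 1%N z)^-1 *: x0) = (f 1%N z)^-1.
  by rewrite opZ Tx x1; exact: mulr1.
have nz : `|z| != 0 by rewrite normr_eq0.
rewrite [X in _ <= complex.Re X -> _](_ : _ = 1 + z * f 2%N z / f 1%N z)//.
move: (f 1%N z) (f 2%N z) f10 => a b a0.
by field; rewrite a0 z0 nz.
Qed.

Lemma J23_slice (F : X -> X) (x0 : X) (T : bounded_op X R[i]^o) :
  let f n z := T (mlin_diag (frechetn n F (z *: x0)) x0) : R[i] in
  J23 F x0 T = f 2%N 0 / 2 * (f 3%N 0 / 6) - f 4%N 0 / 24.
Proof.
move=> f; rewrite /J23 /A_coef /f scale0r.
by rewrite -[2`!]/2%N -[3`!]/6%N -[4`!]/24%N; ring.
Qed.

Lemma J23_upper (lambda : R) (g : X -> R[i]^o) (F : X -> X) (x0 : X)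
    (T : bounded_op X R[i]^o) : 1 / 2 <= lambda <= 1 ->
  (forall x, unit_ball x -> F x = g x *: x) -> F_class lambda F ->
  `|x0| = 1 -> support_functionals x0 T -> `|J23 F x0 T| <= (jbound lambda)%:C.
Proof.
move=> lb Fg FF x1 sT; rewrite nr_le J23_slice.
have [df f10 fre] := F_class_slice Fg FF x1 sT.
exact: (scalar_upper lb df f10 fre).
Qed.

End BanachUpperBound.

(** * The extremal map *)

Section RadialPrimitive.
Variable R : realType.

Lemma cint_FTC (f V : R -> R[i]) (a b : R) : a <= b -> rcont f ->
  (forall t, a <= t <= b -> rder (W := R[i]^o) V t (f t)) -> cint f a b = V b - V a.
Proof.
move=> ab /cint_ex[U [Uf ->]] Vf.
have := @mean_value_le R R[i]^o (fun t => U t + (-1 : R[i]) *: (V t : R[i]^o)) (fun=> 0) a b 0 ab.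
rewrite mul0r => /(_ _ _)H.
have {}H : nr (U b + (-1 : R[i]) *: (V b : R[i]^o) - (U a + (-1 : R[i]) *: (V a : R[i]^o)) : R[i]^o) <= 0.
  apply: H => [t tab|t _]; last by rewrite nr0.
  by have := rderD (Uf t) (rderZ (-1) (Vf t tab)); rewrite scaleN1r subrr.
apply/eqP; rewrite -subr_eq0 -nr_eq0 eq_le nr_ge0 andbT.
rewrite (_ : _ - _ = U b + (-1) * V b - (U a + (-1) * V a)) //; ring.
Qed.

(** Extends integrands from [[0, 1]] to the real line, where continuity is required, without leaving
    the segment from 0 to [z]. *)
Definition clamp (t : R) : R := Order.max 0 (Order.min t 1).

Lemma clamp_id (t : R) : 0 <= t <= 1 -> clamp t = t.
Proof. by move=> /andP[t0 t1]; rewrite /clamp (min_idPl t1) (max_idPr t0). Qed.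

Lemma clamp_bound (t : R) : 0 <= clamp t <= 1.
Proof. by rewrite /clamp le_max lexx ge_max ler01 ge_min lexx orbT. Qed.

Lemma clamp_lip (s t : R) : `|clamp s - clamp t| <= `|s - t|.
Proof.
have h1 := ler_norm (s - t); have h2 := ler_norm (t - s).
rewrite [`|t - s|]distrC in h2.
have h0 := normr_ge0 (s - t).
rewrite /clamp !maxEle !minEle ler_norml.
by case: (leP s 1); case: (leP t 1) => t1 s1; rewrite ?ler01;
  try (case: (leP 0 s) => s0); try (case: (leP 0 t) => t0); lra.
Qed.

Lemma nr_clamp (t : R) (z : R[i]) : nr ((clamp t)%:C * z) <= nr z.
Proof.
have /andP[c0 c1] := clamp_bound t.
by rewrite nrM nrR ger0_norm// ler_piMl// nr_ge0.
Qed.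

Lemma rcont_clamp (p : R[i] -> R[i]) (z : R[i]) : (forall w, nr w <= nr z -> ccont p w) ->
  rcont (fun t => p ((clamp t)%:C * z)).
Proof.
move=> cp; apply: (rcont_comp (g := fun t => (clamp t)%:C * z)) => [t e e0|t].
  have n0 : 0 < nr z + 1 by rewrite ltr_wpDl// nr_ge0.
  exists (e / (nr z + 1)) => [|h]; first exact: divr_gt0.
  rewrite ler_pdivlMr// -mulrBl -rmorphB nrM nrR => he.
  have := clamp_lip (t + h) t; rewrite addrAC subrr add0r => H.
  apply: le_trans he; apply: ler_pM => //; rewrite ?nr_ge0//; lra.
by apply: cp; exact: nr_clamp.
Qed.

(** For [z <> 0] this is the primitive of [p] vanishing at 0, divided by [z]; in this form the
    origin is no exception. *)
Definition radial_mean (p : R[i] -> R[i]) (z : R[i]) : R[i] :=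
  cint (fun t => p ((clamp t)%:C * z)) 0 1.

Lemma radial_meanP (p p1 : R[i] -> R[i]) :
  (forall z, nr z < 1 -> vder (W := R[i]^o) p z (p1 z)) ->
  (forall z, nr z < 1 -> ccont p1 z) ->
  (forall rho : R, rho < 1 -> exists M : R, forall z, nr z <= rho -> nr (p z) <= M) ->
  forall z, nr z < 1 -> exists d : R[i],
    vder (W := R[i]^o) (radial_mean p) z d /\ radial_mean p z + z * d = p z.
Proof.
move=> dp cp1 bp z z1.
have cp w : nr w < 1 -> ccont p w by move=> /dp; exact: vder_ccont.
pose d := cint (fun t => (clamp t)%:C * p1 ((clamp t)%:C * z)) 0 1.
have rc (w : R[i]) : nr w < 1 -> rcont (fun t => p ((clamp t)%:C * w)).
  by move=> w1; apply: rcont_clamp => v vw; apply: cp; exact: le_lt_trans w1.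
have rc1 : rcont (fun t => (clamp t)%:C * p1 ((clamp t)%:C * z)).
  have [->|z0] := eqVneq z 0.
    have := @rcont_clamp (fun w => w * p1 0) 1.
    have H : forall w : R[i], nr w <= nr (1 : R[i]) -> ccont (fun w => w * p1 0) w.
      move=> w _; apply: cdif_ccont; apply: cdifM; [exact: cdif_id|exact: cdif_cst].
    by move=> /(_ H); congr rcont; apply/funext => t; rewrite mulr1 mulr0.
  (* For [z <> 0] the factor [t] is [z^-1 (t z)], so the integrand depends on the point [t z]
     alone. *)
  have H : forall w, nr w <= nr z -> ccont (fun w => z^-1 * w * p1 w) w.
    move=> w wz e e0.
    have [r r0 Hr] := cp1 w (le_lt_trans wz z1) 1 ltr01.
    pose K := nr (p1 w) + 1 + nr w + 1.
    have K0 : 0 < K by rewrite /K; have := nr_ge0 (p1 w); have := nr_ge0 w; lra.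
    have nz : 0 < nr z by rewrite nr_gt0.
    have e1 : 0 < e * nr z / (2 * K) by rewrite divr_gt0 ?mulr_gt0.
    have [s s0 Hs] := cp1 w (le_lt_trans wz z1) _ e1.
    exists (Order.min r (Order.min s (e * nr z / (2 * K)))).
      by rewrite !lt_min r0 s0 e1.
    move=> h; rewrite !le_min => /andP[/Hr h1 /andP[/Hs h2 h3]].
    have -> : z^-1 * (w + h) * p1 (w + h) - z^-1 * w * p1 w =
      z^-1 * (h * p1 (w + h) + w * (p1 (w + h) - p1 w)) by ring.
    rewrite nrM nrV mulrC ler_pdivrMr//; apply: le_trans (nrD _ _) _; rewrite !nrM.
    have p1b : nr (p1 (w + h)) <= nr (p1 w) + 1.
      by rewrite -[p1 (w + h)](subrK (p1 w)) addrC; apply: le_trans (nrD _ _) _; rewrite lerD2l.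
    move: h2 h3; rewrite !ler_pdivlMr ?mulr_gt0// => h2 h3.
    have q1 : nr h * nr (p1 (w + h)) <= nr h * K.
      by apply: ler_wpM2l; [exact: nr_ge0|rewrite /K; have := nr_ge0 w; lra].
    have q2 : nr w * nr (p1 (w + h) - p1 w) <= K * nr (p1 (w + h) - p1 w).
      by apply: ler_wpM2r; [exact: nr_ge0|rewrite /K; have := nr_ge0 (p1 w); lra].
    lra.
  have := @rcont_clamp _ z H; congr rcont; apply/funext => t; congr (_ * _).
  by rewrite mulrCA mulVf// mulr1.
exists d; split.
  pose rho := (1 + nr z) / 2; pose q := (1 - nr z) / 2.
  have q0 : 0 < q by rewrite /q; lra.
  have [M HM] := bp rho ltac:(rewrite /rho; lra).
  have M0 : 0 <= M by apply: le_trans (nr_ge0 _) (HM 0 _); rewrite nr0 /rho; have := nr_ge0 z; lra.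
  pose C := 64 * M / q ^+ 2.
  have C0 : 0 <= C by apply: divr_ge0; [apply: mulr_ge0|apply: exprn_ge0; exact: ltW].
  have tayl w k : nr w <= nr z -> nr k <= q / 2 -> nr (p (w + k) - p w - k * p1 w) <= C * nr k ^+ 2.
    move=> wz kq.
    have win u : nr u < q -> nr (w + u) <= rho by have := nrD w u; rewrite /rho /q; lra.
    have := @cauchy_taylor R R[i]^o (fun u => p (w + u)) (fun u => p1 (w + u)) q M q0.
    rewrite addr0 => /(_ _ _ _ kq); apply=> u /win uw; last exact: HM.
    apply: (@vder_shift R R[i]^o p); apply: dp; apply: le_lt_trans uw _; rewrite /rho; lra.
  apply: vder_scalar => e e0.
  exists (Order.min (q / 2) (e / (C + 1))).
    by rewrite lt_min; apply/andP; split; apply: divr_gt0 => //; lra.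
  move=> k; rewrite le_min => /andP[kq ke].
  have zk1 : nr (z + k) < 1 by have := nrD z k; move: kq; rewrite /q; lra.
  have -> : radial_mean p (z + k) - radial_mean p z - k * d =
    cint (fun t => p ((clamp t)%:C * (z + k)) + -1 * p ((clamp t)%:C * z) +
      - k * ((clamp t)%:C * p1 ((clamp t)%:C * z))) 0 1.
    rewrite /radial_mean /d cintD; [|apply: rcontD|exact: rcontZ]; last 2 first.
      exact: rc.
      by apply: rcontZ; exact: rc.
    rewrite cintD; [|exact: rc|by apply: rcontZ; exact: rc].
    by rewrite !cintZ//; [ring|exact: rc].
  have := @cint_le R (fun t => p ((clamp t)%:C * (z + k)) + -1 * p ((clamp t)%:C * z) +
      - k * ((clamp t)%:C * p1 ((clamp t)%:C * z))) (C * nr k ^+ 2) 0 1.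
  rewrite subr0 mulr1 => H; apply: le_trans (H _ ler01 _) _.
  - apply: rcontD; last exact: rcontZ.
    by apply: rcontD; [exact: rc|apply: rcontZ; exact: rc].
  - move=> t _; have -> : p ((clamp t)%:C * (z + k)) + -1 * p ((clamp t)%:C * z) +
      - k * ((clamp t)%:C * p1 ((clamp t)%:C * z)) =
      p ((clamp t)%:C * z + (clamp t)%:C * k) - p ((clamp t)%:C * z) -
      (clamp t)%:C * k * p1 ((clamp t)%:C * z) by rewrite mulrDr; ring.
    have tk := nr_clamp t k.
    apply: le_trans (tayl _ _ (nr_clamp t z) (le_trans tk kq)) _.
    by apply: ler_wpM2l => //; rewrite ler_pXn2r ?nnegrE ?nr_ge0.
  - rewrite expr2 mulrA; apply: ler_wpM2r; first exact: nr_ge0.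
    move: ke; rewrite ler_pdivlMr ?ltr_wpDl//; have := nr_ge0 k; nra.
rewrite /radial_mean /d -cintZ// -cintD; [|exact: rc|exact: rcontZ].
rewrite (@cint_FTC _ (fun t => t%:C * p (t%:C * z))) ?ler01//.
- by rewrite rmorph0 rmorph1 !mul0r subr0 !mul1r.
- by apply: rcontD; [exact: rc|exact: rcontZ].
- move=> t t01; rewrite clamp_id//.
  have tz : nr (t%:C * z) < 1.
    by apply: le_lt_trans z1; rewrite -(clamp_id t01) nr_clamp.
  have H : vder (W := R[i]^o) (fun w => w * p (w * z)) t%:C (p (t%:C * z) + z * (t%:C * p1 (t%:C * z))).
    have e1 : vder (W := R[i]^o) (fun w => w * z) t%:C z.
      have := @vder_mull R z t%:C; congr vder; apply/funext => w; exact: mulrC.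
    have := vderM (@vder_id R t%:C) (vder_comp e1 (dp _ tz)) => H.
    by apply: (vder_eq H); rewrite -[LHS]/(1 * p (t%:C * z) + t%:C * (z * p1 (t%:C * z))); ring.
  have := @vder_line0 R R[i]^o (fun w => w * p (w * z)) 1 t; rewrite mulr1 => /(_ _ H).
  by rewrite scale1r; congr rder; apply/funext => s; rewrite mulr1.
Qed.

End RadialPrimitive.

(** * A logarithm on the disc centred at 1 *)

Section ComplexLogarithm.
Variable R : realType.

Lemma vder0_const (f : R[i] -> R[i]) : (forall z, nr z < 1 -> vder (W := R[i]^o) f z 0) ->
  forall z, nr z < 1 -> f z = f 0.
Proof.
move=> f0 z z1; apply/eqP; rewrite -subr_eq0 -nr_eq0 eq_le nr_ge0 andbT.
have := @mean_value_segment R R[i]^o f (fun=> 0) 0 z 0; rewrite mul0r; apply=> t t01.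
  rewrite add0r subr0; apply: f0; apply: le_lt_trans z1.
  by rewrite -(clamp_id t01) nr_clamp.
by rewrite nr0.
Qed.

Lemma radial_mean_le (p : R[i] -> R[i]) (z : R[i]) (M : R) :
  (forall w, nr w <= nr z -> cdif p w) -> (forall w, nr w <= nr z -> nr (p w) <= M) ->
  nr (radial_mean p z) <= M.
Proof.
move=> dp pM; have := @cint_le R (fun t => p ((clamp t)%:C * z)) M 0 1.
rewrite subr0 mulr1; apply=> // [|t _].
  by apply: rcont_clamp => w wz; apply: cdif_ccont; exact: dp.
by apply: pM; exact: nr_clamp.
Qed.

Lemma radial_mean0 (p : R[i] -> R[i]) : radial_mean p 0 = p 0.
Proof.
rewrite /radial_mean (@cintE _ _ (fun t => p 0 * t%:C)) ?rmorph1 ?rmorph0.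
  by rewrite mulr1 mulr0 subr0.
move=> t; rewrite mulr0; have := rderZ (p 0) (@rder_id R t).
by rewrite [_ *: 1]mulr1.
Qed.

Let ell (w : R[i]) := - (1 - w)^-1.

(** The branch of the logarithm of [1 - w] that vanishes at 0. *)
Definition clog1m (w : R[i]) : R[i] := w * radial_mean ell w.

Lemma sub1_neq0 (w : R[i]) : nr w < 1 -> 1 - w != 0.
Proof. by move=> w1; rewrite subr_eq0; apply: contraTneq w1 => <-; rewrite nr1 ltxx. Qed.

Lemma vder_1m (w : R[i]) : vder (W := R[i]^o) (fun w => 1 - w) w (-1).
Proof.
have H := vderB (@vder_cst R R[i]^o 1 w) (@vder_id R w).
by apply: (vder_eq H); exact: sub0r.
Qed.

Let ell_vder w : nr w < 1 -> vder (W := R[i]^o) ell w (- (1 - w) ^- 2).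
Proof.
move=> w1; have H := vderN (vderV (vder_1m w) (sub1_neq0 w1)).
apply: (vder_eq H); rewrite -[LHS]/(- - (-1 / (1 - w) ^+ 2)) mulN1r opprK //.
Qed.

Let ell_le (rho : R) w : rho < 1 -> nr w <= rho -> nr (ell w) <= (1 - rho)^-1.
Proof.
move=> r1 wr; rewrite nrN nrV lef_pV2 ?posrE; last 2 first.
- by rewrite nr_gt0 sub1_neq0//; lra.
- by rewrite subr_gt0.
have := nr_tri 1 w (0 : R[i]); rewrite !subr0 nr1; lra.
Qed.

Lemma vder_clog1m w : nr w < 1 -> vder (W := R[i]^o) clog1m w (- (1 - w)^-1).
Proof.
move=> w1.
have [||d [Hd E]] := @radial_meanP R ell (fun w => - (1 - w) ^- 2) ell_vder _ _ w w1.
- move=> z z1; apply: cdif_ccont; apply: cdifN; apply: cdifV; first by cdif_poly.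
  by rewrite expf_neq0// sub1_neq0.
- by move=> rho r1; exists (1 - rho)^-1 => z; exact: ell_le.
have H := vderM (@vder_id R w) Hd.
by apply: (vder_eq H); rewrite -[LHS]/(1 * radial_mean ell w + w * d) mul1r E.
Qed.

Lemma clog1m0 : clog1m 0 = 0. Proof. by rewrite /clog1m mul0r. Qed.

Lemma clog1m_le (rho : R) w : rho < 1 -> nr w <= rho -> nr (clog1m w) <= (1 - rho)^-1.
Proof.
move=> r1 wr; rewrite nrM -[leRHS]mul1r; apply: ler_pM; rewrite ?nr_ge0//; first lra.
apply: radial_mean_le => v vw; last by apply: ell_le => //; lra.
by exists (- (1 - v) ^- 2); apply: ell_vder; lra.
Qed.

Lemma cexp_clog1m w : nr w < 1 -> cexp (clog1m w) = 1 - w.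
Proof.
move=> w1; have := @vder0_const (fun w => cexp (clog1m w) * (1 - w)^-1).
move=> /(_ _ w w1) H; have {}H : cexp (clog1m w) * (1 - w)^-1 = 1.
  rewrite H ?clog1m0 ?cexp0 ?subr0 ?mul1r ?invr1// => z z1.
  have n0 := sub1_neq0 z1.
  have HD := vderM (vder_comp (vder_clog1m z1) (vder_cexp _)) (vderV (vder_1m z) n0).
  apply: (vder_eq HD).
  rewrite -[LHS]/((- (1 - z)^-1 * cexp (clog1m z)) * (1 - z)^-1 +
     cexp (clog1m z) * - (-1 / (1 - z) ^+ 2)).
  by field.
by apply: (mulIf (invr_neq0 (sub1_neq0 w1))); rewrite H mulfV// sub1_neq0.
Qed.

(** Along the radius to [w] the real part of [1 - w] is positive, hence so is the cosine of the
    imaginary part; starting from 0, that part cannot cross a zero of the cosine. *)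
Lemma Im_clog1m w : nr w < 1 -> `|complex.Im (clog1m w)| < pi / 2.
Proof.
move=> w1; pose u (t : R) := complex.Im (clog1m (t%:C * w)).
have tw (t : R) : 0 <= t <= 1 -> nr (t%:C * w) < 1.
  by move=> t01; apply: le_lt_trans w1; rewrite -(clamp_id t01) nr_clamp.
have cu (t : R) : 0 <= t <= 1 -> 0 < cos (u t).
  move=> /tw tw1; have := cexp_clog1m tw1 => /(congr1 (@complex.Re R)).
  rewrite /cexp Re_mul/= mul0r subr0 Re_add Re_opp/= => E.
  have : 0 < 1 - complex.Re (t%:C * w).
    by have := Re_le_nr (t%:C * w); rewrite ler_norml; lra.
  by rewrite -E pmulr_rgt0// expR_gt0.
have u0 : u 0 = 0 by rewrite /u rmorph0 mul0r clog1m0.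
have uc : {within `[0, 1], continuous u}.
  apply: continuous_in_subspaceT => t; rewrite inE/= in_itv/= => t01.
  have := vder_line0 (vder_clog1m (tw t t01)) => H.
  have := @rder_functional R R[i]^o (fun v => complex.Im v) _ t _ _ _ _ H.
  move=> /(_ _ _ _)[].
  - by move=> a b; rewrite Im_add.
  - by move=> s [x y] /=; rewrite mul0r addr0.
  - by move=> v; apply: le_trans (Im_le_nr v); rewrite ler_norm.
  move=> + _.
  by move=> /derivable1_diffP/differentiable_continuous.
have u1 : u 1 = complex.Im (clog1m w) by rewrite /u rmorph1 mul1r.
have pi20 : 0 < pi / 2 :> R by rewrite divr_gt0 ?pi_gt0.
have no v : cos v = 0 -> ~ (Order.min (u 0) (u 1) <= v <= Order.max (u 0) (u 1)).
  move=> cv /(IVT (ler01 : 0 <= 1 :> R) uc)[t]; rewrite in_itv/= => /cu + uv.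
  by rewrite uv cv ltxx.
rewrite -u1 ltr_norml; apply/andP; split; rewrite ltNge; apply/negP => h.
  apply: (no (- (pi / 2))); first by rewrite cosN cos_pihalf.
  rewrite u0 (_ : Order.min 0 (u 1) = u 1) ?h//=; last by apply/min_idPr; lra.
  by rewrite le_max; apply/orP; left; lra.
apply: (no (pi / 2)); first by rewrite cos_pihalf.
rewrite u0 (_ : Order.max 0 (u 1) = u 1) ?h ?andbT//; last by apply/max_idPr; lra.
by rewrite ge_min; apply/orP; left; lra.
Qed.

End ComplexLogarithm.

Lemma Re_lt_vder (R : realType) (g g' : R[i] -> R[i]) :
  (forall t : R, 0 <= t <= 1 -> vder (W := R[i]^o) g t%:C (g' t%:C)) ->
  (forall t : R, 0 <= t <= 1 -> 0 < complex.Re (g' t%:C)) ->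
  complex.Re (g 0) < complex.Re (g 1).
Proof.
move=> gd pos; pose G (t : R) := complex.Re (g t%:C).
have Gd (t : R) : 0 <= t <= 1 -> is_derive t 1 G (complex.Re (g' t%:C)).
  move=> t01; have := @vder_line0 R R[i]^o g 1 t.
  rewrite mulr1 => /(_ _ (gd t t01)); rewrite scale1r.
  have -> : (fun s : R => g (s%:C * 1)) = (fun s => g s%:C).
    by apply/funext => s; rewrite mulr1.
  move=> H.
  apply: (@rder_functional R R[i]^o (fun v => complex.Re v) _ t _ _ _ _ H).
  - by move=> u v; rewrite Re_add.
  - by move=> s [x y] /=; rewrite mul0r subr0.
  - by move=> v; apply: le_trans (Re_le_nr v); rewrite ler_norm.
have [||t tin] := @MVT R G (fun t => complex.Re (g' t%:C)) 0 1 ltr01.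
- by move=> t; rewrite in_itv/= => /andP[t0 t1]; apply: Gd; rewrite !ltW.
- apply: continuous_in_subspaceT => t; rewrite inE/= in_itv/= => /Gd[+ _].
  by move=> /derivable1_diffP/differentiable_continuous.
rewrite /G rmorph0 rmorph1 subr0 mulr1 -subr_gt0 => ->; apply: pos.
by move: tin; rewrite in_itv/= => /andP[t0 t1]; rewrite !ltW.
Qed.

(** * The extremal function of one variable *)

Section Extremal.
Variables (R : realType) (c m : R).
Hypotheses (c01 : 0 <= c < 1) (m23 : 2 <= m <= 3).

Let sigma := Num.sqrt (1 - c ^+ 2).

Let sigma2 : sigma ^+ 2 = 1 - c ^+ 2.
Proof. by rewrite sqr_sqrtr//; case/andP: c01; nra. Qed.

Let sigma_gt0 : 0 < sigma.
Proof. by rewrite sqrtr_gt0; case/andP: c01; nra. Qed.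

(** [e] and [eb] are the conjugate zeros of [ext_q], on the unit circle and inverse to each other,
    so a logarithm of [ext_q] is a sum of two values of [clog1m]. *)
Let e : R[i] := c +i* sigma.
Let eb : R[i] := c +i* - sigma.

Let eeb : e * eb = 1.
Proof.
apply/eqP; rewrite eq_complex/=; apply/andP; split; apply/eqP; last by ring.
by rewrite mulrN opprK -!expr2 sigma2; ring.
Qed.

Let eDeb : e + eb = 2 * c%:C.
Proof. by apply/eqP; rewrite eq_complex/=; apply/andP; split; apply/eqP; ring. Qed.

Let nr_e : nr e = 1.
Proof. by apply/eqP; rewrite -(eqrXn2 (n := 2))// ?nr_ge0// nrS/= sigma2 expr1n; apply/eqP; ring. Qed.

Let nr_eb : nr eb = 1.
Proof. by apply/eqP; rewrite -(eqrXn2 (n := 2))// ?nr_ge0// nrS/= sqrrN sigma2 expr1n; apply/eqP; ring. Qed.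

Definition ext_q (z : R[i]) : R[i] := 1 - 2 * c%:C * z + z ^+ 2.

Let qE z : ext_q z = (1 - e * z) * (1 - eb * z).
Proof.
have -> : (1 - e * z) * (1 - eb * z) = 1 - (e + eb) * z + e * eb * z ^+ 2 by ring.
by rewrite eDeb eeb mul1r.
Qed.

Let ez1 z : nr z < 1 -> nr (e * z) < 1. Proof. by rewrite nrM nr_e mul1r. Qed.
Let ebz1 z : nr z < 1 -> nr (eb * z) < 1. Proof. by rewrite nrM nr_eb mul1r. Qed.

Lemma ext_q_neq0 z : nr z < 1 -> ext_q z != 0.
Proof. by move=> z1; rewrite qE mulf_neq0// sub1_neq0// ?ez1// ebz1. Qed.

Let L (z : R[i]) : R[i] := clog1m (e * z) + clog1m (eb * z).
Let dL (z : R[i]) : R[i] := - (2 * c%:C - 2 * z) / ext_q z.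

Let L_vder z : nr z < 1 -> vder (W := R[i]^o) L z (dL z).
Proof.
move=> z1; have H := vderD (vder_comp (@vder_mull R e z) (vder_clog1m (ez1 z1)))
  (vder_comp (@vder_mull R eb z) (vder_clog1m (ebz1 z1))).
apply: (vder_eq H); rewrite -[LHS]/(e * - (1 - e * z)^-1 + eb * - (1 - eb * z)^-1).
have n1 := sub1_neq0 (ez1 z1); have n2 := sub1_neq0 (ebz1 z1).
rewrite /dL qE.
have -> : 2 * c%:C - 2 * z = e * (1 - eb * z) + eb * (1 - e * z).
  have -> : e * (1 - eb * z) + eb * (1 - e * z) = e + eb - 2 * (e * eb) * z by ring.
  by rewrite eDeb eeb mulr1.
by move: (1 - e * z) (1 - eb * z) n1 n2 => u v u0 v0; field; rewrite u0 v0.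
Qed.

Let cexpL z : nr z < 1 -> cexp (L z) = ext_q z.
Proof. by move=> z1; rewrite cexpD !cexp_clog1m ?ez1 ?ebz1// qE. Qed.

Let L0 : L 0 = 0. Proof. by rewrite /L !mulr0 clog1m0 addr0. Qed.

Let ImL z : nr z < 1 -> `|complex.Im (L z)| < pi.
Proof.
move=> z1; rewrite Im_add; apply: le_lt_trans (ler_normD _ _) _.
by rewrite [pi]splitr ltrD// Im_clog1m ?ez1 ?ebz1.
Qed.

Let ImW z : nr z < 1 -> `|complex.Im (clog1m (eb * z) - clog1m (e * z))| < pi.
Proof.
move=> z1; rewrite Im_add Im_opp; apply: le_lt_trans (ler_normB _ _) _.
by rewrite [pi]splitr ltrD// Im_clog1m ?ez1 ?ebz1.
Qed.

Let a : R := - (m / 2).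

(** The branch of [ext_q] to the power [- m / 2] that equals 1 at 0. *)
Definition ext_p (z : R[i]) : R[i] := cexp (a%:C * L z).
Definition ext_p1 (z : R[i]) : R[i] := m%:C * (c%:C - z) / ext_q z * ext_p z.

Lemma ext_p0 : ext_p 0 = 1. Proof. by rewrite /ext_p L0 mulr0 cexp0. Qed.

Lemma ext_p_neq0 z : ext_p z != 0. Proof. exact: cexp_neq0. Qed.

Lemma ext_p_vder z : nr z < 1 -> vder (W := R[i]^o) ext_p z (ext_p1 z).
Proof.
move=> z1; have H := vder_comp (vderM (@vder_cst R R[i]^o a%:C z) (L_vder z1))
  (@vder_cexp R (a%:C * L z)).
apply: (vder_eq H); rewrite -[LHS]/((0 * L z + a%:C * dL z) * ext_p z).
rewrite /ext_p1 /dL /a rmorphN/= rmorphM/= fmorphV/= rmorph_nat; have := ext_q_neq0 z1.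
by move: (ext_q z) => u u0; field.
Qed.

Let p1_cont z : nr z < 1 -> ccont ext_p1 z.
Proof.
move=> z1; have n : cdif (fun w : R[i] => m%:C * (c%:C - w)) z.
  exact: cdifM (cdif_cst _ z) (cdifD (cdif_cst _ z) (cdifN (cdif_id z))).
have q : cdif ext_q z.
  exact: cdifD (cdifD (cdif_cst 1 z) (cdifN (cdifM (cdif_cst (2 * c%:C) z) (cdif_id z))))
    (cdifX 2 (cdif_id z)).
have p : cdif ext_p z by exists (ext_p1 z); exact: ext_p_vder.
exact: cdif_ccont (cdifM (cdifM n (cdifV q (ext_q_neq0 z1))) p).
Qed.

Let p_bounded (rho : R) : rho < 1 -> exists M : R, forall z, nr z <= rho -> nr (ext_p z) <= M.
Proof.
move=> r1; exists (expR (nr a%:C * ((1 - rho)^-1 + (1 - rho)^-1))) => z zr.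
rewrite nr_cexp ler_expR; apply: le_trans (ler_norm _) _; apply: le_trans (Re_le_nr _) _.
rewrite nrM ler_wpM2l ?nr_ge0//; apply: le_trans (nrD _ _) _.
by apply: lerD; apply: clog1m_le => //; rewrite nrM ?nr_e ?nr_eb mul1r.
Qed.

Definition ext_h (z : R[i]) : R[i] := radial_mean ext_p z.

Lemma ext_hP z : nr z < 1 -> exists d : R[i],
  vder (W := R[i]^o) ext_h z d /\ ext_h z + z * d = ext_p z.
Proof. exact: (radial_meanP ext_p_vder p1_cont p_bounded). Qed.

Lemma ext_h0 : ext_h 0 = 1.
Proof. by rewrite /ext_h radial_mean0 ext_p0. Qed.

Lemma ext_f_vder z : nr z < 1 -> vder (W := R[i]^o) (fun z => z * ext_h z) z (ext_p z).
Proof.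
move=> /ext_hP[d [Hd E]]; apply: (vder_eq (vderM (@vder_id R z) Hd)).
by rewrite -[LHS]/(1 * ext_h z + z * d) mul1r.
Qed.

(** The product is the exponential of [(1 - m / 2) L]; the factor has modulus at most 1/2 and the
    imaginary part of [L] stays below [pi]. *)
Let pq_pos z : nr z < 1 -> 0 < complex.Re (ext_p z * ext_q z).
Proof.
move=> z1; rewrite -cexpL// -cexpD /cexp Re_mul/= mul0r subr0 pmulr_rgt0 ?expR_gt0//.
apply: cos_gt0_pihalf; rewrite -ltr_norml Im_add Im_mul/= mul0r addr0.
have -> : a * complex.Im (L z) + complex.Im (L z) = (1 + a) * complex.Im (L z) by ring.
rewrite normrM; have := ImL z1; have : `|1 + a| <= 1 / 2.
  by rewrite /a ler_norml; case/andP: m23; lra.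
by have := normr_ge0 (complex.Im (L z)); have := normr_ge0 (1 + a); nra.
Qed.

Let sin_pos_range (x : R) : - pi < x < 2 * pi -> 0 < sin x -> 0 < x < pi.
Proof.
move=> /andP[x1 x2] sx; apply/andP; split; rewrite ltNge; apply/negP => h.
  have : 0 <= sin (- x) by apply: sin_ge0_pi; apply/andP; split; lra.
  by rewrite sinN; lra.
have : 0 <= sin (x - pi) by apply: sin_ge0_pi; apply/andP; split; lra.
by have := sinDpi (x - pi); rewrite subrK; lra.
Qed.

Let e_eb_neq0 : e - eb != 0.
Proof. by apply/eqP => /(congr1 (@complex.Im R)) /=; move: sigma_gt0; lra. Qed.

(* In the coordinate [W = log ((1 - eb z) / (1 - e z))], which maps the disc onto
   a strip, [f] becomes a function whose derivative [p q] has positive real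
   part; so [f] cannot vanish at the end of a segment starting at [0]. *)
Let ext_f_neq0 z : nr z < 1 -> z != 0 -> z * ext_h z != 0.
Proof.
move=> z1 z0.
pose W := clog1m (eb * z) - clog1m (e * z).
pose E (tau : R[i]) := cexp (tau * W).
have n1 := sub1_neq0 (ez1 z1); have n2 := sub1_neq0 (ebz1 z1).
have E1 : E 1 = (1 - eb * z) / (1 - e * z).
  by rewrite /E mul1r /W cexpD cexpN !cexp_clog1m ?ez1 ?ebz1.
have E0 : E 0 = 1 by rewrite /E mul0r cexp0.
have W0 : W != 0.
  apply: contraNneq z0 => W0; have := E1; rewrite /E W0 mulr0 cexp0.
  move=> /(congr1 (fun w => w * (1 - e * z))); rewrite mul1r mulfVK// => H.
  have : (e - eb) * z == 0 by apply/eqP; transitivity ((1 - eb * z) - (1 - e * z)); [ring|rewrite -H subrr].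
  by rewrite mulf_eq0 (negbTE e_eb_neq0).
pose theta := acos c.
have c11 : -1 <= c <= 1 by case/andP: c01; lra.
have cth : cos theta = c by rewrite acosK// in_itv.
have sth : sin theta = sigma by rewrite sin_acos.
have th0 : 0 < theta by apply: acos_gt0; case/andP: c01; lra.
have thpi : theta < pi by apply: acos_ltpi; case/andP: c01; lra.
have ImE (t : R) : complex.Im (e * E t%:C) =
    expR (complex.Re (t%:C * W)) * sin (theta + t * complex.Im W).
  have reim : complex.Im (t%:C * W) = t * complex.Im W by rewrite Im_mul/= mul0r addr0.
  rewrite /E /cexp reim sinD cth sth; move: (expR _) (cos _) (sin _) => x cs sn /=.
  by ring.
(* The Möbius map [e (1 - eb z) / (1 - e z)] sends the disc into the upper half plane; the bound on
   the imaginary part of [W] then singles out the right interval for its argument. *)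
have range1 : 0 < theta + complex.Im W < pi.
  apply: sin_pos_range.
    by have := ImW z1; rewrite -/W ltr_norml; lra.
  have := ImE 1; rewrite mul1r rmorph1 E1 => H.
  rewrite -(pmulr_rgt0 _ (expR_gt0 (complex.Re (1 * W)))) -H.
  have -> : e * ((1 - eb * z) / (1 - e * z)) =
     (nr (1 - e * z) ^+ 2)^-1%:C * ((e - z) * (1 - eb * z^*)).
    have cj : (1 - e * z)^* = 1 - eb * z^*.
      rewrite rmorphB rmorphM rmorph1/=; congr (_ - _ * _).
    rewrite fmorphV/= -mul_conj cj.
    have n3 : 1 - eb * z^* != 0 by rewrite -cj conjC_eq0.
    have -> : e * ((1 - eb * z) / (1 - e * z)) = (e - e * eb * z) / (1 - e * z) by ring.
    by rewrite eeb mul1r; move: (1 - e * z) (1 - eb * z^*) n1 n3 => u v u0 v0; field; rewrite u0 v0.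
  rewrite Im_mul/= mul0r addr0 pmulr_rgt0 ?invr_gt0 ?exprn_gt0 ?nr_gt0//.
  have -> : (e - z) * (1 - eb * z^*) = e - z - e * eb * z^* + eb * (z * z^*) by ring.
  rewrite eeb mul1r mul_conj.
  have -> : complex.Im (e - z - z^* + eb * (nr z ^+ 2)%:C) = sigma * (1 - nr z ^+ 2).
    by case: (z) => x y /=; ring.
  by rewrite mulr_gt0// subr_gt0 expr_lt1// nr_ge0.
have IEpos (t : R) : 0 <= t <= 1 -> 0 < complex.Im (e * E t%:C).
  move=> /andP[t0 t1]; rewrite ImE pmulr_rgt0 ?expR_gt0//; apply: sin_gt0_pi.
  have mix (x y : R) : 0 < x -> 0 < y -> 0 < (1 - t) * x + t * y.
    by move=> x0 y0; have [h|h] := leP t (1 / 2); nra.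
  case/andP: range1 => r1 r2; apply/andP; split.
    by have := mix _ _ th0 r1; lra.
  have := mix (pi - theta) (pi - (theta + complex.Im W)); rewrite !subr_gt0.
  by move=> /(_ thpi r2); lra.
have den0 (t : R) : 0 <= t <= 1 -> eb - e * E t%:C != 0.
  move=> /IEpos h; apply/eqP => /(congr1 (@complex.Im R)); rewrite Im_add Im_opp.
  have -> : complex.Im eb = - sigma by [].
  rewrite [complex.Im 0](_ : _ = 0 :> R)//.
  by move: (complex.Im _) h sigma_gt0 => i h s0; lra.
(* Solves [E tau = (1 - eb zeta) / (1 - e zeta)]: a curve from 0 to [z], kept in the disc by the
   convexity of the strip, with derivative [K q(zeta)]. *)
pose zeta (tau : R[i]) := (1 - E tau) / (eb - e * E tau).
have zeta1 (t : R) : 0 <= t <= 1 -> nr (zeta t%:C) < 1.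
  move=> t01; have d0 := den0 t t01; have h := IEpos t t01.
  rewrite /zeta nrM nrV ltr_pdivrMr ?nr_gt0// mul1r.
  rewrite -(ltr_pXn2r (n := 2)) ?nnegrE ?nr_ge0// !nrS.
  move: h; case: (E _) => x y /=; have := sigma2; move: sigma_gt0 => s0 s2 h.
  have pos : 0 < 4 * sigma * (c * y + sigma * x) by apply: mulr_gt0; lra.
  rewrite -subr_gt0 [X in 0 < X](_ : _ = 4 * sigma * (c * y + sigma * x))//.
  by ring: s2.
have E_vder tau : vder (W := R[i]^o) E tau (W * E tau).
  have e1 : vder (W := R[i]^o) (fun tau => tau * W) tau W.
    by have := @vder_mull R W tau; congr vder; apply/funext => w; rewrite mulrC.
  exact: (vder_comp e1 (@vder_cexp R (tau * W))).
pose K := W / (e - eb).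
have K0 : K != 0 by rewrite mulf_neq0// invr_neq0.
have zeta_vder (t : R) : 0 <= t <= 1 ->
    vder (W := R[i]^o) zeta t%:C (K * ext_q (zeta t%:C)).
  move=> t01; have d0 := den0 t t01.
  have H := vderM (vderB (@vder_cst R R[i]^o 1 t%:C) (E_vder t%:C))
    (vderV (vderB (@vder_cst R R[i]^o eb t%:C) (vderM (@vder_cst R R[i]^o e t%:C) (E_vder t%:C))) d0).
  apply: (vder_eq H).
  rewrite -[LHS]/((0 - W * E t%:C) / (eb - e * E t%:C) + (1 - E t%:C) *
    - ((0 - (0 * E t%:C + e * (W * E t%:C))) / (eb - e * E t%:C) ^+ 2)).
  rewrite qE /K /zeta; move: (E t%:C) d0 => w d0.
  have -> : 1 - e * ((1 - w) / (eb - e * w)) = (eb - e) / (eb - e * w) by field.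
  have -> : 1 - eb * ((1 - w) / (eb - e * w)) = w * (eb - e) / (eb - e * w) by field.
  have -> : eb - e = - (e - eb) by rewrite opprB.
  have -> : (0 - W * w) / (eb - e * w) +
     (1 - w) * - ((0 - (0 * w + e * (W * w))) / (eb - e * w) ^+ 2) =
     W * w * (e - eb) / (eb - e * w) ^+ 2 by field.
  move: (e - eb) e_eb_neq0 (eb - e * w) d0 => u u0 v v0.
  by field; rewrite u0 v0.
have g_vder (t : R) : 0 <= t <= 1 ->
    vder (W := R[i]^o) (fun tau => K^-1 * (zeta tau * ext_h (zeta tau))) t%:C
      ((fun tau => ext_p (zeta tau) * ext_q (zeta tau)) t%:C).
  move=> t01; have H := vderM (@vder_cst R R[i]^o K^-1 t%:C)
    (vder_comp (zeta_vder t t01) (ext_f_vder (zeta1 t t01))).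
  apply: (vder_eq H).
  rewrite -[LHS]/(0 * (zeta t%:C * ext_h (zeta t%:C)) +
    K^-1 * (K * ext_q (zeta t%:C) * ext_p (zeta t%:C))).
  by rewrite mul0r add0r -[K * _ * _]mulrA mulKf// mulrC.
have zeta0 : zeta 0 = 0 by rewrite /zeta E0 subrr mul0r.
have zetaz : zeta 1 = z.
  rewrite /zeta E1; have u0 : eb - e != 0 by rewrite -opprB oppr_eq0.
  have -> : 1 - (1 - eb * z) / (1 - e * z) = z * (eb - e) / (1 - e * z) by field.
  have -> : eb - e * ((1 - eb * z) / (1 - e * z)) = (eb - e) / (1 - e * z) by field.
  by move: (eb - e) (1 - e * z) u0 n1 => u v u0 v0; field; rewrite u0 v0.
apply/eqP => f0; have := @Re_lt_vder R (fun tau => K^-1 * (zeta tau * ext_h (zeta tau)))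
  (fun tau => ext_p (zeta tau) * ext_q (zeta tau)) g_vder
  (fun t t01 => pq_pos (zeta1 t t01)).
by rewrite zeta0 zetaz f0 mul0r mulr0 ltxx.
Qed.

Lemma ext_h_neq0 z : nr z < 1 -> ext_h z != 0.
Proof.
move=> z1; have [->|z0] := eqVneq z 0; first by rewrite ext_h0 oner_neq0.
by have := ext_f_neq0 z1 z0; rewrite mulf_eq0 negb_or => /andP[].
Qed.

(** With [A = 1 - c z] and [w = z (c - z)] one has [ext_q = A - w] and [|w| <= |A|], so
    [(A + w) / (A - w) = 1 + 2 w / ext_q] has nonnegative real part. *)
Lemma ext_Re z : nr z < 1 -> 1 - m / 2 <= complex.Re (1 + z * ext_p1 z / ext_p z).
Proof.
move=> z1; have q0 := ext_q_neq0 z1.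
have -> : z * ext_p1 z / ext_p z = m%:C * (z * (c%:C - z) / ext_q z).
  rewrite /ext_p1; move: (ext_p z) (ext_p_neq0 z) => p p0.
  by field; rewrite q0.
rewrite Re_add Re_mul/= mul0r subr0.
suff : - (1 / 2) <= complex.Re (z * (c%:C - z) / ext_q z) by case/andP: m23; nra.
pose A := 1 - c%:C * z; pose w := z * (c%:C - z).
have qA : ext_q z = A - w by rewrite /ext_q /A /w; ring.
have wA : nr w <= nr A.
  apply: (@le_trans _ _ (nr (c%:C - z))).
    by rewrite /w nrM ler_piMl ?nr_ge0// ltW.
  rewrite -(ler_pXn2r (n := 2)) ?nnegrE ?nr_ge0//.
  have : nr z ^+ 2 < 1 by rewrite expr_lt1// nr_ge0.
  rewrite !nrS /A; case: (z) => x y /= h.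
  rewrite !mul0r !subr0 !addr0 !sub0r.
  case/andP: c01 => c0 c1.
  have : 0 <= (1 - c ^+ 2) * (1 - (x ^+ 2 + y ^+ 2)) by apply: mulr_ge0; nra.
  nra.
have : 0 <= complex.Re ((A + w) / (A - w)).
  rewrite -qA.
  have -> : (A + w) / ext_q z = (nr (ext_q z) ^+ 2)^-1%:C * ((A + w) * (A - w)^*).
    rewrite fmorphV/= -mul_conj qA.
    have n3 : (A - w)^* != 0 by rewrite conjC_eq0 -qA.
    have n4 : A - w != 0 by rewrite -qA.
    by move: (A + w) (A - w) ((A - w)^*) n3 n4 => u v v' u0 v0; field; rewrite u0 v0.
  rewrite Re_mul/= mul0r subr0 mulr_ge0 ?invr_ge0 ?exprn_ge0 ?nr_ge0//.
  have -> : complex.Re ((A + w) * (A - w)^*) = nr A ^+ 2 - nr w ^+ 2.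
    by rewrite !nrS; case: (A) => x y; case: (w) => x' y' /=; ring.
  by rewrite subr_ge0 ler_pXn2r ?nnegrE ?nr_ge0.
have -> : (A + w) / (A - w) = 1 + 2 * (w / ext_q z).
  by rewrite qA; field; rewrite -qA.
by rewrite mulr_natl mulr2n !Re_add/= -/w; lra.
Qed.

End Extremal.

(** * The extremal map on the Banach space *)

Section Sharpness.
Variables (R : realType) (X : completeNormedModType R[i]).

Lemma hasD_vder_op (h : R[i] -> R[i]) (T : bounded_op X R[i]^o) (x : X) (d : R[i]) :
  vder (W := R[i]^o) h (T x) d -> exists2 A : bounded_op X R[i]^o,
    forall k, A k = d * T k & hasD (W := R[i]^o) (fun y => h (T y)) x A.
Proof.
move=> hd; have [||A AE] := @bounded_op_of R X R[i]^o (fun k => d * T k) (nr d * nr T).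
- by move=> b u v; rewrite opD opZ -[b *: T u]/(b * T u) -[RHS]/(b * (d * T u) + d * T v); ring.
- move=> v; rewrite nrM -mulrA; apply: ler_wpM2l; [exact: nr_ge0|exact: (nr_op T v)].
exists A => [k|e e0]; first by rewrite AE.
have n0 : 0 < nr T + 1 by rewrite ltr_wpDl// nr_ge0.
have [r r0 H] := hd _ (divr_gt0 e0 n0).
exists (r / (nr T + 1)); first exact: divr_gt0.
move=> k; rewrite ler_pdivlMr// => kr.
have Tk : nr (T k) <= nr T * nr k by exact: nr_op.
have Tkr : nr (T k) <= r.
  by apply: le_trans kr; apply: le_trans Tk _; have := nr_ge0 k; have := nr_ge0 T; nra.
rewrite AE opD [d * _]mulrC.
apply: le_trans (H _ Tkr) _; apply: le_trans (ler_wpM2l _ Tk) _.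
  by rewrite ltW// divr_gt0.
by rewrite [nr T * _]mulrC; apply: ler_shrink; rewrite ?nr_ge0.
Qed.

Lemma hasD_scal_id (g : X -> R[i]^o) (x : X) (A : bounded_op X R[i]^o) :
  hasD g x A -> hasD (fun y => g y *: y) x (fun k => A k *: x + g x *: k).
Proof.
move=> gA e e0.
pose K := nr x + nr A + 2.
have K0 : 0 < K by rewrite /K; have := nr_ge0 x; have := nr_ge0 A; lra.
have e2 : 0 < e / 2 / K by rewrite !divr_gt0.
have [r r0 H] := gA _ e2; have [s s0 H1] := gA 1 ltr01.
exists (Order.min r (Order.min s (e / 2 / K))); first by rewrite !lt_min r0 s0.
move=> k; rewrite !le_min => /andP[/H {}H /andP[/H1 {}H1 kq]].
have -> : g (x + k) *: (x + k) - g x *: x - (A k *: x + g x *: k) =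
  (g (x + k) - g x - A k) *: x + (g (x + k) - g x) *: k.
  rewrite !scalerBl scalerDr opprD -!addrA; congr (_ + _).
  by rewrite addrCA; congr (_ + _); rewrite addrCA.
apply: le_trans (nrD _ _) _; rewrite !nrZ.
have k0 := nr_ge0 k; have x0 := nr_ge0 x; have A0 := nr_ge0 A.
have gk : nr (g (x + k) - g x) <= (1 + nr A) * nr k.
  rewrite -[g (x + k) - g x](subrK (A k)); apply: le_trans (nrD _ _) _.
  by rewrite mulrDl; apply: lerD => //; exact: (nr_op A k).
have t1 : nr (g (x + k) - g x - A k) * nr x <= e / 2 * nr k.
  apply: le_trans (ler_wpM2r x0 H) _; rewrite mulrAC ler_wpM2r//.
  by rewrite mulrAC ler_pdivrMr// ler_wpM2l ?divr_ge0 ?(ltW e0)// /K; lra.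
have t2 : nr (g (x + k) - g x) * nr k <= e / 2 * nr k.
  apply: ler_wpM2r => //; apply: le_trans gk _.
  apply: le_trans (ler_wpM2l _ kq) _; first lra.
  by rewrite mulrC mulrAC ler_pdivrMr// ler_wpM2l ?divr_ge0 ?(ltW e0)// /K; lra.
lra.
Qed.

Lemma norm_one_support : (exists x : X, x != 0) ->
  exists (x0 : X) (T : bounded_op X R[i]^o), [/\ `|x0| = 1, support_functionals x0 T &
    forall x, nr (T x) <= nr x].
Proof.
move=> [x xn]; pose x0 := `|x|^-1 *: x.
have nx : `|x| != 0 by rewrite normr_eq0.
have x01 : `|x0| = 1 by rewrite normrZ normfV normr_id mulVf.
have [T [Tx Tle]] := hahn_banach x0.
exists x0, T; split=> //; split=> //.
have nT : nr T = 1.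
  apply/eqP; rewrite eq_le; apply/andP; split.
    by apply: nr_op_le => // v; rewrite mul1r.
  have := nr_op T x0; rewrite Tx x01 /nr x01 normr1.
  by rewrite mulr1.
by rewrite nrE nT.
Qed.

Variables (c m : R).
Hypotheses (c01 : 0 <= c < 1) (m23 : 2 <= m <= 3).
Variable T : bounded_op X R[i]^o.
Hypothesis Tle : forall x, nr (T x) <= nr x.

Let h := ext_h c m.
Let p := ext_p c m.
Let p1 := ext_p1 c m.

Definition ext_map (x : X) : X := h (T x) *: x.

Let Tin x : nr x < 1 -> nr (T x) < 1.
Proof. by apply: le_lt_trans. Qed.

Lemma ext_g_holomorphic : holomorphic (fun x : X => h (T x) : R[i]^o).
Proof.
move=> x /unit_ballE/Tin/(ext_hP m c01)[d [hd _]].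
by have [A _ /hasD_frechet[]] := hasD_vder_op hd.
Qed.

Lemma ext_map_frechet x : nr x < 1 -> exists d : R[i],
  [/\ h (T x) + T x * d = p (T x), differentiable ext_map x &
   forall k, frechet ext_map x k = (d * T k) *: x + h (T x) *: k].
Proof.
move=> /Tin/(ext_hP m c01)[d [hd dE]]; exists d.
have [B BE /hasD_scal_id H] := hasD_vder_op hd.
have [||A AE] := @bounded_op_of R X X (fun k => B k *: x + h (T x) *: k)
  (nr B * nr x + nr (h (T x))).
- move=> b u v; rewrite opD opZ scalerDl !scalerDr [h _ *: (b *: u)]scalerA [h _ * b]mulrC.
  by rewrite -[(b * h _) *: u]scalerA addrACA [b *: (B u *: x)]scalerA.
- move=> v; apply: le_trans (nrD _ _) _; rewrite !nrZ mulrDl; apply: lerD => //.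
  by rewrite mulrAC; apply: ler_wpM2r; [exact: nr_ge0|exact: (nr_op B v)].
have {}H : hasD ext_map x A by rewrite AE; exact: H.
have [df fE] := hasD_frechet H.
by split=> // k; rewrite fE AE BE.
Qed.

Lemma ext_map_holomorphic : holomorphic ext_map.
Proof. by move=> x /unit_ballE/ext_map_frechet[d []]. Qed.

(** The left side is the derivative at [z = 1] of the first derivative along the line of [x], which
    equals [p (z T x) *: x]. *)
Lemma ext_map_second x : nr x < 1 ->
  mlin_diag (frechetn 2 ext_map x) x = (T x * p1 (T x)) *: x.
Proof.
move=> x1; pose psi n z := mlin_diag (frechetn n ext_map (z *: x)) x : X.
pose tau := T x.
have d n z : nr (z *: x) < 1 -> vder (psi n) z (psi n.+1 z).
  by apply: slice_vder; exact: ext_map_holomorphic.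
have psi1 z : nr (z *: x) < 1 -> psi 1%N z = p (z * tau) *: x.
  have Tz : T (z *: x) = z * tau by rewrite opZ.
  move=> /ext_map_frechet[b [bE _ bF]]; rewrite /psi/= bF; rewrite Tz in bE *.
  rewrite -bE [(h _ + _) *: x]scalerDl. rewrite scalerA [RHS]addrC; congr (_ *: _ + _); rewrite /tau; ring.
(* Keeps [(1 + k) *: x] in the ball for [|k| <= r]; the added 1 covers [x = 0]. *)
pose r := (1 - nr x) / (2 * (nr x + 1)).
have nx := nr_ge0 x.
have r0 : 0 < r by rewrite divr_gt0 ?mulr_gt0//; lra.
have near1 (k : R[i]) : nr k <= r -> nr ((1 + k) *: x) < 1.
  rewrite /r ler_pdivlMr; last by rewrite mulr_gt0//; lra.
  rewrite nrZ => kr; have := nrD 1 k; rewrite nr1; have := nr_ge0 k; nra.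
have tau1 : nr (1 * tau) < 1 by rewrite mul1r; exact: Tin.
have e1 : vder (W := R[i]^o) (fun z => z * tau) 1 tau.
  by have := @vder_mull R tau 1; congr vder; apply/funext => w; rewrite mulrC.
have H := vderZ (vder_comp e1 (ext_p_vder m c01 tau1)) (@vder_cst R X x 1).
have {}H : vder (psi 1%N) 1 ((tau * p1 tau) *: x).
  apply: (@vder_near R X _ _ _ _ r r0); last first.
    by apply: (vder_eq H); rewrite scaler0 addr0 mul1r.
  by move=> k /near1 kr; rewrite psi1.
have E := vder_unique (d 1%N 1 ltac:(by rewrite scale1r)) H.
by rewrite -E /psi scale1r.
Qed.

Lemma ext_map_op_inverse x : nr x < 1 -> op_inverses (frechet ext_map x) !=set0.
Proof.
move=> x1; have [d [dE _ F1]] := ext_map_frechet x1.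
have h0 : h (T x) != 0 by exact: (ext_h_neq0 c01 m23 (Tin x1)).
have p0 : p (T x) != 0 by exact: ext_p_neq0.
(* The Sherman-Morrison inverse of [h (T x)] times the identity plus a rank-one operator; its
   denominators [h (T x)] and [h (T x) + d T x = p (T x)] do not vanish. *)
pose G y := (h (T x))^-1 *: (y - (d * T y / p (T x)) *: x).
have Glin : linear G.
  move=> b u v; rewrite /G opD opZ -[b *: T u]/(b * T u).
  move: (h (T x))^-1 (p (T x))^-1 (T u) (T v) => a q s t.
  rewrite [b *: (a *: _)]scalerA [b * a]mulrC -[(a * b) *: _]scalerA -[RHS]scalerDr.
  congr (_ *: _); rewrite scalerBr addrACA -opprD scalerA -[in RHS]scalerDl.
  by congr (_ - _ *: _); ring.
have [|B BE] := @bounded_op_of R X X G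
  (nr (h (T x))^-1 * (1 + nr d * nr T * nr (p (T x))^-1 * nr x)) Glin.
  move=> v; rewrite /G nrZ -[X in _ <= X]mulrA ler_wpM2l ?nr_ge0//.
  apply: le_trans (nrB _ _) _; rewrite mulrDl mul1r lerD2l nrZ !nrM.
  rewrite [X in _ <= X](_ : _ = nr d * (nr T * nr v) * nr (p (T x))^-1 * nr x); last by ring.
  do 2 (apply: ler_wpM2r; first exact: nr_ge0).
  by apply: ler_wpM2l; [exact: nr_ge0|exact: (nr_op T v)].
exists B; split=> y; rewrite BE /G.
  rewrite F1 opD !opZ.
  rewrite -[(d * T y) *: T x]/(d * T y * T x) -[h (T x) *: T y]/(h (T x) * T y).
  have -> : d * (d * T y * T x + h (T x) * T y) / p (T x) = d * T y.
    rewrite (_ : d * (d * T y * T x + h (T x) * T y) = d * T y * (h (T x) + T x * d)); last by ring.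
    by rewrite dE mulfK.
  by rewrite addrAC subrr add0r scalerA mulVf// scale1r.
rewrite F1 opZ opB opZ.
rewrite -[_ *: (T y - _)]/((h (T x))^-1 * (T y - d * T y / p (T x) * T x)).
rewrite scalerA mulfV// scale1r.
have -> : d * ((h (T x))^-1 * (T y - d * T y / p (T x) * T x)) = d * T y / p (T x).
  rewrite -dE; have : h (T x) + T x * d != 0 by rewrite dE.
  by move: (h (T x)) (T x) (T y) h0 => a t s a0 b0; field; rewrite a0 b0.
by rewrite addrC subrK.
Qed.

(** Since [x] is an eigenvector of the derivative, any support functional [S] at [x] enters only
    through [S x], and the condition becomes the scalar one at the point [T x]. *)
Lemma ext_map_F_class (lambda : R) : m = 1 + 2 * lambda -> F_class lambda ext_map.
Proof.
move=> mE; split.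
- exact: ext_map_holomorphic.
- split; first by rewrite /ext_map scaler0.
  move=> k; have [d [_ _ ->]] := @ext_map_frechet 0 ltac:(by rewrite nr0).
  by rewrite scaler0 add0r op0 /h (ext_h0 c m) scale1r.
- by move=> x /unit_ballE; exact: ext_map_op_inverse.
move=> x S /unit_ballE x1 x0 [Sx _].
have [d [dE _ F1]] := ext_map_frechet x1.
have F1x : frechet ext_map x x = p (T x) *: x.
  by rewrite F1 -scalerDl -dE addrC [d * _]mulrC.
have [p0 oi] := op_inv_eigen (ext_map_op_inverse x1) x0 F1x.
rewrite ext_map_second// F1x -scalerDl !opZ oi !opZ Sx.
rewrite -[X in complex.Re X]/(`|x|^-1 * ((T x * p1 (T x) + p (T x)) * ((p (T x))^-1 * `|x|))).
have nx : `|x| != 0 :> R[i] by rewrite normr_eq0.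
rewrite [X in complex.Re X](_ : _ = 1 + T x * p1 (T x) / p (T x)).
  by apply: le_trans (ext_Re c01 m23 (Tin x1)); rewrite mE; lra.
by move: (p (T x)) (p1 (T x)) p0 => a b a0; field; rewrite a0 nx.
Qed.

End Sharpness.

(** * The value of the functional at the extremal map *)

Section ExtremalJ.
Variables (R : realType) (X : completeNormedModType R[i]).
Variables (c m lambda : R).
Hypotheses (c01 : 0 <= c < 1) (m23 : 2 <= m <= 3) (mE : m = 1 + 2 * lambda).
Variables (x0 : X) (T : bounded_op X R[i]^o).
Hypotheses (x01 : `|x0| = 1) (sT : support_functionals x0 T).
Hypothesis Tle : forall x, nr (T x) <= nr x.

(** The derivatives at 0 follow from the equation [q f'' = m (c - z) f'], differentiated twice. *)
Lemma ext_map_J23 :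
  J23 (ext_map c m T) x0 T =
  (m / 12 * ((6 + m) / 2 * c - (4 - m) * (2 + m) / 2 * c ^+ 3))%:C.
Proof.
pose f n z : R[i] := T (mlin_diag (frechetn n (ext_map c m T) (z *: x0)) x0).
have [df f10] : (forall n z, nr z < 1 -> vder (W := R[i]^o) (f n) z (f n.+1 z)) /\
    f 1%N 0 = 1.
  by have [] := @F_class_slice R X lambda (fun x => ext_h c m (T x)) (ext_map c m T) x0 T
    (fun x _ => erefl) (ext_map_F_class c01 m23 Tle mE) x01 sT.
have -> : J23 (ext_map c m T) x0 T = f 2%N 0 / 2 * (f 3%N 0 / 6) - f 4%N 0 / 24.
  exact: J23_slice.
have Tx0 : T x0 = 1 by have [->] := sT.
have f0E z : f 0%N z = z * ext_h c m z.
  have Tz : T (z *: x0) = z by rewrite opZ Tx0; exact: mulr1.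
  by rewrite /f/= /ext_map opZ Tz mulrC.
have f1E z : nr z < 1 -> f 1%N z = ext_p c m z.
  move=> z1; have H := df 0%N z z1; apply: (vder_unique H).
  by move: (ext_f_vder m c01 z1); congr vder; apply/funext => w; rewrite f0E.
have near z : nr z < 1 -> 0 < (1 - nr z) / 2 /\
    forall k : R[i], nr k <= (1 - nr z) / 2 -> nr (z + k) < 1.
  by move=> z1; split=> [|k kz]; [|have := nrD z k]; lra.
have f2E z : nr z < 1 -> f 2%N z * ext_q c z = m%:C * (c%:C - z) * f 1%N z.
  move=> z1; have [r0 H] := near z z1.
  have -> : f 2%N z = ext_p1 c m z.
    apply: (vder_unique (df 1%N z z1)).
    by apply: (vder_near r0 _ (ext_p_vder m c01 z1)) => k /H zk; rewrite f1E.
  rewrite f1E// /ext_p1; move: (ext_q c z) (ext_q_neq0 c01 z1) => q q0.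
  by field.
have q1 z : vder (W := R[i]^o) (ext_q c) z (2 * z - 2 * c%:C).
  have H := vderD (vderB (@vder_cst R R[i]^o 1 z) (@vder_mull R (2 * c%:C) z))
    (vderM (@vder_id R z) (@vder_id R z)).
  by apply: (vder_eq H); rewrite -[LHS]/(0 - 2 * c%:C + (1 * z + z * 1)); ring.
have l1 z : vder (W := R[i]^o) (fun z => m%:C * (c%:C - z)) z (- m%:C).
  have H := vderM (@vder_cst R R[i]^o m%:C z) (vderB (@vder_cst R R[i]^o c%:C z) (@vder_id R z)).
  by apply: (vder_eq H); rewrite -[LHS]/(0 * (c%:C - z) + m%:C * (0 - 1)); ring.
have f3E z : nr z < 1 -> f 3%N z * ext_q c z + f 2%N z * (2 * z - 2 * c%:C) =
    - m%:C * f 1%N z + m%:C * (c%:C - z) * f 2%N z.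
  move=> z1; have [r0 H] := near z z1.
  have A := vderM (df 2%N z z1) (q1 z); have B := vderM (l1 z) (df 1%N z z1).
  by apply: (vder_unique A); apply: (vder_near r0 _ B) => k /H zk; rewrite f2E.
have f4E : f 4%N 0 * ext_q c 0 + f 3%N 0 * (2 * 0 - 2 * c%:C) +
    (f 3%N 0 * (2 * 0 - 2 * c%:C) + f 2%N 0 * 2) =
    - m%:C * f 2%N 0 + (- m%:C * f 2%N 0 + m%:C * (c%:C - 0) * f 3%N 0).
  have z1 : nr (0 : R[i]) < 1 by rewrite nr0.
  have [r0 H] := near 0 z1.
  have l2 : vder (W := R[i]^o) (fun z : R[i] => 2 * z - 2 * c%:C) 0 2.
    have H2 := vderB (@vder_mull R 2 0) (@vder_cst R R[i]^o (2 * c%:C) 0).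
    by apply: (vder_eq H2); rewrite -[LHS]/(2 - 0 : R[i]) subr0.
  have A := vderD (vderM (df 3%N 0 z1) (q1 0)) (vderM (df 2%N 0 z1) l2).
  have B := vderD (vderM (@vder_cst R R[i]^o (- m%:C) 0) (df 1%N 0 z1))
    (vderM (l1 0) (df 2%N 0 z1)).
  have := vder_unique A (vder_near r0 _ B); rewrite mul0r add0r; apply.
  by move=> k /H zk; rewrite f3E.
have z1 : nr (0 : R[i]) < 1 by rewrite nr0.
have q00 : ext_q c 0 = 1 by rewrite /ext_q mulr0 expr0n/= subr0 addr0.
have := f2E 0 z1; rewrite q00 f10 !mulr1 subr0 => E2.
have := f3E 0 z1; rewrite q00 f10 E2 => E3.
have {}E3 : f 3%N 0 = (m%:C + 2) * c%:C * (m%:C * c%:C) - m%:C.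
  by move: E3 => /(canRL (addrK _)); rewrite mulr1 => ->; ring.
have {}f4E : f 4%N 0 = (m%:C + 4) * c%:C * f 3%N 0 - (2 * m%:C + 2) * f 2%N 0.
  move: f4E; rewrite q00 mulr1 -addrA => /(canRL (addrK _)) ->; ring.
have CM (a b : R) : (a * b)%:C = a%:C * b%:C by exact: rmorphM.
have CD (a b : R) : (a + b)%:C = a%:C + b%:C by exact: rmorphD.
have CN (a : R) : (- a)%:C = - a%:C by exact: rmorphN.
have CV (a : R) : a^-1%:C = a%:C^-1 by exact: fmorphV.
have Cn (n : nat) : (n%:R : R)%:C = n%:R by exact: rmorph_nat.
by rewrite f4E E3 E2 !exprS !(CM, CD, CN, CV, Cn, expr0); field.
Qed.

Lemma ext_map_sharp : 3 * (9 - 4 * lambda ^+ 2) * c ^+ 2 = 7 + 2 * lambda ->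
  `|J23 (ext_map c m T) x0 T| = (jbound lambda)%:C.
Proof.
move=> cE; have [c0 c1] := andP c01; have [m2 m3] := andP m23.
have JE : J23 (ext_map c m T) x0 T = (jbound lambda)%:C.
  rewrite ext_map_J23 (@jbound_sqrt R lambda c)//; last by apply/andP; split; move: mE; lra.
  (* As [c] is critical, the cubic term takes away one third of the linear term. *)
  congr (_%:C); have QE : (4 - m) * (2 + m) / 2 * c ^+ 2 = (7 + 2 * lambda) / 6.
    by rewrite -cE mE; field.
  by rewrite exprS [_ * (c * _)]mulrCA QE mE; field.
rewrite JE; apply: ger0_norm; rewrite lecR.
by rewrite /jbound !mulr_ge0 ?powR_ge0 ?invr_ge0 ?mulr_ge0 ?sqrtr_ge0//; move: mE; lra.
Qed.

End ExtremalJ.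

Theorem theorem6p1 (R : realType) (X : completeNormedModType R[i])
    (X_neq0 : exists x : X, x != 0)
    (lambda : R) (lambda_bounds : 1 / 2 <= lambda <= 1) :
  let bound : R :=
    (1 + 2 * lambda) * (7 + 2 * lambda) `^ (3 / 2) /
      (36 * Num.sqrt (3 * (9 - 4 * lambda ^+ 2))) in
  (forall (g : X -> R[i]^o) (F : X -> X),
      holomorphic g -> g 0 = 1 ->
      (forall x, unit_ball x -> F x = g x *: x) ->
      F_class lambda F ->
      forall (x0 : X) (T : bounded_op X R[i]^o),
        `|x0| = 1 -> support_functionals x0 T ->
        `|J23 F x0 T| <= bound%:C) /\
  (exists (g : X -> R[i]^o) (F : X -> X) (x0 : X) (T : bounded_op X R[i]^o),
      [/\ holomorphic g, g 0 = 1,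
          forall x, unit_ball x -> F x = g x *: x &
          F_class lambda F] /\
      [/\ `|x0| = 1, support_functionals x0 T &
          `|J23 F x0 T| = bound%:C]).
Proof.
move=> bound; split.
  by move=> g F _ _ Fg FF x0 T x01 sT; exact: J23_upper lambda_bounds Fg FF x01 sT.
have [l1 l2] := andP lambda_bounds.
(* The critical modulus from the upper bound; it is below 1 because
   [7 + 2 lambda < 3 (9 - 4 lambda^2)] on the given range. *)
pose c := Num.sqrt ((7 + 2 * lambda) / (3 * (9 - 4 * lambda ^+ 2))).
have Q0 : 0 < 3 * (9 - 4 * lambda ^+ 2) by nra.
have c2 : c ^+ 2 = (7 + 2 * lambda) / (3 * (9 - 4 * lambda ^+ 2)).
  by rewrite sqr_sqrtr// divr_ge0 ?(ltW Q0)//; lra.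
have c01 : 0 <= c < 1.
  rewrite sqrtr_ge0/= -(@ltr_pXn2r R 2)// ?nnegrE ?sqrtr_ge0// c2 expr1n.
  by rewrite ltr_pdivrMr//; nra.
have m23 : 2 <= 1 + 2 * lambda <= 3 by apply/andP; split; lra.
have [x0 [T [x01 sT Tle]]] := norm_one_support X_neq0.
exists (fun x => ext_h c (1 + 2 * lambda) (T x)), (ext_map c (1 + 2 * lambda) T), x0, T.
split; [split=> [||x _|]|split=> //].
- exact: ext_g_holomorphic.
- by rewrite op0 ext_h0.
- by [].
- exact: ext_map_F_class.
apply: ext_map_sharp => //.
by rewrite c2 mulrC divfK// gt_eqF.
Qed.
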